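(* Let $p$ be a prime different from $2$, and let $\varepsilon$ be a fixed element of $\mathbb{Z}/(p)$ which is not a square. The following is a complete list, up to isomorphism, of left braces $G$ of order $p^3$ (that is: each item below, for each allowed value of its parameter, defines a left brace, with additive group, order of the socle and isomorphism type of the multiplicative group $(G,\cdot)$ as indicated, and every left brace of order $p^3$ is isomorphic to exactly one of them). **1. Additive group $\mathbb{Z}/(p^3)$.** - Socle of order $p$: $x_1\cdot x_2=x_1+x_2+px_1x_2$; $(G,\cdot)\cong\mathbb{Z}/(p^3)$. - Socle of order $p^2$: $x_1\cdot x_2=x_1+x_2+p^2x_1x_2$; $(G,\cdot)\cong\mathbb{Z}/(p^3)$. - Socle of order $p^3$: $x_1\cdot x_2=x_1+x_2$; $(G,\cdot)\cong\mathbb{Z}/(p^3)$. **2. Additive group $\mathbb{Z}/(p)\times\mathbb{Z}/(p^2)$**, with $(x_1,y_1)\cdot(x_2,y_2)$ equal to: Socle of order $p$: - $(x_1+x_2,\;y_1+y_2+p(\varepsilon x_1+\lambda y_1)x_2+py_1y_2)$, for each $\lambda\in\{0,1,\dots,(p-1)/2\}$; $(G,\cdot)\cong\mathbb{Z}/(p)\times\mathbb{Z}/(p^2)$ if $\lambda=0$, $\cong M_3(p)$ if $\lambda\ne0$. - $(x_1+x_2,\;y_1+y_2+p(x_1+\lambda y_1)x_2+py_1y_2)$, for each $\lambda\in\{0,1,\dots,(p-1)/2\}$; $(G,\cdot)\cong\mathbb{Z}/(p)\times\mathbb{Z}/(p^2)$ if $\lambda=0$, $\cong M_3(p)$ if $\lambda\ne0$.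 - $(x_1+x_2,\;y_1+y_2+p\lambda y_1x_2+px_1y_2)$, for each $\lambda\in\{1,2,\dots,p-1\}$; $(G,\cdot)\cong\mathbb{Z}/(p)\times\mathbb{Z}/(p^2)$ if $\lambda=1$, $\cong M_3(p)$ if $\lambda\ne1$. - $(x_1+x_2,\;y_1+y_2-py_1x_2+p(x_1+y_1)y_2)$; $(G,\cdot)\cong M_3(p)$. - $(x_1+x_2+y_1y_2,\;y_1+y_2+pay_1x_2+px_1y_2+p(a-1)C(y_1,2)y_2)$, for each $a\in\{0,1,\dots,p-1\}$. If $p\neq3$: $(G,\cdot)\cong\mathbb{Z}/(p)\times\mathbb{Z}/(p^2)$ if $a=1$, $\cong M_3(p)$ if $a\neq1$. If $p=3$: $(G,\cdot)\cong\mathbb{Z}/(3)\times\mathbb{Z}/(9)$ if $a=1$, $\cong M(3)$ if $a=-1$, $\cong M_3(3)$ if $a=0$ (values of $a$ mod $3$). - $(x_1+x_2+y_1y_2,\;y_1+y_2+pay_1x_2+p\varepsilon x_1y_2+p(a-\varepsilon)C(y_1,2)y_2)$, for each $a\in\{0,1,\dots,p-1\}$. If $p\neq3$: $(G,\cdot)\cong\mathbb{Z}/(p)\times\mathbb{Z}/(p^2)$ if $a=\varepsilon$, $\cong M_3(p)$ if $a\neq\varepsilon$. If $p=3$: $(G,\cdot)\cong M_3(3)$ if $a=1$, $\cong(\mathbb{Z}/(3))^3$ if $a=-1$, $\cong M_3(3)$ if $a=0$ (values of $a$ mod $3$). Socle of order $p^2$: - $(x_1+x_2,\;y_1+y_2+px_1y_2)$;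 $(G,\cdot)\cong M_3(p)$. - $(x_1+x_2,\;y_1+y_2+py_1y_2)$; $(G,\cdot)\cong\mathbb{Z}/(p)\times\mathbb{Z}/(p^2)$. - $(x_1+x_2,\;y_1+y_2+py_1x_2)$; $(G,\cdot)\cong M_3(p)$. - $(x_1+x_2,\;y_1+y_2+px_1x_2)$; $(G,\cdot)\cong\mathbb{Z}/(p)\times\mathbb{Z}/(p^2)$. - $(x_1+x_2,\;y_1+y_2+p(x_1+y_1)x_2)$; $(G,\cdot)\cong M_3(p)$. - $(x_1+x_2+y_1y_2,\;y_1+y_2)$; $(G,\cdot)\cong\mathbb{Z}/(p)\times\mathbb{Z}/(p^2)$. - $(x_1+x_2+y_1y_2,\;y_1+y_2+py_1x_2+pC(y_1,2)y_2)$; $(G,\cdot)\cong M_3(p)$. - $(x_1+x_2+y_1y_2,\;y_1+y_2+p\varepsilon y_1x_2+p\varepsilon C(y_1,2)y_2)$; $(G,\cdot)\cong M_3(p)$. Socle of order $p^3$: - $(x_1+x_2,\;y_1+y_2)$; $(G,\cdot)\cong\mathbb{Z}/(p)\times\mathbb{Z}/(p^2)$. **3. Additive group $(\mathbb{Z}/(p))^3$**, with $(x_1,y_1,z_1)\cdot(x_2,y_2,z_2)$ equal to: Socle of order $p$: - $(x_1+x_2-z_1y_2+y_1z_2,\;y_1+y_2,\;z_1+z_2)$; $(G,\cdot)\cong M(p)$. - $(x_1+x_2+(y_1+\lambda z_1)y_2+z_1z_2,\;y_1+y_2,\;z_1+z_2)$, for each $\lambda\in\{0,1,\dots,(p-1)/2\}$;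 $(G,\cdot)\cong(\mathbb{Z}/(p))^3$ if $\lambda=0$, $\cong M(p)$ if $\lambda\neq0$. - $(x_1+x_2+(\varepsilon y_1+\lambda z_1)y_2+z_1z_2,\;y_1+y_2,\;z_1+z_2)$, for each $\lambda\in\{0,1,\dots,(p-1)/2\}$; $(G,\cdot)\cong(\mathbb{Z}/(p))^3$ if $\lambda=0$, $\cong M(p)$ if $\lambda\neq0$. - $(x_1+x_2+cz_1y_2+y_1z_2+(c-1)C(z_1,2)z_2,\;y_1+y_2+z_1z_2,\;z_1+z_2)$, for each $c\in\mathbb{Z}/(p)$. If $p=3$: $(G,\cdot)\cong M(3)$ if $c=0$, $\cong\mathbb{Z}/(3)\times\mathbb{Z}/(9)$ if $c=1$, $\cong M_3(3)$ if $c\neq0,1$. If $p\neq3$: $(G,\cdot)\cong(\mathbb{Z}/(p))^3$ if $c=1$, $\cong M(p)$ if $c\neq1$. Socle of order $p^2$: - $(x_1+x_2+y_1y_2,\;y_1+y_2,\;z_1+z_2)$; $(G,\cdot)\cong(\mathbb{Z}/(p))^3$. - $(x_1+x_2+z_1y_2,\;y_1+y_2,\;z_1+z_2)$; $(G,\cdot)\cong M(p)$. - $(x_1+x_2+z_1y_2+C(z_1,2)z_2,\;y_1+y_2+z_1z_2,\;z_1+z_2)$; $(G,\cdot)\cong M_3(3)$ if $p=3$, $\cong M(p)$ if $p\neq3$. Socle of order $p^3$: - $(x_1+x_2,\;y_1+y_2,\;z_1+z_2)$; $(G,\cdot)\cong(\mathbb{Z}/(p))^3$.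
   Context: A left brace is a set $B$ with two operations $+$ and $\cdot$ such that $(B,+)$ is an abelian group, $(B,\cdot)$ is a group, and $a\cdot(b+c)+a=a\cdot b+a\cdot c$ for all $a,b,c\in B$. A morphism of left braces is a map preserving both operations. For $a\in B$, $\lambda_a(b)=a\cdot b-a$; this is an automorphism of $(B,+)$. The socle of $B$ is $\mathrm{Soc}(B)=\{a\in B:\lambda_a=\mathrm{id}\}$. Notation: a dot denotes the brace multiplication; juxtaposition denotes ordinary ring multiplication. The additive structure of each brace is the usual componentwise addition of the indicated group. In $\mathbb{Z}/(p)\times\mathbb{Z}/(p^2)$, elements are written $(x,y)$ with $x\in\mathbb{Z}/(p)$, $y\in\mathbb{Z}/(p^2)$; expressions in the first component are reduced mod $p$ and those in the second component mod $p^2$ (for $u$ defined mod $p$, $pu$ is a well-defined element of $\mathbb{Z}/(p^2)$). $C(n,m)$ denotes the binomial coefficient, equal to $\frac{n!}{m!(n-m)!}$ if $n\ge m$ and to $0$ if $n<m$; in $C(y_1,2)$ and $C(z_1,2)$ the argument is represented by a non-negative integer (the value mod $p$ does not depend on the choice, as $p$ is odd). For an odd prime $p$, $M(p)=\langle x,y,z\mid x^p=y^p=z^p=1,\ [x,z]=[y,z]=1,\ [x,y]=z\rangle$ (the non-abelian group of order $p^3$ and exponent $p$), and $M_3(p)=\langle x,y\mid x^{p^2}=y^p=1,\ y^{-1}xy=x^{1+p}\rangle$ (the non-abelian group of order $p^3$ and exponent $p^2$).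
   Formalization: For p = 3, the last brace with additive group Z/(p)×Z/(p²) and socle of order p² (the one with pεy₁x₂ + pεC(y₁,2)y₂) is stated to have multiplicative group M(3) instead of M_3(3), since there ε = −1 and every element has order dividing 3. *)

(* Defs.v *)
From HB Require Import structures.
From mathcomp Require Import all_boot all_order all_algebra all_fingroup.

Set Implicit Arguments.
Unset Strict Implicit.
Unset Printing Implicit Defensive.

Import GRing.Theory.
Local Open Scope ring_scope.

(* The library does not join the product instances into a finZmodType. *)
HB.saturate prod.

Definition is_group (T : Type) (op : T -> T -> T) : Prop :=
  associative op /\
  exists (e : T) (inv : T -> T),
    [/\ left_id e op, right_id e op, left_inverse e inv op
      & right_inverse e inv op].

(* The additive abelian group of the brace is the zmodType B itself; only the
   second operation is a parameter. *)
Record left_brace (B : zmodType) (op : B -> B -> B) : Prop := LeftBrace {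
  brace_mul_group : is_group op;
  brace_compat : forall a b c, op a (b + c) + a = op a b + op a c
}.

Definition brace_lambda (B : zmodType) (op : B -> B -> B) (a b : B) : B :=
  op a b - a.

Definition socle (B : finZmodType) (op : B -> B -> B) : {set B} :=
  [set a | [forall b, brace_lambda op a b == b]].

Definition brace_morphism (A B : zmodType) (opA : A -> A -> A)
    (opB : B -> B -> B) (f : A -> B) : Prop :=
  {morph f : a b / a + b} /\ {morph f : a b / opA a b >-> opB a b}.

Definition brace_isog (A B : zmodType) (opA : A -> A -> A)
    (opB : B -> B -> B) : Prop :=
  exists2 f : A -> B, bijective f & brace_morphism opA opB f.

(* [mul_group_type op P]: the group (B, op) is isomorphic to a finite group
   satisfying P; used below only for isomorphism-invariant P. *)
Definition mul_group_type (B : Type) (op : B -> B -> B)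
    (P : finGroupType -> Prop) : Prop :=
  exists (gT : finGroupType) (f : B -> gT),
    [/\ bijective f, {morph f : a b / op a b >-> (a * b)%g} & P gT].

(* The canonical group law on 'F_p and 'Z_n is their addition. *)
Definition is_Zp3 (p : nat) (gT : finGroupType) : Prop :=
  [set: gT] \isog [set: 'Z_(p ^ 3)].

Definition is_Zp_Zp2 (p : nat) (gT : finGroupType) : Prop :=
  [set: gT] \isog [set: ('F_p * 'Z_(p ^ 2))%type].

Definition is_Zp_cube (p : nat) (gT : finGroupType) : Prop :=
  [set: gT] \isog [set: ('F_p * 'F_p * 'F_p)%type].

Definition is_M (p : nat) (gT : finGroupType) : Prop :=
  ([set: gT] \isog Grp (x : y : z : x ^+ p = y ^+ p = 1, z ^+ p = 1,
                        [~ x, z] = [~ y, z] = 1, [~ x, y] = z))%g.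

Definition is_M3 (p : nat) (gT : finGroupType) : Prop :=
  ([set: gT] \isog Grp (x : y : x ^+ (p ^ 2)%N = y ^+ p = 1,
                        y^-1 * x * y = x ^+ (1 + p)%N))%g.

Definition redp (p : nat) (y : 'Z_(p ^ 2)) : 'F_p := (y : nat)%:R.

(* The element p u of Z/(p^2), which depends only on u modulo p. *)
Definition ptimes (p : nat) (u : 'F_p) : 'Z_(p ^ 2) := (p * u)%N%:R.

(* C(n, 2) modulo p; applied to the canonical non-negative representatives of
   elements of Z/(p^2) or Z/(p). *)
Definition bin2p (p : nat) (n : nat) : 'F_p := 'C(n, 2)%:R.

(* One line of the classification: additive group, multiplication, order of
   the socle, isomorphism type of the multiplicative group. *)
Record brace_entry := BraceEntry {
  entry_carrier : finZmodType;
  entry_mul : entry_carrier -> entry_carrier -> entry_carrier;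
  entry_socle_order : nat;
  entry_mul_type : finGroupType -> Prop
}.

(* Cyc, Mix and Elem stand for the additive groups Z/(p^3), Z/(p) x Z/(p^2)
   and (Z/(p))^3; the suffix s_k indicates a socle of order p^k. *)
Inductive brace_index (p : nat) : Type :=
  | Cyc_s1 | Cyc_s2 | Cyc_s3
  | Mix_s1_a of nat | Mix_s1_b of nat | Mix_s1_c of nat | Mix_s1_d
  | Mix_s1_e of nat | Mix_s1_f of nat
  | Mix_s2_a | Mix_s2_b | Mix_s2_c | Mix_s2_d
  | Mix_s2_e | Mix_s2_f | Mix_s2_g | Mix_s2_h
  | Mix_s3
  | Elem_s1_a | Elem_s1_b of nat | Elem_s1_c of nat | Elem_s1_d of 'F_p
  | Elem_s2_a | Elem_s2_b | Elem_s2_c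
  | Elem_s3.

Definition allowed (p : nat) (i : brace_index p) : bool :=
  match i with
  | Mix_s1_a l | Mix_s1_b l | Elem_s1_b l | Elem_s1_c l => (l <= p.-1./2)%N
  | Mix_s1_c l => (1 <= l <= p.-1)%N
  | Mix_s1_e a | Mix_s1_f a => (a <= p.-1)%N
  | _ => true
  end.

Definition cyc_entry (p : nat)
    (op : 'Z_(p ^ 3) -> 'Z_(p ^ 3) -> 'Z_(p ^ 3)) (s : nat)
    (P : nat -> finGroupType -> Prop) : brace_entry :=
  @BraceEntry 'Z_(p ^ 3) op s (P p).

Definition mix_entry (p : nat)
    (op : 'F_p -> 'Z_(p ^ 2) -> 'F_p -> 'Z_(p ^ 2) -> 'F_p * 'Z_(p ^ 2))
    (s : nat) (P : nat -> finGroupType -> Prop) : brace_entry :=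
  @BraceEntry ('F_p * 'Z_(p ^ 2))%type
    (fun a b => op a.1 a.2 b.1 b.2) s (P p).

Definition elem_entry (p : nat)
    (op : 'F_p -> 'F_p -> 'F_p -> 'F_p -> 'F_p -> 'F_p -> 'F_p * 'F_p * 'F_p)
    (s : nat) (P : nat -> finGroupType -> Prop) : brace_entry :=
  @BraceEntry ('F_p * 'F_p * 'F_p)%type
    (fun a b => op a.1.1 a.1.2 a.2 b.1.1 b.1.2 b.2) s (P p).

Arguments cyc_entry : clear implicits.
Arguments mix_entry : clear implicits.
Arguments elem_entry : clear implicits.

(* For p = 3 the multiplicative group of Mix_s2_h is M(3) and not M_3(3): then
   eps = -1, and the non-abelian group obtained has exponent 3. *)
Definition brace_table (p : nat) (eps : 'F_p) (i : brace_index p) : brace_entry :=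
  let m := @redp p in
  let pt := @ptimes p in
  let C2 := bin2p p in
  match i with
  | Cyc_s1 => cyc_entry p (fun x1 x2 => x1 + x2 + p%:R * x1 * x2) p is_Zp3
  | Cyc_s2 =>
      cyc_entry p (fun x1 x2 => x1 + x2 + (p ^ 2)%N%:R * x1 * x2) (p ^ 2) is_Zp3
  | Cyc_s3 => cyc_entry p (fun x1 x2 => x1 + x2) (p ^ 3) is_Zp3

  | Mix_s1_a l =>
      mix_entry p (fun x1 y1 x2 y2 =>
        (x1 + x2,
         y1 + y2 + pt ((eps * x1 + l%:R * m y1) * x2) + pt (m y1 * m y2)))
        p (if l == 0%N then is_Zp_Zp2 else is_M3)
  | Mix_s1_b l =>
      mix_entry p (fun x1 y1 x2 y2 =>
        (x1 + x2,
         y1 + y2 + pt ((x1 + l%:R * m y1) * x2) + pt (m y1 * m y2)))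
        p (if l == 0%N then is_Zp_Zp2 else is_M3)
  | Mix_s1_c l =>
      mix_entry p (fun x1 y1 x2 y2 =>
        (x1 + x2, y1 + y2 + pt (l%:R * m y1 * x2) + pt (x1 * m y2)))
        p (if l == 1%N then is_Zp_Zp2 else is_M3)
  | Mix_s1_d =>
      mix_entry p (fun x1 y1 x2 y2 =>
        (x1 + x2, y1 + y2 - pt (m y1 * x2) + pt ((x1 + m y1) * m y2)))
        p is_M3
  | Mix_s1_e a =>
      mix_entry p (fun x1 y1 x2 y2 =>
        (x1 + x2 + m y1 * m y2,
         y1 + y2 + pt (a%:R * m y1 * x2) + pt (x1 * m y2)
           + pt ((a%:R - 1) * C2 y1 * m y2)))
        p (if p != 3%N then
             if a%:R == 1 :> 'F_p then is_Zp_Zp2 else is_M3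
           else
             if a%:R == 1 :> 'F_p then is_Zp_Zp2
             else if a%:R == -1 :> 'F_p then is_M
             else is_M3)
  | Mix_s1_f a =>
      mix_entry p (fun x1 y1 x2 y2 =>
        (x1 + x2 + m y1 * m y2,
         y1 + y2 + pt (a%:R * m y1 * x2) + pt (eps * x1 * m y2)
           + pt ((a%:R - eps) * C2 y1 * m y2)))
        p (if p != 3%N then
             if a%:R == eps then is_Zp_Zp2 else is_M3
           else
             if a%:R == 1 :> 'F_p then is_M3
             else if a%:R == -1 :> 'F_p then is_Zp_cube
             else is_M3)

  | Mix_s2_a =>
      mix_entry p (fun x1 y1 x2 y2 => (x1 + x2, y1 + y2 + pt (x1 * m y2)))
        (p ^ 2) is_M3
  | Mix_s2_b =>
      mix_entry p (fun x1 y1 x2 y2 => (x1 + x2, y1 + y2 + pt (m y1 * m y2)))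
        (p ^ 2) is_Zp_Zp2
  | Mix_s2_c =>
      mix_entry p (fun x1 y1 x2 y2 => (x1 + x2, y1 + y2 + pt (m y1 * x2)))
        (p ^ 2) is_M3
  | Mix_s2_d =>
      mix_entry p (fun x1 y1 x2 y2 => (x1 + x2, y1 + y2 + pt (x1 * x2)))
        (p ^ 2) is_Zp_Zp2
  | Mix_s2_e =>
      mix_entry p (fun x1 y1 x2 y2 =>
        (x1 + x2, y1 + y2 + pt ((x1 + m y1) * x2)))
        (p ^ 2) is_M3
  | Mix_s2_f =>
      mix_entry p (fun x1 y1 x2 y2 => (x1 + x2 + m y1 * m y2, y1 + y2))
        (p ^ 2) is_Zp_Zp2
  | Mix_s2_g =>
      mix_entry p (fun x1 y1 x2 y2 =>
        (x1 + x2 + m y1 * m y2,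
         y1 + y2 + pt (m y1 * x2) + pt (C2 y1 * m y2)))
        (p ^ 2) is_M3
  | Mix_s2_h =>
      mix_entry p (fun x1 y1 x2 y2 =>
        (x1 + x2 + m y1 * m y2,
         y1 + y2 + pt (eps * m y1 * x2) + pt (eps * C2 y1 * m y2)))
        (p ^ 2) (if p != 3%N then is_M3 else is_M)

  | Mix_s3 =>
      mix_entry p (fun x1 y1 x2 y2 => (x1 + x2, y1 + y2)) (p ^ 3) is_Zp_Zp2

  | Elem_s1_a =>
      elem_entry p (fun x1 y1 z1 x2 y2 z2 =>
        (x1 + x2 - z1 * y2 + y1 * z2, y1 + y2, z1 + z2))
        p is_M
  | Elem_s1_b l =>
      elem_entry p (fun x1 y1 z1 x2 y2 z2 =>
        (x1 + x2 + (y1 + l%:R * z1) * y2 + z1 * z2, y1 + y2, z1 + z2))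
        p (if l == 0%N then is_Zp_cube else is_M)
  | Elem_s1_c l =>
      elem_entry p (fun x1 y1 z1 x2 y2 z2 =>
        (x1 + x2 + (eps * y1 + l%:R * z1) * y2 + z1 * z2, y1 + y2, z1 + z2))
        p (if l == 0%N then is_Zp_cube else is_M)
  | Elem_s1_d c =>
      elem_entry p (fun x1 y1 z1 x2 y2 z2 =>
        (x1 + x2 + c * z1 * y2 + y1 * z2 + (c - 1) * C2 z1 * z2,
         y1 + y2 + z1 * z2, z1 + z2))
        p (if p == 3%N then
             if c == 0 then is_M
             else if c == 1 then is_Zp_Zp2
             else is_M3
           else
             if c == 1 then is_Zp_cube else is_M)

  | Elem_s2_a =>
      elem_entry p (fun x1 y1 z1 x2 y2 z2 =>
        (x1 + x2 + y1 * y2, y1 + y2, z1 + z2))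
        (p ^ 2) is_Zp_cube
  | Elem_s2_b =>
      elem_entry p (fun x1 y1 z1 x2 y2 z2 =>
        (x1 + x2 + z1 * y2, y1 + y2, z1 + z2))
        (p ^ 2) is_M
  | Elem_s2_c =>
      elem_entry p (fun x1 y1 z1 x2 y2 z2 =>
        (x1 + x2 + z1 * y2 + C2 z1 * z2, y1 + y2 + z1 * z2, z1 + z2))
        (p ^ 2) (if p == 3%N then is_M3 else is_M)

  | Elem_s3 =>
      elem_entry p (fun x1 y1 z1 x2 y2 z2 => (x1 + x2, y1 + y2, z1 + z2))
        (p ^ 3) is_Zp_cube
  end.

(* Main.v *)
(** Write a * b = a . b - a - b; it is additive in b, and a lies in the socle
    iff a * b = 0 for all b.  An orbit count modulo p gives every nonzero brace
    of order p^k a flag of additive subgroups stable under all the maps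
    b |-> a * b.  If the additive group has exponent p^3, it is generated by
    some y and the brace is determined by s in y . y = 2 y + s y, a multiple of
    p, which can be normalized to a power of p.  Otherwise there is a line
    <e1> that is annihilated on both sides by * and contains p B (if the socle
    were trivial, lambda would map onto the full unitriangular group, which is
    incompatible with the order of the elements in the flag).  In coordinates
    Y, Z on B / <e1>, with u = (_, y1, z1) and v = (_, y2, z2), associativity
    leaves only the products

      u . v = u + v + j1 (q (y1, z1, y2, z2)) + j2 (b z1 z2),
      q = (a1 y1 + a2 z1) y2 + (g y1 + (a2 - g) b z1^2 / 2 + e z1) z2

    with a1 b = 0, so that a brace is given by (b, a1, a2, g, e).  When b = 0
    these are bilinear forms, classified by their skew part and determinant up
    to the linear changes of coordinates allowed by the additive group; when
    b != 0 the triple products u * (v * w) and (u * v) * w give the invariants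
    a2 b and g b.  The group (B, .) is commutative iff a2 = g, and its type
    follows from the p-th powers
    v^p = p v + j2 (C(p, 2) b z^2) + j1 (C(p, 2) q (v, v) + C(p, 3) b a2 z^3),
    where C(p, 3) is divisible by p unless p = 3. *)
Require Import Defs.
From HB Require Import structures.
From mathcomp Require Import all_boot all_order all_algebra all_fingroup.
From mathcomp Require Import all_solvable ring zify.

Set Implicit Arguments.
Unset Strict Implicit.
Unset Printing Implicit Defensive.

Import GRing.Theory.

(** * Groups of order p^3 *)

(** The obstacle is that * is additive only in its second argument: in the first one, lambda turns
    the product of (B, .), not the sum, into composition. Left annihilation by a multiple of an
    element is therefore reached by writing the multiple as a product. The same tension produces the
    shape of q. The coefficient of e1 in a * e3 is a homomorphism on (B, .) up to a correction;
    rewriting products as sums leaves a cross term (a2 - g) b z z', which the quadratic function (a2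
    - g) b z^2 / 2 absorbs, and this is one use of p odd. Comparing a + b with b + a in the same
    computation gives a1 b = 0. Since C(z, 2) = (z^2 - z) / 2, the binomial terms of the table are
    this quadratic term plus a linear one, whence values of e such as -(a - 1) / 2. Both non-cyclic
    additive groups carry the same kind of coordinates, so the group law, powers and socle are
    computed once; they differ in the admissible changes of coordinates and in whether p v
    vanishes. *)

Section GroupsOfOrderP3.
Local Open Scope group_scope.
Variables (p : nat) (gT : finGroupType).
Hypotheses (p_pr : prime p) (p_odd : p != 2).
Hypothesis oG : #|[set: gT]| = (p ^ 3)%N.

Let pG : p.-group [set: gT].
Proof. by rewrite /pgroup oG pnatX pnat_id. Qed.

Lemma p3group_is_Zp3 (x : gT) : x ^+ (p ^ 2)%N != 1 -> is_Zp3 p gT.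
Proof.
move=> xn1; rewrite /is_Zp3.
have ox : #[x] = (p ^ 3)%N.
  have : #[x] %| (p ^ 3)%N by rewrite -oG order_dvdG ?inE.
  case/(dvdn_pfactor _ _ p_pr) => m lem ox; rewrite ox; congr (_ ^ _)%N.
  apply/eqP; rewrite eqn_leq lem ltnNge; apply: contra xn1 => lem2.
  by rewrite -order_dvdn ox dvdn_exp2l.
have cG : cyclic [set: gT].
  apply/cyclicP; exists x; apply/esym/eqP.
  by rewrite eqEcard subsetT /= oG -ox.
rewrite isog_cyclic_card // oG /= cardsT card_ord.
rewrite Zp_cast; last by rewrite -(exp1n 3) ltn_exp2r // prime_gt1.
rewrite eqxx andbT; have /= := Zp_cycle (Zp_trunc (p ^ 3)).+1 => ->.
by apply: cycle_cyclic.
Qed.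

Lemma p3group_is_Zp_cube :
  abelian [set: gT] -> (forall x : gT, x ^+ p = 1) -> is_Zp_cube p gT.
Proof.
move=> cG xp; rewrite /is_Zp_cube (@isog_abelem_card _ _ p); last first.
  by apply/abelemP => //; split => // x _.
rewrite !cardsT !card_prod !card_Fp // -cardsT oG -mulnA eqxx andbT.
apply/abelemP => //; split.
  apply/centsP => -[[a1 a2] a3] _ [[b1 b2] b3] _.
  by rewrite /commute; congr (_, _, _); apply: addrC.
move=> [[a1 a2] a3] _.
have H (a : 'F_p) : (a ^+ p)%g = 1%g :> 'F_p.
  by rewrite FinRing.zmodXgE -mulr_natr pchar_Fp_0 // mulr0.
have K n : ((a1, a2, a3) : 'F_p * 'F_p * 'F_p) ^+ n = (a1 ^+ n, a2 ^+ n, a3 ^+ n).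
  by elim: n => // n IH; rewrite !expgS IH.
by rewrite K !H.
Qed.

End GroupsOfOrderP3.

Section AbelianMixed.
Local Open Scope group_scope.
Variables (p : nat).
Hypotheses (p_pr : prime p).

(** The invariant factors multiply to p^3 and the first one is the exponent p^2, so the others
    multiply to the prime p and there is only one of them. *)
Lemma abelian_type_p3_exp_p2 (gT : finGroupType) (G : {group gT}) :
  abelian G -> #|G| = (p ^ 3)%N -> exponent G = (p ^ 2)%N ->
  abelian_type G = [:: p ^ 2; p]%N.
Proof.
move=> cG oG eG; have p1 := prime_gt1 p_pr; have p0 := prime_gt0 p_pr.
have prodT : (\prod_(m <- abelian_type G) m = p ^ 3)%N.
  case/abelian_structure: cG => b /bigdprod_card defG <-.
  by rewrite -oG -defG big_map.
move: prodT (abelian_type_gt1 G); rewrite /abelian_type.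
case E: #|G| => [|n] /=; first by rewrite E in oG; move: oG; case: (p) p0.
set t := abelian_type_rec _ _; have -> : <<G>> = G by rewrite genGid.
rewrite -cardG_gt1 oG -(exp1n 3) ltn_exp2r // cG p1 /= eG.
rewrite big_cons => /eqP.
rewrite (expnS p 2) mulnC eqn_pmul2r ?expn_gt0 ?p0 // => /eqP prodt /andP[_ t1].
congr (_ :: _); case: t prodt t1 => [|m t].
  by rewrite big_nil => E1; rewrite -E1 in p1.
rewrite big_cons /= => mt /andP[m1 t1].
have mp : m = p.
  have : m %| p by rewrite -mt dvdn_mulr.
  by move/(prime_nt_dvdP p_pr) => -> //; rewrite neq_ltn m1 orbT.
rewrite mp; congr (_ :: _); move: mt; rewrite mp => /eqP; rewrite -{2}(muln1 p) eqn_pmul2l //.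
case: t t1 => // a t /= /andP[a1 _]; rewrite big_cons => /eqP at1.
have : a %| 1 by rewrite -at1 dvdn_mulr.
by rewrite dvdn1 => /eqP a11; rewrite a11 in a1.
Qed.

Lemma p3group_exponent_p2 (gT : finGroupType) (x : gT) :
  (forall y : gT, y ^+ (p ^ 2)%N = 1) -> x ^+ p != 1 ->
  exponent [set: gT] = (p ^ 2)%N.
Proof.
move=> yp2 xp; apply/eqP; rewrite eqn_dvd.
apply/andP; split; first by apply/exponentP => y _.
have ox : #[x] = (p ^ 2)%N.
  have : #[x] %| (p ^ 2)%N by rewrite order_dvdn yp2.
  case/(dvdn_pfactor _ _ p_pr) => m lem ox; rewrite ox; congr (_ ^ _)%N.
  apply/eqP; rewrite eqn_leq lem ltnNge; apply: contra xp => lem2.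
  by rewrite -order_dvdn ox -[p in _ %| p]expn1 dvdn_exp2l.
by rewrite -ox dvdn_exponent ?inE.
Qed.

Lemma p3group_is_Zp_Zp2 (gT : finGroupType) (x : gT) :
  #|[set: gT]| = (p ^ 3)%N -> abelian [set: gT] ->
  (forall y : gT, y ^+ (p ^ 2)%N = 1) -> x ^+ p != 1 -> is_Zp_Zp2 p gT.
Proof.
move=> oG cG yp2 xp; rewrite /is_Zp_Zp2; have p1 := prime_gt1 p_pr.
have p21 : 1 < p ^ 2 by rewrite -(exp1n 2) ltn_exp2r.
have cH : abelian [set: ('F_p * 'Z_(p ^ 2))%type].
  apply/centsP => -[a1 a2] _ [b1 b2] _.
  by rewrite /commute; congr (_, _); apply: addrC.
have K n (a : 'F_p) (b : 'Z_(p ^ 2)) :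
    ((a, b) : ('F_p * 'Z_(p ^ 2))%type) ^+ n = ((a *+ n)%R, (b *+ n)%R).
  by elim: n => // n IH; rewrite expgS IH !mulrS.
rewrite eq_abelian_type_isog // !abelian_type_p3_exp_p2 //.
- by rewrite cardsT card_prod card_Fp // card_ord Zp_cast // -expnS.
- apply: (p3group_exponent_p2 (x := (0%R : 'F_p, 1%R : 'Z_(p ^ 2)))) => [[a b]|].
    rewrite K -mulr_natr -[X in (_, X)]mulr_natr pchar_Zp // mulr0.
    by rewrite natrX pchar_Fp_0 // expr0n /= mulr0.
  rewrite K mul0rn; apply/eqP => -[] /(congr1 val) /=.
  rewrite val_Zp_nat // modn_small ?expnS ?expn0 ?muln1 //; last by rewrite ltn_Pmull // ltnW.
  by move=> p0; rewrite p0 in p1.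
- exact: p3group_exponent_p2 xp.
Qed.

(** A non-abelian group of order p^3 is extraspecial, and exponent p makes it p^{1+2}. That group is
    presented by x and y alone; the two presentations are matched by sending z to [x, y]. *)
Lemma p3group_is_M (gT : finGroupType) :
  #|[set: gT]| = (p ^ 3)%N -> ~~ abelian [set: gT] ->
  (forall y : gT, y ^+ p = 1) -> is_M p gT.
Proof.
move=> oG ncG yp.
have pG : p.-group [set: gT] by rewrite /pgroup oG pnatX pnat_id.
have esG : extraspecial [set: gT].
  by apply: (p3group_extraspecial pG) => //; rewrite oG pfactorK.
have isoG : [set: gT] \isog p^{1+2}.
  by apply: isog_pX1p2 => //; apply/exponentP => y _.
move=> rT H; have := isoGrp_trans isoG (Grp_pX1p2 p_pr) => /(_ rT H) ->.
apply/existsP/existsP => /=.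
  case=> -[x y] /= /eqP [defH xp y_p xyx xyy].
  exists ((x, y), [~ x, y]) => /=; apply/eqP.
  have zH : [~ x, y] \in H.
    by rewrite -defH groupR // ?mem_gen // inE cycle_id ?orbT.
  have cxz : commute x [~ x, y] by apply/esym/commgP/eqP.
  have cyz : commute y [~ x, y] by apply/esym/commgP/eqP.
  congr (_, (_, (_, (_, (_, (_, _)))))) => //.
  - by rewrite defH joingE (setUidPl _) ?genGid // cycle_subG.
  - by rewrite -commXg // xp comm1g.
  - exact/eqP/commgP.
  - exact/eqP/commgP.
case=> -[[x y] z] /= /eqP [defH xp y_p zp xz yz xyz]; subst z.
exists (x, y) => /=; apply/eqP.
have cxz : commute [~ x, y] x by apply/esym/commgP/eqP.
have cyz : commute [~ x, y] y by apply/esym/commgP/eqP.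
have defH' : <[x]> <*> <[y]> = H.
  rewrite -defH [RHS]joingE (setUidPl _) ?genGid //=.
  by rewrite cycle_subG groupR // ?mem_gen // inE cycle_id ?orbT.
by congr (_, (_, (_, (_, _)))) => //; apply/eqP/commgP.
Qed.

(** The element x generates a cyclic subgroup of order p^2, hence of index p, and for odd p a
    non-abelian p-group with such a subgroup is modular. *)
Lemma p3group_is_M3 (gT : finGroupType) (x : gT) : p != 2 ->
  #|[set: gT]| = (p ^ 3)%N -> ~~ abelian [set: gT] ->
  x ^+ p != 1 -> is_M3 p gT.
Proof.
move=> p2 oG ncG xp.
have pG : p.-group [set: gT] by rewrite /pgroup oG pnatX pnat_id.
have p1 := prime_gt1 p_pr.
have ox : #[x] = (p ^ 2)%N.
  have : #[x] %| (p ^ 3)%N by rewrite -oG order_dvdG ?inE.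
  case/(dvdn_pfactor _ _ p_pr) => m lem ox; rewrite ox; congr (_ ^ _)%N.
  apply/eqP; rewrite eqn_leq andbC ltnNge; apply/andP; split.
    by apply: contra xp => lem2; rewrite -order_dvdn ox -[p in _ %| p]expn1 dvdn_exp2l.
  rewrite -ltnS ltn_neqAle lem andbT; apply: contra ncG => /eqP m3.
  suff -> : [set: gT] = <[x]> by apply: cycle_abelian.
  by apply/esym/eqP; rewrite eqEcard subsetT /= oG -orderE ox m3.
have isoG : [set: gT] \isog 'Mod_(p ^ 3).
  have idx : #|[set: gT] : <[x]>| = p.
    by rewrite -divgS ?subsetT //= -orderE ox oG -expnB ?prime_gt0.
  have := maximal_cycle_extremal pG ncG (cycle_cyclic x) (subsetT _) idx.
  rewrite (negPf p2) /= orbF => /eqP /modular_group_classP.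
  case=> q q_pr [n n3 isoG].
  have n2 : n > 2 by apply: leq_trans n3; rewrite leq_addl.
  have := card_isog isoG; rewrite oG card_modular_group //= => E.
  have qp : q = p.
    apply/eqP; rewrite -dvdn_prime2 //; have : q %| p ^ 3.
      by rewrite E -[q in q %| _]expn1 dvdn_exp2l // ltnW // ltnW.
    by rewrite Euclid_dvdX // andbT.
  move: E isoG; rewrite qp => /eqP; rewrite eqn_exp2l // => /eqP <- //.
have nlt : 2 < 3 by [].
move=> rT H; have := isoGrp_trans isoG (Grp_modular_group p_pr nlt) => /(_ rT H) ->.
apply/existsP/existsP => /= -[[a b] /= /eqP [defH ap bp ab]];
  exists (a, b); apply/eqP => /=; congr (_, (_, (_, _))) => //.
- by rewrite -mulgA -conjgE ab expn1 add1n.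
- by rewrite conjgE mulgA ab expn1 add1n.
Qed.
End AbelianMixed.

Local Open Scope ring_scope.

(** * A normalizer for identities in abelian groups *)

Inductive zexpr := ZVar of nat | ZZero | ZAdd of zexpr & zexpr | ZOpp of zexpr
  | ZMuln of zexpr & nat.

Fixpoint zeval (V : zmodType) (env : seq V) e : V :=
  match e with
  | ZVar i => nth 0 env i
  | ZZero => 0
  | ZAdd e1 e2 => zeval env e1 + zeval env e2
  | ZOpp e1 => - zeval env e1
  | ZMuln e1 n => zeval env e1 *+ n
  end.

Fixpoint zcoef e (i : nat) : int :=
  match e with
  | ZVar j => (i == j)%:R
  | ZZero => 0
  | ZAdd e1 e2 => zcoef e1 i + zcoef e2 i
  | ZOpp e1 => - zcoef e1 i
  | ZMuln e1 n => zcoef e1 i *+ n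
  end.

Lemma zevalE (V : zmodType) (env : seq V) e :
  zeval env e = \sum_(i < size env) env`_i *~ zcoef e i.
Proof.
elim: e => [j||e1 IH1 e2 IH2|e1 IH1|e1 IH1 n] /=.
- case: (ltnP j (size env)) => ji; last first.
    rewrite nth_default // big1 // => i _.
    by rewrite (_ : (i == j :> nat) = false) ?mulr0z //; apply/negbTE;
      rewrite neq_ltn (leq_trans (ltn_ord i) ji).
  rewrite (bigD1 (Ordinal ji)) //= eqxx mulr1z big1 ?addr0 // => i ij.
  by rewrite (_ : (i == j :> nat) = false) ?mulr0z //; apply/negbTE.
- by rewrite big1 // => i _; rewrite mulr0z.
- by rewrite IH1 IH2 -big_split; apply: eq_bigr => i _; rewrite mulrzDr.
- by rewrite IH1 -sumrN; apply: eq_bigr => i _; rewrite mulrNz.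
- rewrite IH1 -sumrMnl; apply: eq_bigr => i _.
  by elim: n => [|n IH]; rewrite ?mulr0z // !mulrS mulrzDr IH.
Qed.

Lemma zeval_eq (V : zmodType) (env : seq V) e1 e2 :
  all (fun i => zcoef e1 i == zcoef e2 i) (iota 0 (size env)) ->
  zeval env e1 = zeval env e2.
Proof.
move=> /allP E; rewrite !zevalE; apply: eq_bigr => i _.
by rewrite (eqP (E (val i) _)) // mem_iota add0n ltn_ord.
Qed.

(* Atoms are compared up to unification, since the same element may be typed
   through different canonical structures. *)
Ltac zsame x y :=
  match goal with
  | _ => let _ := match goal with _ => unify x y end in constr:(true)
  | _ => constr:(false)
  end.

Ltac zmem x l :=
  lazymatch l with
  | nil => constr:(false)
  | cons ?y ?l' =>
    let b := zsame x y in
    lazymatch b with true => constr:(true) | false => zmem x l' end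
  end.

(** Only multiples by the literals 2 and 3 are opened, which keeps all coefficients closed integers;
    any other multiple, such as [x *+ n], is an atom. *)
Ltac zatoms t l :=
  lazymatch t with
  | (?a + ?b) => let l1 := zatoms a l in zatoms b l1
  | (- ?a) => zatoms a l
  | (?a *+ 2) => zatoms a l
  | (?a *+ 3) => zatoms a l
  | 0 => l
  | _ => lazymatch zmem t l with
         | true => l
         | false => constr:(cons t l)
         end
  end.

Ltac zindex x l :=
  lazymatch l with
  | cons ?y ?l' =>
    let b := zsame x y in
    lazymatch b with
    | true => constr:(O)
    | false => let n := zindex x l' in constr:(S n)
    end
  end.

Ltac zreify t l :=
  lazymatch t with
  | (?a + ?b) =>
      let x := zreify a l in let y := zreify b l in constr:(ZAdd x y)
  | (- ?a) => let x := zreify a l in constr:(ZOpp x)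
  | (?a *+ 2) => let x := zreify a l in constr:(ZMuln x 2)
  | (?a *+ 3) => let x := zreify a l in constr:(ZMuln x 3)
  | 0 => constr:(ZZero)
  | _ => let i := zindex t l in constr:(ZVar i)
  end.

Ltac zmod :=
  lazymatch goal with
  | |- @eq ?T ?a ?b =>
    let l := zatoms a (@nil T) in
    let l := zatoms b l in
    let x := zreify a l in
    let y := zreify b l in
    refine (@zeval_eq _ l x y _); vm_compute; reflexivity
  end.

(** * The annihilator of a brace of order p^3 *)

(* Locked: otherwise rewriting with its additivity would also match the
   difference it unfolds to. *)
Fact ast_key : unit. Proof. by []. Qed.
Definition ast (B : zmodType) (op : B -> B -> B) : B -> B -> B :=
  locked_with ast_key (fun a b => op a b - a - b).

Section BraceTheory.
Variables (B : zmodType) (op : B -> B -> B).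
Hypothesis brB : left_brace op.
Local Notation ast := (ast op).

Lemma astE a b : ast a b = op a b - a - b.
Proof. by rewrite /ast unlock. Qed.

Lemma opE a b : op a b = a + b + ast a b.
Proof. by rewrite astE; zmod. Qed.

Lemma brace_mulA : associative op.
Proof. by case: brB => -[]. Qed.

Lemma astDr a b c : ast a (b + c) = ast a b + ast a c.
Proof.
have := brace_compat brB a b c; rewrite !opE => E.
apply: (@addrI _ (a + (b + c) + a)).
transitivity (a + (b + c) + ast a (b + c) + a); first by zmod.
by rewrite E; zmod.
Qed.

Lemma ast0r a : ast a 0 = 0.
Proof. by apply: (@addrI _ (ast a 0)); rewrite -astDr !addr0. Qed.

Lemma astNr a b : ast a (- b) = - ast a b.
Proof. by apply: (@addrI _ (ast a b)); rewrite -astDr !subrr ast0r. Qed.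

Lemma astMnr a b n : ast a (b *+ n) = ast a b *+ n.
Proof. by elim: n => [|n IH]; rewrite ?mulr0n ?ast0r // !mulrS astDr IH. Qed.

Lemma brace_mulr0 a : op a 0 = a.
Proof. by rewrite opE ast0r !addr0. Qed.

Lemma brace_inv : exists iv : B -> B,
  (forall a, op a (iv a) = 0) /\ (forall a, op (iv a) a = 0).
Proof.
case: brB => -[_ [e [iv [e1 e2 iv1 iv2]]]] _; exists iv.
have -> : 0 = e by rewrite -[LHS]e1 brace_mulr0.
by [].
Qed.

Lemma brace_mul0r a : op 0 a = a.
Proof.
case: brB => -[_ [e [iv [e1 e2 iv1 iv2]]]] _.
have -> : 0 = e by rewrite -[LHS]e1 brace_mulr0.
by [].
Qed.

Lemma ast0l a : ast 0 a = 0.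
Proof. by rewrite astE brace_mul0r subr0 subrr. Qed.

(** The map b |-> b + a * b is lambda_a, so this is the multiplicativity of lambda, that is,
    associativity of [op] expressed through [ast]. *)
Lemma astM a b c : ast (op a b) c = ast a c + ast b c + ast a (ast b c).
Proof.
apply: (@addrI _ (op a b + c)).
by rewrite -opE -brace_mulA !opE !astDr; zmod.
Qed.

Lemma brace_mul_eq a b c : op a b = op a c -> b = c.
Proof.
have [iv [_ iv1]] := brace_inv.
by move/(congr1 (op (iv a))); rewrite !brace_mulA iv1 !brace_mul0r.
Qed.

End BraceTheory.

(** The maps f and g are identities in the proof; keeping them abstract separates this group law
    from the additive one that a [finZmodType] already carries. *)
Lemma group_of_op (B : finType) (op : B -> B -> B) : is_group op ->
  exists (gT : finGroupType) (f : B -> gT) (g : gT -> B),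
  [/\ cancel f g, cancel g f & {morph f : a b / op a b >-> (a * b)%g}].
Proof.
case=> opA [e [iv [e1 e2 iv1 iv2]]].
pose T : Type := Finite.sort B.
pose fT : finType := HB.pack T (Finite.class B).
pose m := Finite_isGroup.Build fT opA e1 iv1.
pose gT : finGroupType := HB.pack T (Finite.class B) m.
by exists gT, id, id; split.
Qed.

(** * Fixed points of the lambda action on quotients *)

Section CosetFixed.
Variables (p : nat) (B : finZmodType) (op : B -> B -> B).
Hypothesis brB : left_brace op.
Hypotheses (p_pr : prime p) (oB : #|B| = (p ^ 3)%N).
Local Notation "a ** b" := (ast op a b) (at level 40).

Lemma p3_nat_card (D : {group B}) : p.-nat #|D|.
Proof.
apply: (@pnat_dvd _ #|[set: B]|); first exact: cardSg (subsetT _).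
by rewrite cardsT oB pnatX pnat_id.
Qed.

(** The p-group (B, .) acts through lambda on the cosets of D in S, whose number is a multiple of p.
    The number of fixed cosets is then a multiple of p as well, and since D is one of them there is
    another. *)
Lemma coset_fixed0 (S D : {group B}) : D \proper S ->
  (forall a s, s \in S -> a ** s \in S) ->
  (forall a d, d \in D -> a ** d \in D) ->
  exists s : B, [/\ s \in S, s \notin D & forall a, a ** s \in D].
Proof.
move=> /andP[sDS nDS] astS astD.
have [gT [f [g [fK gK fM]]]] := group_of_op (brace_mul_group brB).
have gM x y : g (x * y)%g = op (g x) (g y) by rewrite -[in LHS](gK x) -[in LHS](gK y) -fM fK.
have g1 : g 1%g = 0.
  by apply: (brace_mul_eq brB (a := g 1%g)); rewrite -gM mulg1 (brace_mulr0 brB).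
(* A right action is required, hence the inverse: this is lambda of a^-1. *)
pose to (x : B) (a : gT) := x + g a^-1%g ** x.
have to1 : to^~ 1%g =1 id by move=> x; rewrite /to invg1 g1 (ast0l brB) addr0.
have toM (x : B) a b : to x (a * b)%g = to (to x a) b.
  by rewrite /to invMg gM (astM brB) (astDr brB); zmod.
pose act := TotalAction to1 toM.
have toD x y a : to (x + y) a = to x a + to y a.
  by rewrite /to (astDr brB); zmod.
have toDD a d : d \in D -> to d a \in D by move=> dD; rewrite groupM ?astD.
have toS a d : d \in S -> to d a \in S by move=> dD; rewrite groupM ?astS.
have actD s a : (act^*)%act (D :* s)%g a = (D :* to s a)%g.
  apply/eqP; rewrite eqEcard; apply/andP; split.
    apply/subsetP => _ /imsetP[_ /rcosetP[d dD ->] ->] /=.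
    by rewrite mem_rcoset [to _ a]toD -[_ \in _]/(to d a + to s a - to s a \in D) addrK toDD.
  by rewrite card_setact !card_rcoset.
have acts : [acts [set: gT], on rcosets D S | act^*].
  apply/subsetP=> a _; rewrite !inE /=; apply/subsetP => X.
  case/rcosetsP => s sS ->; rewrite inE /= -[X in X \in _]/((act^*)%act (D :* s)%g a) actD.
  by apply/rcosetsP; exists (to s a) => //; apply: toS.
have pgT : (p.-group [set: gT])%g.
  rewrite /pgroup cardsT -(bij_eq_card (f := f)); last by exists g.
  by rewrite oB pnatX pnat_id.
have := pgroup_fix_mod pgT acts.
have : (p %| #|rcosets D S|)%N.
  have : p.-nat #|S : D|%g by apply: pnat_dvd (p3_nat_card S); apply: dvdn_indexg.
  case/p_natP => -[|m] E; last by rewrite -[#|_|]/(#|S : D|%g) E expnS dvdn_mulr.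
  by move/eqP: E; rewrite indexg_eq1 (negPf nDS).
rewrite /dvdn => /eqP -> /esym /eqP; rewrite -/(dvdn _ _) => pF.
have DF : (D : {set B}) \in 'Fix_(rcosets D S | act^*)([set: gT])%g.
  rewrite inE; apply/andP; split.
    by apply/rcosetsP; exists 1%g; rewrite ?group1 // mulg1.
  apply/afixP => a _; rewrite -{1}(mulg1 (D : {set B})) actD.
  by apply: rcoset_id; apply: toDD; apply: group1.
have : exists2 X, X \in 'Fix_(rcosets D S | act^*)([set: gT])%g & X != D.
  apply/exists_inP; apply: contraLR pF => /exists_inPn H.
  rewrite (_ : 'Fix_(_ | _)(_)%g = [set (D : {set B})]).
    by rewrite cards1 dvdn1 neq_ltn prime_gt1 ?orbT.
  apply/setP => X; rewrite in_set1; apply/idP/eqP => [XF|->//].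
  by apply/eqP; apply/negPn/H.
case=> X; rewrite inE => /andP[/rcosetsP[s sS ->] /afixP sF] sD.
exists s; split => //.
  by apply: contraNN sD => sD; apply/eqP/rcoset_id.
move=> a; have := sF (f a)^-1%g (in_setT _); rewrite actD => /rcoset_eqP.
rewrite mem_rcoset -[_ \in _]/(to s (f a)^-1%g - s \in D).
by rewrite /to invgK fK (_ : s + _ - s = a ** s) //; zmod.
Qed.

Lemma coset_fixed (S D : {group B}) : D \proper S ->
  (forall a s, s \in S -> a ** s \in S) ->
  (forall a d, d \in D -> a ** d \in D) ->
  exists s : B, [/\ s \in S, s \notin D, s *+ p \in D & forall a, a ** s \in D].
Proof.
move=> sDS astS astD; have [s [sS sD sF]] := coset_fixed0 sDS astS astD.
have ex : exists k, s *+ (p ^ k) \in D.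
  exists 3; rewrite -FinRing.zmodXgE (_ : (_ ^+ _)%g = 1%g) ?group1 //.
  by apply/eqP; rewrite -order_dvdn -oB -cardsT order_dvdG ?inE.
case: (ex_minnP ex) => -[|k] kD kmin.
  by rewrite expn0 mulr1n (negPf sD) in kD.
(* The last p-power multiple of s outside D; being fixed modulo D passes to multiples. *)
exists (s *+ (p ^ k)); split => //.
- by rewrite -FinRing.zmodXgE groupX.
- by apply/negP => /kmin; rewrite ltnn.
- by rewrite -mulrnA -expnSr.
- by move=> a; rewrite astMnr // -FinRing.zmodXgE groupX.
Qed.

End CosetFixed.

Section AdditiveSubgroups.
Variables (B : finZmodType).
Implicit Types D : {group B}.

Lemma subg0 D : 0 \in D. Proof. exact: group1. Qed.
Lemma subgD D x y : x \in D -> y \in D -> x + y \in D.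
Proof. exact: groupM. Qed.
Lemma subgN D x : (- x \in D) = (x \in D).
Proof. exact: groupV. Qed.
Lemma subgB D x y : x \in D -> y \in D -> x - y \in D.
Proof. by move=> xD yD; rewrite subgD ?subgN. Qed.
Lemma subgDl D x y : x \in D -> (x + y \in D) = (y \in D).
Proof. exact: groupMl. Qed.
Lemma subgDr D x y : x \in D -> (y + x \in D) = (y \in D).
Proof. exact: groupMr. Qed.
Lemma subgMn D x n : x \in D -> x *+ n \in D.
Proof. by rewrite -FinRing.zmodXgE; apply: groupX. Qed.

Lemma mem_cycleP (e x : B) : reflect (exists n, x = e *+ n) (x \in <[e]>%g).
Proof.
apply: (iffP idP) => [/cycleP[n ->]|[n ->]]; first by exists n; rewrite FinRing.zmodXgE.
by apply/cycleP; exists n; rewrite FinRing.zmodXgE.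
Qed.

Lemma mem_joinP D (s x : B) :
  reflect (exists2 d : B, d \in D & exists n, x = d + s *+ n) (x \in D <*> <[s]>)%g.
Proof.
have -> : (D <*> <[s]> = D * <[s]>)%g.
  by apply: norm_joinEr; apply/cents_norm/centsP => x' _ y _; apply: addrC.
apply: (iffP mulsgP) => [[d y dD /mem_cycleP[n ->] ->]|[d dD [n ->]]].
  by exists d => //; exists n.
by exists d (s *+ n) => //; apply/mem_cycleP; exists n.
Qed.

Lemma mem_joinl D s x : x \in D -> x \in (D <*> <[s]>)%g.
Proof. by move=> xD; apply/mem_joinP; exists x => //; exists 0%N; rewrite addr0. Qed.

Lemma mem_joinr D s : s \in (D <*> <[s]>)%g.
Proof. by apply/mem_joinP; exists 0; rewrite ?subg0 //; exists 1%N; rewrite add0r. Qed.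

Variable p : nat.
Hypothesis p_pr : prime p.

Lemma mulrn_notin D s n : s \notin D -> s *+ p \in D -> s *+ n \in D -> (p %| n)%N.
Proof.
move=> sD pD nD; apply: contraNT sD => pn.
have co : coprime n p by rewrite coprime_sym prime_coprime.
have n0 : (0 < n)%N by case: n pn {nD co} => //; rewrite dvdn0.
case: (egcdnP p n0) => u v e _; move: e; rewrite (eqP co) => e.
have -> : s = s *+ (u * n) - s *+ (v * p).
  by rewrite e mulrnDr mulr1n; zmod.
by rewrite subgB // mulnC mulrnA subgMn.
Qed.

Lemma card_join D s : p.-nat #|D| -> (forall x : B, x *+ (p ^ 3) = 0) ->
  s \notin D -> s *+ p \in D -> #|(D <*> <[s]>)%g| = (p * #|D|)%N.
Proof.
move=> pD xp3 sD psD.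
pose f (x : B * 'I_p) := x.1 + s *+ x.2.
have -> : (D <*> <[s]>)%g = [set f x | x in setX D setT].
  apply/setP => x; apply/mem_joinP/imsetP => [[d dD [n ->]]|[[d i] dD ->]].
    exists (d + s *+ p *+ (n %/ p), Ordinal (ltn_pmod n (prime_gt0 p_pr))).
      by rewrite in_setX in_setT andbT /= subgD // subgMn.
    by rewrite /f /= -addrA -mulrnA -mulrnDr mulnC -divn_eq.
  by exists d; [move: dD; rewrite in_setX => /andP[] | exists (val i)].
rewrite card_in_imset; first by rewrite cardsX cardsT card_ord mulnC.
move=> [d1 i1] [d2 i2]; rewrite !in_setX /= => /andP[d1D _] /andP[d2D _].
rewrite /f /= => E.
have H (a b : 'I_p) (x y : B) : x \in D -> y \in D -> x + s *+ a = y + s *+ b -> (b <= a)%N -> a = b.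
  move=> xD yD E2 ab; apply: val_inj => /=.
  have : s *+ (a - b) \in D.
    by rewrite mulrnBr // (_ : _ - _ = y - x) ?subgB //;
     apply: (@addrI _ x); rewrite addrA E2; zmod.
  move/(mulrn_notin sD psD); case: (posnP (a - b)) => [/eqP|] ab0.
    by move=> _; apply/eqP; rewrite eqn_leq ab andbT -subn_eq0.
  by move/(dvdn_leq ab0); rewrite leqNgt (leq_ltn_trans (leq_subr _ _)).
have ii : i1 = i2.
  case: (leqP i2 i1) => l; first exact: H E _.
  by apply/esym; apply: H (esym E) _ => //; apply: ltnW.
by move: E; rewrite ii => /addIr ->.
Qed.

End AdditiveSubgroups.

Section Annihilator.
Variables (p : nat) (B : finZmodType) (op : B -> B -> B).
Hypothesis brB : left_brace op.
Hypotheses (p_pr : prime p) (p_neq2 : p != 2%N) (oB : #|B| = (p ^ 3)%N).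
Local Notation "a ** b" := (ast op a b) (at level 40).
Implicit Types (D : {group B}) (e s d x y : B).

Lemma mulrn_card x : x *+ (p ^ 3) = 0 :> B.
Proof.
apply/eqP; rewrite -FinRing.zmodXgE -[_ == 0]/(_ == 1%g) -order_dvdn -oB.
by rewrite -cardsT order_dvdG ?inE.
Qed.

Lemma card_joinp D s : s \notin D -> s *+ p \in D ->
  #|(D <*> <[s]>)%g| = (p * #|D|)%N.
Proof. by move=> sD psD; apply: card_join => //; [apply: p3_nat_card | apply: mulrn_card]. Qed.

Lemma card_cyclep (e : B) : e != 0 -> e *+ p = 0 -> #|<[e]>%g| = p.
Proof.
by move=> e0 pe; apply: nt_prime_order => //; rewrite FinRing.zmodXgE pe.
Qed.

Lemma proper_card_group D k : (k < 3)%N -> #|D| = (p ^ k)%N -> D \proper [set: B].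
Proof.
move=> k3 oD; rewrite properT; apply: contraTneq k3 => E.
by move: oD; rewrite E cardsT oB => /eqP; rewrite eqn_exp2l ?prime_gt1 // => /eqP <-.
Qed.

Lemma ast_join D D' s : (forall a d, d \in D -> a ** d \in D') ->
  (forall a, a ** s \in D') ->
  forall a x, x \in (D <*> <[s]>)%g -> a ** x \in D'.
Proof.
move=> hD hs a x /mem_joinP[d dD [n ->]].
by rewrite (astDr brB) (astMnr brB) subgD ?hD ?subgMn.
Qed.

Lemma full_join D s x : #|D| = (p ^ 2)%N -> s \notin D -> s *+ p \in D ->
  exists2 d : B, d \in D & exists n, x = d + s *+ n.
Proof.
move=> oD sD psD; apply/mem_joinP.
suff -> : (D <*> <[s]>)%g = setT by rewrite inE.
by apply/eqP; rewrite eqEcard subsetT cardsT oB card_joinp // oD -expnS leqnn.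
Qed.

(** The next term of the flag is D + <s>: it is stable because the products a * s already lie in
    D. *)
Lemma flag_step D k : (k < 3)%N -> #|D| = (p ^ k)%N ->
  (forall a d, d \in D -> a ** d \in D) ->
  exists s : B, [/\ s \notin D, s *+ p \in D, forall a, a ** s \in D
    & #|(D <*> <[s]>)%g| = (p ^ k.+1)%N].
Proof.
move=> k3 oD hD.
have [//|//|s [_ sD psD hs]] := coset_fixed brB p_pr oB (proper_card_group k3 oD).
  by move=> *; rewrite inE.
by exists s; split=> //; rewrite card_joinp // oD expnS.
Qed.

(* The quotient by [D] is a brace of order p^2; comparing [e2 . e3] with a
   product of the form [e3 . x] shows that [e2 * e3 = b e2] forces b^2 = 0. *)
Lemma fixed_ann_mod D (e2 : B) : #|D| = p ->
  (forall d b, d \in D -> d ** b = 0) -> (forall d b, d \in D -> b ** d = 0) ->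
  e2 \notin D -> e2 *+ p \in D -> (forall a, a ** e2 \in D) ->
  forall b, e2 ** b \in D.
Proof.
move=> oD Dl Dr e2D pe2 he2.
have DD a d : d \in D -> a ** d \in D by move=> dD; rewrite Dr ?subg0.
pose D2 := (D <*> <[e2]>)%G.
have oD2 : #|D2| = (p ^ 2)%N by rewrite card_joinp // oD.
have DD2 : forall a d, d \in D2 -> a ** d \in D by exact: ast_join.
have [e3 [e3D pe3 he3 _]] := flag_step (ltnSn 2) oD2 (fun a d dD => mem_joinl _ (DD2 a d dD)).
have D2b a b : a ** b \in D2.
  have [d dD [n ->]] := full_join b oD2 e3D pe3.
  by rewrite (astDr brB) (astMnr brB) subgD ?subgMn // mem_joinl // DD2.
(* Modulo D, the map x |-> x * e3 is additive on D + <e2>, since sums there are products up to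
   elements of D. *)
have lin n : forall d, d \in D -> (e2 *+ n + d) ** e3 - (e2 ** e3) *+ n \in D.
  elim: n => [|n IH] d dD; first by rewrite add0r subr0 Dl ?subg0.
  pose d' := d - e2 ** (e2 *+ n).
  have d'D : d' \in D by rewrite subgB // (astMnr brB) subgMn.
  have -> : e2 *+ n.+1 + d = op e2 (e2 *+ n + d').
    rewrite (opE op) (astDr brB) (Dr d') // mulrS /d'; zmod.
  rewrite (astM brB) mulrS.
  rewrite (_ : _ - _ = ((e2 *+ n + d') ** e3 - (e2 ** e3) *+ n) + e2 ** ((e2 *+ n + d') ** e3)); last by zmod.
  by rewrite subgD ?IH // DD2.
suff e23 : e2 ** e3 \in D.
  move=> b; have [d dD [n ->]] := full_join b oD2 e3D pe3.
  by rewrite (astDr brB) (astMnr brB) subgD ?subgMn // DD2.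
have /mem_joinP[d0 d0D [b E]] := D2b e2 e3.
(* With e2 * e3 = d0 + b e2 this y satisfies e2 . e3 = e3 + y, and subtracting d' = e3 * y makes e3
   . (y - d') the same element. *)
pose y : B := d0 + e2 *+ b.+1; pose d' := e3 ** y.
have yD2 : y \in D2 by apply/mem_joinP; exists d0 => //; exists b.+1.
have d'D : d' \in D by apply: DD2.
have E1 : op e2 e3 = op e3 (y - d').
  rewrite !(opE op) (astDr brB) (astNr brB) (Dr d') // -/d' E /y (mulrS e2 b); zmod.
have : e2 ** e3 *+ b \in D.
  have := congr1 (fun z => z ** e3) E1; rewrite !(astM brB) => E2.
  have H := lin b.+1 (d0 - d') (subgB d0D d'D).
  have H2 := subgD H (subgB (DD2 e3 _ (D2b (y - d') e3)) (DD2 e2 _ (D2b e3 e3))).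
  rewrite -subgN; congr (_ \in D) : H2.
  rewrite (_ : e2 *+ b.+1 + (d0 - d') = y - d'); last by rewrite /y; zmod.
  rewrite (mulrS (e2 ** e3) b).
  apply: (@addrI _ (e2 ** e3 + e3 ** e3 + e2 ** (e3 ** e3))).
  by rewrite [in RHS]E2; zmod.
(* Here b (e2 * e3) is b^2 e2 modulo D, so p divides b. *)
rewrite E mulrnDl (subgDl _ (subgMn _ d0D)) -(mulrnA e2) => /(mulrn_notin p_pr e2D pe2).
rewrite Euclid_dvdM // orbb => /dvdnP[k ->].
by rewrite subgD // mulnC mulrnA subgMn.
Qed.

End Annihilator.

Section Annihilator2.
Variables (p : nat) (B : finZmodType) (op : B -> B -> B).
Hypothesis brB : left_brace op.
Hypotheses (p_pr : prime p) (p_neq2 : p != 2%N) (oB : #|B| = (p ^ 3)%N).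
Local Notation "a ** b" := (ast op a b) (at level 40).
Implicit Types (D : {group B}) (e s d x y : B).

Lemma ast_eq0 a x : x + a ** x = 0 -> x = 0.
Proof.
move=> E; apply: (brace_mul_eq brB (a := a)); rewrite (brace_mulr0 brB) (opE op).
by rewrite -addrA E addr0.
Qed.

Lemma ast_faithful : (forall k, (forall b, k ** b = 0) -> k = 0) ->
  forall a a', (forall b, a ** b = a' ** b) -> a = a'.
Proof.
move=> faith a a' E; have [iv [iv1 iv2]] := brace_inv brB.
have E1 : op a (op (iv a) a') = a' by rewrite (brace_mulA brB) iv1 (brace_mul0r brB).
rewrite -[RHS]E1 [op (iv a) a']faith ?(brace_mulr0 brB) // => b.
apply: (@ast_eq0 a); have := E b; rewrite -[in a' ** b]E1 (astM brB) => E2.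
by apply: (@addrI _ (a ** b)); rewrite addr0 {2}E2; zmod.
Qed.

(* If [lambda] were faithful, [a |-> (a * e2, a * e3)] would be a bijection
   onto [D1 x D2], so [lambda] would map onto the full unitriangular group.
   Comparing [t . v] with [z . v . t], where [z] acts as the commutator of [t]
   and [v], then gives [2 m e2 \in D1] with [m] prime to [p]. *)
Lemma socle_neq0 : exists2 k, k != 0 & forall b, k ** b = 0.
Proof.
case: (pickP (fun k => (k != 0) && [forall b, k ** b == 0])) => [k /andP[k0 /forallP kb]|H].
  by exists k => // b; apply/eqP.
exfalso.
have faith : forall k, (forall b, k ** b = 0) -> k = 0.
  move=> k kb; have := H k; case: eqP => //= _.
  by move/negbT/forallP => [] b; rewrite kb.
pose D0 := 1%G : {group B}.
have o1 : #|D0| = (p ^ 0)%N by rewrite cards1.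
have h1 (a : B) d : d \in D0 -> a ** d \in D0.
  by rewrite !inE => /eqP ->; rewrite (ast0r brB) -[_ == _]/(0 == 0 :> B) eqxx.
have [e1 [e10 pe1 he1 _]] := flag_step brB p_pr oB (isT : 0 < 3)%N o1 h1.
have {}e10 : e1 != 0 by move: e10; rewrite inE.
have {}pe1 : e1 *+ p = 0 by move: pe1; rewrite inE => /eqP.
have {}he1 (a : B) : a ** e1 = 0 by have := he1 a; rewrite inE => /eqP.
pose D1 := <[e1]>%G : {group B}.
have oD1 : #|D1| = p by apply: card_cyclep.
have D1r a d : d \in D1 -> a ** d = 0.
  by case/mem_cycleP => n ->; rewrite (astMnr brB) he1 mul0rn.
have e1D1 : e1 \in D1 by apply/mem_cycleP; exists 1%N.
have oD1' : #|D1| = (p ^ 1)%N by rewrite expn1.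
have hD1 a d : d \in D1 -> a ** d \in D1 by move=> dD; rewrite D1r ?subg0.
have [e2 [e2D pe2 he2 oD2]] := flag_step brB p_pr oB (isT : 1 < 3)%N oD1' hD1.
pose D2 := (D1 <*> <[e2]>)%G : {group B}.
have DD2 : forall a d, d \in D2 -> a ** d \in D1 by apply: ast_join.
have [e3 [e3D pe3 he3 _]] := flag_step brB p_pr oB (ltnSn 2) oD2 (fun a d dD => mem_joinl _ (DD2 a d dD)).
have gen x := full_join p_pr oB x oD2 e3D pe3.
have D2b a b : a ** b \in D2.
  have [d dD [n ->]] := gen b.
  by rewrite (astDr brB) (astMnr brB) subgD ?subgMn // mem_joinl // DD2.
have ext a a' : a ** e2 = a' ** e2 -> a ** e3 = a' ** e3 -> forall b, a ** b = a' ** b.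
  move=> E2 E3 b; have [_ /mem_joinP[d dD [m ->]] [n ->]] := gen b.
  by rewrite !(astDr brB) !(astMnr brB) (D1r a d) // (D1r a' d) // E2 E3.
pose phi a := (a ** e2, a ** e3).
have phi_inj : injective phi.
  by move=> a a' [E2 E3]; apply: (ast_faithful faith); apply: ext.
(* The injective [phi] lands in D1 x D2, which has p^3 elements like B, so it is onto. *)
have surj (u v : B) : u \in D1 -> v \in D2 -> exists a, a ** e2 = u /\ a ** e3 = v.
  move=> uD vD; have : (u, v) \in setX D1 D2 by rewrite in_setX uD.
  have <- : phi @: setT = setX D1 D2.
    apply/eqP; rewrite eqEcard; apply/andP; split.
      by apply/subsetP => _ /imsetP[a _ ->]; rewrite in_setX he2 D2b.
    by rewrite card_imset // cardsT oB cardsX oD1 oD2 -expnS.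
  by case/imsetP => a _ [-> ->]; exists a.
(* These act on e1, e2, e3 like the elementary unitriangular matrices, with z the central one. *)
have [z [z2 z3]] := surj 0 e1 (subg0 _) (mem_joinl _ e1D1).
have [t [t2 t3]] := surj e1 0 e1D1 (subg0 _).
have [v [v2 v3]] := surj 0 e2 (subg0 _) (mem_joinr _ _).
have zc u : op z u = op u z.
  apply: (ast_faithful faith); apply: ext; rewrite !(astM brB).
    by rewrite z2 (ast0r brB) [z ** _]D1r ?he2 //; zmod.
  have : z ** (u ** e3) = 0.
    have /mem_joinP[d dD [n ->]] := D2b u e3.
    by rewrite (astDr brB) (astMnr brB) z2 D1r // mul0rn addr0.
  by rewrite z3 he1 => ->; zmod.
have zs u : z ** u = u ** z.
  by apply: (@addrI _ (u + z)); rewrite -[in RHS](opE op) -zc (opE op); zmod.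
have zD2 d : d \in D2 -> z ** d = 0.
  case/mem_joinP=> d' d'D [n ->].
  by rewrite (astDr brB) (astMnr brB) z2 D1r // mul0rn addr0.
(* Since z is central, z * v = v * z. The left side lies in D1, while an e3 component n of z
   contributes n e2 on the right, so p divides n. *)
have [d [dD [n zE]]] : exists d, d \in D1 /\ exists n, z = d + e2 *+ n.
  have [dz dzD [n zE]] := gen z.
  have : e2 *+ n \in D1.
    have zv : z ** v \in D1.
      have [dv dvD [k ->]] := gen v.
      by rewrite (astDr brB) (astMnr brB) z3 zD2 // add0r subgMn.
    move: zv; rewrite zs zE (astDr brB) (astMnr brB) v3 subgDl // DD2 //.
  move/(mulrn_notin p_pr e2D pe2) => /dvdnP[k nk].
  suff /mem_joinP[d dD [m E]] : z \in D2 by exists d; split => //; exists m.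
  by rewrite zE subgD // nk mulnC mulrnA subgMn.
have e1N : (e1 *+ n == 0) = (p %| n)%N.
  have oe1 : #[e1]%g = p by [].
  by rewrite -[in RHS]oe1 order_dvdn FinRing.zmodXgE.
(* Otherwise e3 * z would vanish, but it equals z * e3 = e1. *)
have pn : ~~ (p %| n)%N.
  apply/negP => /dvdnP[k nk]; move/eqP: e10; apply; rewrite -z3 zs zE.
  have pe3' : (e3 ** e2) *+ p = 0.
    by have /mem_cycleP[i ->] := he2 e3; rewrite -mulrnA mulnC mulrnA pe1 mul0rn.
  by rewrite (astDr brB) (astMnr brB) nk D1r // mulnC mulrnA pe3' mul0rn addr0.
have zt : z ** t = e1 *+ n.
  by rewrite zs zE (astDr brB) (astMnr brB) D1r // t2 add0r.
have vD2 : v \in D2.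
  have [dv dvD [k vE]] := gen v.
  have : z ** v = 0 by rewrite zs zE (astDr brB) (astMnr brB) D1r // v2 mul0rn addr0.
  rewrite {1}vE (astDr brB) (astMnr brB) z3 zD2 // add0r => e1k.
  have /dvdnP[i ki] : (p %| k)%N.
    by have oe1 : #[e1]%g = p by []; rewrite -oe1 order_dvdn FinRing.zmodXgE e1k.
  by rewrite vE subgD // ki mulnC mulrnA subgMn.
have [dt dtD [n' tE]] := gen t.
have e1nn : e1 *+ n' = e1 *+ n.
  by rewrite -zt tE (astDr brB) (astMnr brB) z3 zD2 // add0r.
(* Both sides send e2 to e1 and e3 to e1 + e2 under [ast], and lambda is faithful. *)
have tv : op t v = op z (op v t).
  apply: (ast_faithful faith); apply: ext; rewrite !(astM brB).
    by rewrite z2 v2 t2 !(ast0r brB, he1, addr0, add0r).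
  by rewrite z3 v3 t3 !(ast0r brB, addr0, add0r) t2 z2 addr0 addrC.
have E : t ** v = z + v ** t + e1 *+ n.
  apply: (@addrI _ (t + v)); rewrite -(opE op) tv !(opE op) !(astDr brB).
  by rewrite zt (zD2 v) // (zD2 (v ** t)) //; zmod.
have : e2 *+ n + v ** t \in D1.
  have := DD2 t v vD2; rewrite E zE.
  by rewrite subgDr ?subgMn // -addrA subgDl.
have vdt : v ** dt \in D1 by apply: DD2.
rewrite tE (astDr brB) (astMnr brB) v3 addrCA subgDl // => e2nn.
have nn : n' = n %[mod p].
  have oe1 : #[e1]%g = p by [].
  by apply/eqP; rewrite -oe1 -eq_expg_mod_order !FinRing.zmodXgE e1nn.
have : e2 *+ (n + n') \in D1 by rewrite mulrnDr.
move/(mulrn_notin p_pr e2D pe2); rewrite /dvdn -modnDmr nn modnDmr -/(dvdn _ _).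
rewrite addnn -mul2n Euclid_dvdM // (negPf pn) orbF dvdn_prime2 // => /eqP p2.
by move: p_neq2; rewrite p2.
Qed.

End Annihilator2.

Section AdaptedBasis.
Variables (p : nat) (B : finZmodType) (op : B -> B -> B).
Hypothesis brB : left_brace op.
Hypotheses (p_pr : prime p) (p_neq2 : p != 2%N) (oB : #|B| = (p ^ 3)%N).
Local Notation "a ** b" := (ast op a b) (at level 40).
Implicit Types (D : {group B}) (e s d x y : B).

(** The socle is an ideal: sums in it are products, and lambda acts on it by conjugation. Being
    nonzero, it contains a nonzero element fixed by lambda, which is e1. *)
Lemma ann_neq0 : exists e1 : B, [/\ e1 != 0, e1 *+ p = 0,
  forall b, e1 ** b = 0 & forall b, b ** e1 = 0].
Proof.
pose K : {set B} := [set k | [forall b, k ** b == 0]].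
have KP k : reflect (forall b, k ** b = 0) (k \in K).
  by rewrite inE; apply: (iffP forallP) => E b; apply/eqP.
have gK : group_set K.
  apply/group_setP; split; first by apply/KP => b; apply: ast0l.
  move=> k k' /KP Ek /KP Ek'; apply/KP => b.
  have -> : (k * k')%g = op k k' by rewrite (opE op) Ek addr0.
  by rewrite (astM brB) Ek Ek' Ek !addr0.
pose Kg := Group gK.
have [k k0 kE] := socle_neq0 brB p_pr p_neq2 oB.
have sK : 1%G \proper Kg.
  rewrite properE sub1G; apply/subsetPn; exists k; first exact/KP.
  by rewrite inE.
have hK (a s : B) : s \in Kg -> a ** s \in Kg.
  move=> sK'; rewrite -(subgDl _ sK'); have [iv [iv1 iv2]] := brace_inv brB.
  move/KP: (sK') => Es.
  (* For s in the socle, lambda_a(s) is the conjugate a . s . a^-1, which again acts trivially. *)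
  pose s' := op (op a s) (iv a).
  have Eas x : op a s ** x = a ** x by rewrite (astM brB) Es (ast0r brB) !addr0.
  have Es' : forall b, s' ** b = 0.
    by move=> b; rewrite (astM brB) !Eas -(astM brB) iv1 (ast0l brB).
  have : op s' a = op a s by rewrite -(brace_mulA brB) iv2 (brace_mulr0 brB).
  rewrite !(opE op) Es' => E.
  have -> : s + a ** s = s' by apply: (@addrI _ a); rewrite addrA -E; zmod.
  exact/KP.
have h1 (a d : B) : d \in (1%G : {group B}) -> a ** d \in (1%G : {group B}).
  by rewrite !inE => /eqP ->; rewrite (ast0r brB) -[_ == _]/(0 == 0 :> B) eqxx.
have [e1 [e1K e10 pe1 he1]] := coset_fixed brB p_pr oB sK hK h1.
exists e1; split.
- by move: e10; rewrite inE.
- by move: pe1; rewrite inE => /eqP.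
- exact/KP.
- by move=> b; have := he1 b; rewrite inE => /eqP.
Qed.

Lemma mulrn_bin2 (w : B) : w *+ p = 0 -> w *+ 'C(p, 2) = 0.
Proof.
move=> pw; have /dvdnP[k ->] : (p %| 'C(p, 2))%N.
  by apply: prime_dvd_bin => //=; rewrite ltn_neqAle eq_sym p_neq2 prime_gt1.
by rewrite mulnC mulrnA pw mul0rn.
Qed.

Lemma mulrn_ord (e : B) n : e != 0 -> e *+ p = 0 -> (e *+ n == 0) = (p %| n)%N.
Proof.
move=> e0 pe; have oe : #[e]%g = p by apply: card_cyclep.
by rewrite -[in RHS]oe order_dvdn FinRing.zmodXgE.
Qed.

Hypothesis exp_p2 : forall x : B, x *+ (p ^ 2) = 0.

(* If the annihilator found above does not contain [p y], then [p y = y^p] is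
   in the annihilator as well. *)
Lemma ann_p_multiples : exists e1 : B, [/\ e1 != 0, e1 *+ p = 0,
  forall b, e1 ** b = 0, forall b, b ** e1 = 0 & forall b, b *+ p \in <[e1]>%g].
Proof.
have [e1 [e10 pe1 e1b be1]] := ann_neq0.
pose D1 := <[e1]>%G : {group B}.
case: (pickP (fun y => y *+ p \notin D1)) => [y yD1|H]; last first.
  by exists e1; split => // b; have /negbFE := H b.
have oD1 : #|D1| = p by apply: card_cyclep.
have D1r d b : d \in D1 -> b ** d = 0.
  by case/mem_cycleP => n ->; rewrite (astMnr brB) be1 mul0rn.
have D1l d b : d \in D1 -> d ** b = 0.
  case/mem_cycleP => n ->; elim: n => [|n IH]; first exact: ast0l.
  have -> : e1 *+ n.+1 = op e1 (e1 *+ n) by rewrite (opE op) e1b addr0 mulrS.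
  by rewrite (astM brB) e1b IH e1b !addr0.
have e1D1 : e1 \in D1 by apply/mem_cycleP; exists 1%N.
have oD1' : #|D1| = (p ^ 1)%N by rewrite expn1.
have hD1 a d : d \in D1 -> a ** d \in D1 by move=> dD; rewrite D1r ?subg0.
have pD1 d : d \in D1 -> d *+ p = 0.
  by case/mem_cycleP => n ->; rewrite -mulrnA mulnC mulrnA pe1 mul0rn.
have [e2 [e2D pe2 he2 oD2]] := flag_step brB p_pr oB (isT : 1 < 3)%N oD1' hD1.
pose D2 := (D1 <*> <[e2]>)%G : {group B}.
have DD2 : forall a d, d \in D2 -> a ** d \in D1 by apply: ast_join.
have [e3 [e3D pe3 he3 _]] := flag_step brB p_pr oB (ltnSn 2) oD2 (fun a d dD => mem_joinl _ (DD2 a d dD)).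
have D2b a b : a ** b \in D2.
  have [d dD [n ->]] := full_join p_pr oB b oD2 e3D pe3.
  by rewrite (astDr brB) (astMnr brB) subgD ?subgMn // mem_joinl // DD2.
pose q := y *+ p.
have pq : q *+ p = 0 by rewrite -mulrnA; apply: exp_p2.
have qD2 : q \in D2.
  rewrite /q; have [d dD [n ->]] := full_join p_pr oB y oD2 e3D pe3.
  by rewrite mulrnDl -(mulrnA e3) (mulnC n) (mulrnA e3) subgD ?(subgMn _ pe3) ?(subgMn _ dD).
(* If e2 had order p^2, the elements of D2 killed by p would all lie in D1, q among them. *)
have pe20 : e2 *+ p = 0.
  apply/eqP; apply: contraNT yD1 => e2p.
  case/mem_joinP: qD2 => d dD [m E]; move: pq; rewrite E mulrnDl (pD1 d) // add0r.
  rewrite -mulrnA mulnC mulrnA => /eqP; rewrite mulrn_ord //; last first.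
    by rewrite pD1.
  by case/dvdnP => k mk; rewrite -/q E mk subgD // mulnC mulrnA subgMn.
have pD2 d : d \in D2 -> d *+ p = 0.
  case/mem_joinP => d1 dD [m ->].
  by rewrite mulrnDl (pD1 d1) // -mulrnA mulnC mulrnA pe20 mul0rn addr0.
have aq a : a ** q = 0 by rewrite /q (astMnr brB) pD2.
have yD2 : y \notin D2.
  by apply: contra yD1 => yD2; rewrite pD2 // subg0.
have D2q : D2 = (D1 <*> <[q]>)%g :> {set B}.
  apply/esym/eqP; rewrite eqEcard join_subG joing_subl cycle_subG qD2 /=.
  by rewrite oD2 (card_joinp p_pr oB yD1) ?oD1 //; rewrite -/q pq subg0.
have qD1 b : q ** b \in D1.
  apply: (fixed_ann_mod brB p_pr oB oD1 D1l) => //.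
    by rewrite pq subg0.
  by move=> a; rewrite aq subg0.
have qD2' d : d \in D2 -> q ** d = 0.
  rewrite D2q => /mem_joinP[d1 dD [m ->]].
  by rewrite (astDr brB) (astMnr brB) aq (D1r d1) // mul0rn addr0.
pose w := y ** y.
have pw : w *+ p = 0 := pD2 _ (D2b y y).
have yw : y ** w = 0.
  have := D2b y y; rewrite D2q => /mem_joinP[d1 dD [m]]; rewrite -/w => ->.
  by rewrite (astDr brB) (astMnr brB) aq (D1r d1) // mul0rn addr0.
(* [y *+ n + w *+ 'C(n, 2)] is the n-th power of y in (B, .), because y * w = 0; at n = p it is
   q. *)
have pwn n : (y *+ n + w *+ 'C(n, 2)) ** y = w *+ n.
  elim: n => [|n IH]; first by rewrite !mulr0n add0r ast0l.
  have -> : y *+ n.+1 + w *+ 'C(n.+1, 2) = op y (y *+ n + w *+ 'C(n, 2)).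
    rewrite (opE op) (astDr brB) !(astMnr brB) yw mul0rn addr0 -/w.
    by rewrite binS bin1 (mulrS y) mulrnDr; zmod.
  by rewrite (astM brB) IH (astMnr brB) yw mul0rn addr0 mulrS.
have qy : q ** y = 0.
  by have := pwn p; rewrite mulrn_bin2 // addr0 pw.
have full b : exists2 d, d \in D2 & exists n, b = d + y *+ n by apply: (full_join p_pr oB).
exists q; split => //.
- by apply: contraNneq yD1 => q0; rewrite -/q q0 subg0.
- move=> b; have [d dD [n ->]] := full b.
  by rewrite (astDr brB) (astMnr brB) qy qD2' // mul0rn addr0.
- move=> b; have [d dD [n ->]] := full b.
  rewrite mulrnDl (pD2 d) // add0r -mulrnA mulnC mulrnA.
  by apply/mem_cycleP; exists n.
Qed.

(** The line of e1 is annihilated on both sides, and e2 is annihilated modulo that line. In the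
    mixed case e1 is renormalized to p e3, so that e2 and e3 alone generate the additive group. *)
Lemma adapted_basis : exists e1 e2 e3 : B,
  [/\ [/\ e1 != 0, e1 *+ p = 0, forall b, e1 ** b = 0 & forall b, b ** e1 = 0],
      [/\ e2 \notin <[e1]>%g, e2 *+ p = 0, forall b, e2 ** b \in <[e1]>%g
        & forall b, b ** e2 \in <[e1]>%g],
      e3 \notin (<[e1]> <*> <[e2]>)%g,
      (forall x : B, x *+ p = 0) \/ e3 *+ p = e1 &
      forall a b, a ** b \in (<[e1]> <*> <[e2]>)%g].
Proof.
have [e1 [e10 pe1 e1b be1 pB]] := ann_p_multiples.
pose D1 := <[e1]>%G : {group B}.
have oD1 : #|D1| = p by apply: card_cyclep.
have D1r d b : d \in D1 -> b ** d = 0.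
  by case/mem_cycleP => n ->; rewrite (astMnr brB) be1 mul0rn.
have D1l d b : d \in D1 -> d ** b = 0.
  case/mem_cycleP => n ->; elim: n => [|n IH]; first exact: ast0l.
  have -> : e1 *+ n.+1 = op e1 (e1 *+ n) by rewrite (opE op) e1b addr0 mulrS.
  by rewrite (astM brB) e1b IH e1b !addr0.
have oD1' : #|D1| = (p ^ 1)%N by rewrite expn1.
have hD1 a d : d \in D1 -> a ** d \in D1 by move=> dD; rewrite D1r ?subg0.
have pD1 d : d \in D1 -> d *+ p = 0.
  by case/mem_cycleP => n ->; rewrite -mulrnA mulnC mulrnA pe1 mul0rn.
(* The element supplied by [flag_step] may have order p^2; then p e3 = k p e2 for some k, and e3 - k
   e2 takes its place. *)
have [e2 [e2D pe2 he2]] : exists e2, [/\ e2 \notin D1, e2 *+ p = 0 & forall a, a ** e2 \in D1].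
  have [e2 [e2D pe2 he2 oD2]] := flag_step brB p_pr oB (isT : 1 < 3)%N oD1' hD1.
  case: (eqVneq (e2 *+ p) 0) => [E|pe20]; first by exists e2.
  pose D2 := (D1 <*> <[e2]>)%G : {group B}.
  have DD2 : forall a d, d \in D2 -> a ** d \in D1 by apply: ast_join.
  have [e3 [e3D pe3 he3 _]] := flag_step brB p_pr oB (ltnSn 2) oD2 (fun a d dD => mem_joinl _ (DD2 a d dD)).
  have : e3 *+ p \in <[e2 *+ p]>%g.
    have -> : <[e2 *+ p]>%g = <[e1]>%g.
      apply/eqP; rewrite eqEcard cycle_subG pe2 /=.
      by rewrite !(card_cyclep p_pr) // pD1.
    exact: pB.
  case/mem_cycleP => k Ek; exists (e3 - e2 *+ k); split.
  - apply: contra e3D => e3D1; rewrite -(subrK (e2 *+ k) e3).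
    by apply/mem_joinP; exists (e3 - e2 *+ k) => //; exists k.
  - by rewrite mulrnBl Ek -!mulrnA mulnC subrr.
  move=> a; rewrite (astDr brB) (astNr brB) (astMnr brB) subgB ?subgMn //.
  have /mem_joinP[d dD [n E]] := he3 a; rewrite E.
  (* As p e3 is annihilated, p (a * e3) = 0, which forces the e2 component of a * e3 into D1. *)
  have : (a ** e3) *+ p = 0 by rewrite -(astMnr brB) D1r // pB.
  rewrite E mulrnDl (pD1 d) // add0r -mulrnA mulnC mulrnA => /eqP.
  rewrite (mulrn_ord _ pe20) ?(pD1 (e2 *+ p)) // => /dvdnP[m ->].
  by rewrite subgD // mulnC mulrnA subgMn.
have e2l : forall b, e2 ** b \in D1.
  by apply: (fixed_ann_mod brB p_pr oB oD1 D1l) => //; rewrite pe2 subg0.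
pose D2 := (D1 <*> <[e2]>)%G : {group B}.
have oD2 : #|D2| = (p ^ 2)%N by rewrite (card_joinp p_pr oB) ?oD1 // pe2 subg0.
have DD2 : forall a d, d \in D2 -> a ** d \in D1 by apply: ast_join.
have [e3 [e3D pe3 he3 _]] := flag_step brB p_pr oB (ltnSn 2) oD2 (fun a d dD => mem_joinl _ (DD2 a d dD)).
have D2b a b : a ** b \in D2.
  have [d dD [n ->]] := full_join p_pr oB b oD2 e3D pe3.
  by rewrite (astDr brB) (astMnr brB) subgD ?subgMn // mem_joinl // DD2.
case: (eqVneq (e3 *+ p) 0) => pe30.
  exists e1, e2, e3; split => //; left => x.
  have [_ /mem_joinP[d dD [m ->]] [n ->]] := full_join p_pr oB x oD2 e3D pe3.
  rewrite !mulrnDl (pD1 d) // -!mulrnA (mulnC m) (mulnC n) !mulrnA pe2 pe30.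
  by rewrite !mul0rn !addr0.
have pe3D1 : e3 *+ p \in D1 by apply: pB.
have E : <[e3 *+ p]>%g = <[e1]>%g.
  by apply/eqP; rewrite eqEcard cycle_subG pe3D1 /= !(card_cyclep p_pr) // pD1.
exists (e3 *+ p), e2, e3; split; rewrite ?E //; last by right.
by split => //; [apply: pD1 | move=> b; apply: D1l | move=> b; apply: D1r].
Qed.

End AdaptedBasis.

(** * Braces in coordinates *)

Record pars (F : Type) := Pars { pb : F; pa1 : F; pa2 : F; pg : F; pe : F }.

Fact qf_key : unit. Proof. by []. Qed.
Definition qf (F : fieldType) : pars F -> F -> F -> F -> F -> F :=
  locked_with qf_key (fun P y1 z1 y2 z2 =>
  (pa1 P * y1 + pa2 P * z1) * y2
  + (pg P * y1 + (pa2 P - pg P) * pb P * z1 ^+ 2 / 2%:R + pe P * z1) * z2).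

Lemma qfE (F : fieldType) (P : pars F) y1 z1 y2 z2 : qf P y1 z1 y2 z2 =
  (pa1 P * y1 + pa2 P * z1) * y2
  + (pg P * y1 + (pa2 P - pg P) * pb P * z1 ^+ 2 / 2%:R + pe P * z1) * z2.
Proof. by rewrite /qf unlock. Qed.

Section Qf.
Variables (F : fieldType) (P : pars F).
Hypothesis nz2 : 2%:R != 0 :> F.

Lemma qfDr y1 z1 y2 z2 y3 z3 :
  qf P y1 z1 (y2 + y3) (z2 + z3) = qf P y1 z1 y2 z2 + qf P y1 z1 y3 z3.
Proof. by rewrite !qfE; ring. Qed.

Hypothesis ab0 : pa1 P * pb P = 0.

(** This is associativity of [model] in the [j1] component. The cross term z1 z2 of the quadratic
    part contributes (a2 - g) b z1 z2 z3, which balances g b against a2 b; only multiples of a1 b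
    remain. *)
Lemma qf_cocycle y1 z1 y2 z2 y3 z3 :
  qf P y1 z1 y2 z2 + qf P (y1 + y2 + pb P * z1 * z2) (z1 + z2) y3 z3
  = qf P y2 z2 y3 z3 + qf P y1 z1 (y2 + y3 + pb P * z2 * z3) (z2 + z3).
Proof.
case: P ab0 => b a1 a2 g e; rewrite !qfE /= => /eqP.
by rewrite mulf_eq0 => /orP[] /eqP ->; field.
Qed.

(** The pair (- y + b z^2, - z) consists of the coordinates of the inverse; the equality makes a
    right inverse in [model] a left one. *)
Lemma qf_inv y z :
  qf P (- y + pb P * z ^+ 2) (- z) y z = qf P y z (- y + pb P * z ^+ 2) (- z).
Proof.
case: P ab0 => b a1 a2 g e; rewrite !qfE /= => /eqP.
by rewrite mulf_eq0 => /orP[] /eqP ->; field.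
Qed.
End Qf.

Lemma Fp_additive (p : nat) (p_pr : prime p) (V : zmodType) (f : 'F_p -> V) :
  {morph f : a b / a + b} -> forall u, f u = f 1 *+ (u : nat).
Proof.
move=> fD u; rewrite -[in LHS](natr_Zp u); elim: (u : nat) => [|n IH].
  by rewrite !mulr0n; apply: (@addrI _ (f 0)); rewrite -fD !addr0.
by rewrite -natr1 fD IH mulrSr.
Qed.

Lemma Fp_linear (p : nat) (p_pr : prime p) (f : 'F_p -> 'F_p) :
  {morph f : a b / a + b} -> forall u, f u = u * f 1.
Proof. by move=> fD u; rewrite (Fp_additive p_pr fD) -mulr_natl natr_Zp. Qed.

(* Coordinates of a brace adapted to the chain of its annihilator series:
   [fj1] parametrizes the line [Y = Z = 0], and [fj2] is a section of [Y]. *)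
Record frame (p : nat) (A : zmodType) := Frame {
  fY : A -> 'F_p; fZ : A -> 'F_p; fj1 : 'F_p -> A; fj2 : 'F_p -> A; fe3 : A;
  fYD : {morph fY : a b / a + b};
  fZD : {morph fZ : a b / a + b};
  fj1D : {morph fj1 : a b / a + b};
  fj2D : {morph fj2 : a b / a + b};
  fYj1 : forall u, fY (fj1 u) = 0;
  fZj1 : forall u, fZ (fj1 u) = 0;
  fYj2 : forall u, fY (fj2 u) = u;
  fZj2 : forall u, fZ (fj2 u) = 0;
  fYe3 : fY fe3 = 0;
  fZe3 : fZ fe3 = 1;
  fj1I : injective fj1;
  fker : forall a, fY a = 0 -> fZ a = 0 -> exists u, a = fj1 u
}.

Definition model (p : nat) (A : zmodType) (fr : frame p A) (P : pars 'F_p)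
    (a b : A) : A :=
  a + b + fj1 fr (qf P (fY fr a) (fZ fr a) (fY fr b) (fZ fr b))
  + fj2 fr (pb P * fZ fr a * fZ fr b).

Section Frame.
Variables (p : nat) (p_pr : prime p) (p_neq2 : p != 2%N).
Variables (A : zmodType) (fr : frame p A).
Local Notation Y := (fY fr).
Local Notation Z := (fZ fr).
Local Notation j1 := (fj1 fr).
Local Notation j2 := (fj2 fr).
Local Notation e3 := (fe3 fr).

Lemma Fp_nz2 : 2%:R != 0 :> 'F_p.
Proof.
rewrite -(dvdn_pcharf (pchar_Fp p_pr)) dvdn_prime2 //.
Qed.

Lemma morph0 (V W : zmodType) (f : V -> W) : {morph f : a b / a + b} -> f 0 = 0.
Proof. by move=> fD; apply: (@addrI _ (f 0)); rewrite -fD !addr0. Qed.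
Lemma morphN (V W : zmodType) (f : V -> W) : {morph f : a b / a + b} ->
  forall x, f (- x) = - f x.
Proof. by move=> fD x; apply: (@addrI _ (f x)); rewrite -fD !subrr (morph0 fD). Qed.
Lemma morphMn (V W : zmodType) (f : V -> W) : {morph f : a b / a + b} ->
  forall x n, f (x *+ n) = f x *+ n.
Proof.
move=> fD x; elim=> [|n IH]; first by rewrite !mulr0n (morph0 fD).
by rewrite !mulrS fD IH.
Qed.

Definition fY0 := morph0 (fYD fr).
Definition fZ0 := morph0 (fZD fr).
Definition fj10 := morph0 (fj1D fr).
Definition fj20 := morph0 (fj2D fr).
Definition fYN := morphN (fYD fr).
Definition fZN := morphN (fZD fr).
Definition fYMn := morphMn (fYD fr).
Definition fZMn := morphMn (fZD fr).
Definition fj1Mn := morphMn (fj1D fr).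
Definition fj2Mn := morphMn (fj2D fr).

Definition frE := (fYD, fZD, fYj1, fZj1, fYj2, fZj2, fYe3, fZe3, fYN, fZN, fYMn, fZMn, oppr0, addr0, add0r).

Lemma frameE a : exists u, a = j1 u + j2 (Y a) + e3 *+ (Z a : nat).
Proof.
have [||u E] := fker (f := fr) (a := a - j2 (Y a) - e3 *+ (Z a : nat)).
- by rewrite !frE mul0rn !frE subrr.
- by rewrite !frE natr_Zp subrr.
by exists u; rewrite -E; zmod.
Qed.

Variable P : pars 'F_p.
Hypothesis ab0 : pa1 P * pb P = 0.
Local Notation op := (model fr P).

Lemma modelE a b : op a b = a + b + j1 (qf P (Y a) (Z a) (Y b) (Z b))
  + j2 (pb P * Z a * Z b).
Proof. by []. Qed.
Lemma modelY a b : Y (op a b) = Y a + Y b + pb P * Z a * Z b.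
Proof. by rewrite /model !frE. Qed.
Lemma modelZ a b : Z (op a b) = Z a + Z b.
Proof. by rewrite /model !frE. Qed.

Lemma model_brace : left_brace op.
Proof.
split; last first.
  move=> a b c; rewrite /model !fYD !fZD qfDr mulrDr fj1D fj2D; zmod.
split.
  move=> a b c; rewrite [op a _]modelE [op (op a b) c]modelE !modelY !modelZ !modelE.
  transitivity (a + b + c
    + j1 (qf P (Y b) (Z b) (Y c) (Z c) +
          qf P (Y a) (Z a) (Y b + Y c + pb P * Z b * Z c) (Z b + Z c))
    + j2 (pb P * Z b * Z c + pb P * Z a * (Z b + Z c))).
    by rewrite !fj1D !fj2D; zmod.
  rewrite -(qf_cocycle Fp_nz2 ab0) (_ : pb P * Z b * Z c + _ =
    pb P * Z a * Z b + pb P * (Z a + Z b) * Z c); last by ring.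
  by rewrite !fj1D !fj2D; zmod.
have qf0 y z y' z' : (y = 0 /\ z = 0) \/ (y' = 0 /\ z' = 0) -> qf P y z y' z' = 0.
  by case=> -[-> ->]; rewrite qfE; ring.
pose w a := qf P (Y a) (Z a) (- Y a + pb P * Z a ^+ 2) (- Z a).
exists 0, (fun a => - a + j2 (pb P * Z a ^+ 2) - j1 (w a)).
have N u : j1 (- u) = - j1 u by apply: morphN; apply: fj1D.
split=> a; rewrite /model ?fY0 ?fZ0 ?mulr0 ?mul0r ?fj20.
- by rewrite qf0 ?fj10; [zmod|left].
- by rewrite qf0 ?fj10; [zmod|right].
- rewrite !frE (qf_inv Fp_nz2 ab0) -/(w a).
  rewrite (_ : _ * - _ * _ = - (pb P * Z a ^+ 2)); last by ring.
  by rewrite (morphN (fj2D fr)); zmod.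
- rewrite !frE -/(w a).
  rewrite (_ : _ * - _ = - (pb P * Z a ^+ 2)); last by ring.
  by rewrite (morphN (fj2D fr)); zmod.
Qed.

Lemma model_comm : pa2 P = pg P -> commutative op.
Proof.
move=> E a b; rewrite /model !qfE E subrr !mul0r (addrC b).
by congr (_ + j1 _ + j2 _); rewrite ?E; ring.
Qed.

Lemma model_noncomm : op (j2 1) e3 = op e3 (j2 1) -> pa2 P = pg P.
Proof.
rewrite /model !frE !mulr0 !mul0r !fj20 !addr0 [j2 1 + _]addrC => /addrI/fj1I.
by rewrite !qfE; move=> E; apply/esym; move: E; rewrite !(mulr0, mul0r, addr0, add0r, mulr1, expr0n) /=.
Qed.
End Frame.

Lemma natr_sqr_bin2 (R : comNzRingType) n : n%:R ^+ 2 = 2%:R * 'C(n, 2)%:R + n%:R :> R.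
Proof.
elim: n => [|n IH]; first by rewrite expr0n mulr0 addr0.
rewrite binS bin1 natrD -natr1.
have -> : (n%:R + 1) ^+ 2 = n%:R ^+ 2 + 2%:R * n%:R + 1 :> R by ring.
by rewrite IH; ring.
Qed.

(** * Powers, multiplicative group and socle of a model *)

Section ModelPowers.
Variables (p : nat) (p_pr : prime p) (p_neq2 : p != 2%N).
Variables (A : finZmodType) (fr : frame p A) (P : pars 'F_p).
Hypothesis ab0 : pa1 P * pb P = 0.
Local Notation Y := (fY fr).
Local Notation Z := (fZ fr).
Local Notation j1 := (fj1 fr).
Local Notation j2 := (fj2 fr).
Local Notation e3 := (fe3 fr).
Local Notation op := (model fr P).

Definition model_pow a n := a *+ n + j2 ('C(n, 2)%:R * (pb P * Z a ^+ 2))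
  + j1 ('C(n, 2)%:R * qf P (Y a) (Z a) (Y a) (Z a)
        + 'C(n, 3)%:R * (pb P * pa2 P * Z a ^+ 3)).

Lemma model_powS a n : model_pow a n.+1 = op (model_pow a n) a.
Proof.
rewrite modelE /model_pow !frE.
(* The e2 part of the power gives g b C(n, 2) z^3, and n^2 - n = 2 C(n, 2) makes the quadratic term
   contribute (a2 - g) b C(n, 2) z^3; the sum keeps only a2 b. *)
have -> : qf P (Y a *+ n + 'C(n, 2)%:R * (pb P * Z a ^+ 2)) (Z a *+ n) (Y a) (Z a)
   = n%:R * qf P (Y a) (Z a) (Y a) (Z a) + 'C(n, 2)%:R * (pb P * pa2 P * Z a ^+ 3).
  rewrite -[Y a *+ n]mulr_natl -[Z a *+ n]mulr_natl.
  have E := natr_sqr_bin2 'F_p n; move: ('C(n, 2)%:R) (n%:R) E => c m E.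
  have nz2 := Fp_nz2 p_pr p_neq2.
  rewrite !qfE exprMn E; case: P ab0 => b a1 a2 g e /= /eqP.
  by rewrite mulf_eq0 => /orP[] /eqP ->; field.
rewrite !binS !bin1 !natrD (mulrSr a) -[Z a *+ n]mulr_natl.
rewrite (_ : ('C(n, 2)%:R + n%:R) * (pb P * Z a ^+ 2) =
  'C(n, 2)%:R * (pb P * Z a ^+ 2) + pb P * (n%:R * Z a) * Z a); last by ring.
rewrite !mulrDl !(fj1D fr) !(fj2D fr); zmod.
Qed.

Section Group.
Variables (gT : finGroupType) (f : A -> gT).
Hypothesis fM : {morph f : a b / op a b >-> (a * b)%g}.

Lemma model_expg a n : (f a ^+ n)%g = f (model_pow a n).
Proof.
elim: n => [|n IH]; last by rewrite expgSr IH model_powS fM.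
have E : op 0 0 = 0 by rewrite (brace_mulr0 (model_brace p_pr p_neq2 fr ab0)).
rewrite /model_pow !bin0n !mul0r addr0 (fj10 fr) (fj20 fr) mulr0n !addr0.
by apply: (@mulgI _ (f 0)); rewrite -fM E expg0 mulg1.
Qed.
End Group.

Lemma bin2p_eq0 : 'C(p, 2)%:R = 0 :> 'F_p.
Proof.
have /dvdnP[k ->] : (p %| 'C(p, 2))%N.
  by apply: prime_dvd_bin => //=; rewrite ltn_neqAle eq_sym p_neq2 prime_gt1.
by rewrite natrM pchar_Fp_0 // mulr0.
Qed.

Definition model_powp a := a *+ p + j1 ('C(p, 3)%:R * (pb P * pa2 P * Z a ^+ 3)).

Lemma model_pow_p a : model_pow a p = model_powp a.
Proof. by rewrite /model_pow bin2p_eq0 !mul0r (fj20 fr) add0r addr0. Qed.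

Hypotheses (oA : #|A| = (p ^ 3)%N) (exp_p2 : forall x : A, x *+ (p ^ 2) = 0).

Lemma model_powp2 a : model_powp (model_powp a) = 0.
Proof.
rewrite {1}/model_powp {2}/model_powp !frE.
have pF (u : 'F_p) : u *+ p = 0 by rewrite -mulr_natl pchar_Fp_0 // mul0r.
rewrite pF expr0n /= !mulr0 (fj10 fr) addr0 /model_powp mulrnDl -mulrnA exp_p2.
by rewrite -(fj1Mn fr) pF (fj10 fr) addr0.
Qed.

(** Collects what the recognition criteria for groups of order p^3 ask for: the order, the p-th
    powers in coordinates and an exponent dividing p^2. *)
Lemma model_mul_group (K : finGroupType -> Prop) :
  (forall (gT : finGroupType) (f : A -> gT),
     bijective f -> {morph f : a b / op a b >-> (a * b)%g} ->
     #|[set: gT]| = (p ^ 3)%N ->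
     (forall a, f a ^+ p = f (model_powp a))%g -> f 0 = 1%g ->
     (forall y : gT, y ^+ (p ^ 2)%N = 1)%g -> K gT) ->
  mul_group_type op K.
Proof.
move=> KP; have br := model_brace p_pr p_neq2 fr ab0.
have [gT [f [g [fK gK fM]]]] := group_of_op (brace_mul_group br).
have bf : bijective f by exists g.
exists gT, f; split => //; apply: (KP gT f bf fM).
- by rewrite cardsT -oA; apply/esym; apply: bij_eq_card bf.
- by move=> a; rewrite model_expg // model_pow_p.
- by apply: (@mulgI _ (f 0)); rewrite -fM mulg1 (brace_mulr0 br).
- move=> y; rewrite -(gK y) expnS expn1 expgM !model_expg // !model_pow_p.
  rewrite model_powp2; apply: (@mulgI _ (f 0)).
  by rewrite -fM mulg1 (brace_mulr0 br).
Qed.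

Lemma model_abelian (gT : finGroupType) (f : A -> gT) :
  bijective f -> {morph f : a b / op a b >-> (a * b)%g} ->
  abelian [set: gT] = (pa2 P == pg P).
Proof.
move=> [g fK gK] fM; apply/idP/eqP => [/centsP cG|E].
  apply: (model_noncomm (fr := fr)); apply: (can_inj fK).
  by rewrite !fM; apply: cG; rewrite inE.
apply/centsP => x _ y _; rewrite /commute -(gK x) -(gK y) -!fM.
by rewrite (model_comm fr E).
Qed.

Lemma model_Zp_cube : pa2 P = pg P -> (forall a, model_powp a = 0) ->
  mul_group_type op (is_Zp_cube p).
Proof.
move=> E K; apply: model_mul_group => gT f bf fM oG fp f0 _.
apply: p3group_is_Zp_cube => //; first by rewrite (model_abelian bf fM) E.
by case: bf => g fK gK x; rewrite -(gK x) fp K f0.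
Qed.

Lemma model_Zp_Zp2 a : pa2 P = pg P -> model_powp a != 0 ->
  mul_group_type op (is_Zp_Zp2 p).
Proof.
move=> E K; apply: model_mul_group => gT f bf fM oG fp f0 y2.
apply: (p3group_is_Zp_Zp2 p_pr (x := f a)) => //.
  by rewrite (model_abelian bf fM) E.
by apply: contra K; rewrite fp -f0 => /eqP/(bij_inj bf) ->.
Qed.

Lemma model_M : pa2 P != pg P -> (forall a, model_powp a = 0) ->
  mul_group_type op (is_M p).
Proof.
move=> E K; apply: model_mul_group => gT f bf fM oG fp f0 _.
apply: p3group_is_M => //; first by rewrite (model_abelian bf fM).
by case: bf => g fK gK x; rewrite -(gK x) fp K f0.
Qed.

Lemma model_M3 a : pa2 P != pg P -> model_powp a != 0 ->
  mul_group_type op (is_M3 p).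
Proof.
move=> E K; apply: model_mul_group => gT f bf fM oG fp f0 y2.
apply: (p3group_is_M3 p_pr (x := f a)) => //.
  by rewrite (model_abelian bf fM).
by apply: contra K; rewrite fp -f0 => /eqP/(bij_inj bf) ->.
Qed.

Lemma model_socleP a : reflect
  [/\ pb P * Z a = 0, pa1 P * Y a + pa2 P * Z a = 0 & pg P * Y a + pe P * Z a = 0]
  (a \in socle op).
Proof.
have jE (u v : 'F_p) : j1 u + j2 v = 0 -> u = 0 /\ v = 0.
  move=> E; have v0 : v = 0 by have := congr1 Y E; rewrite !frE fY0.
  by split => //; apply: (fj1I (f := fr)); move: E; rewrite v0 (fj20 fr) (fj10 fr) addr0.
have eqE b : (brace_lambda op a b == b) = (j1 (qf P (Y a) (Z a) (Y b) (Z b)) + j2 (pb P * Z a * Z b) == 0).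
  rewrite /brace_lambda /model -subr_eq0; congr (_ == _); zmod.
(* The quadratic part is a multiple of b z, so it disappears on the socle and the conditions become
   linear. *)
have key : (pa2 P - pg P) * pb P * Z a ^+ 2 / 2%:R = (pa2 P - pg P) * Z a / 2%:R * (pb P * Z a) by ring.
rewrite inE; apply: (iffP forallP) => [E|[E1 E2 E3] b].
  have := E (j2 1); have := E e3; rewrite !eqE.
  move=> /eqP/jE; rewrite !qfE !frE !mulr0 !mulr1 key => -[E1 E2].
  move=> /eqP/jE; rewrite ?addr0 => -[E3 _].
  by split=> //; move: E1; rewrite E2 mulr0 !(addr0, add0r).
rewrite eqE E1 mul0r (fj20 fr) addr0 qfE E2 key E1 mulr0 addr0 E3 !mul0r addr0.
by rewrite (fj10 fr).
Qed.

Lemma model_socle_card : #|socle op| = (p * #|[set yz : 'F_p * 'F_p |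
  [&& pb P * yz.2 == 0, pa1 P * yz.1 + pa2 P * yz.2 == 0
    & pg P * yz.1 + pe P * yz.2 == 0]%R]|)%N.
Proof.
set S := [set yz | _]; pose h (x : 'F_p * ('F_p * 'F_p)) : A :=
  j1 x.1 + j2 x.2.1 + e3 *+ (x.2.2 : nat).
have hY x : Y (h x) = x.2.1 by rewrite /h !frE mul0rn addr0.
have hZ x : Z (h x) = x.2.2 by rewrite /h !frE natr_Zp.
have hI : injective h.
  move=> [u [y z]] [u' [y' z']] E.
  have Ey : y = y' by have := congr1 Y E; rewrite !hY.
  have Ez : z = z' by have := congr1 Z E; rewrite !hZ.
  move: E; rewrite Ey Ez /h /= => /addIr/addIr/fj1I -> //.
have -> : socle op = h @: setX setT S.
  apply/setP => a; apply/model_socleP/imsetP => [[E1 E2 E3]|[[u yz]]].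
    have [u E] := frameE fr a; exists (u, (Y a, Z a)) => //.
    by rewrite in_setX in_setT /S in_set andTb; apply/and3P; split; apply/eqP; [exact: E1|exact: E2|exact: E3].
  rewrite in_setX in_setT /S in_set andTb => /and3P[/eqP E1 /eqP E2 /eqP E3] ->.
  by rewrite hY hZ.
by rewrite card_imset // cardsX cardsT card_Fp.
Qed.

End ModelPowers.

Lemma card_line p (l m : 'F_p) : prime p -> (l != 0) || (m != 0) ->
  #|[set yz : 'F_p * 'F_p | l * yz.1 + m * yz.2 == 0]| = p.
Proof.
move=> p_pr lm; rewrite -[RHS](card_Fp p_pr) -cardsT.
have -> : [set yz | l * yz.1 + m * yz.2 == 0] = [set (m * t, - (l * t)) | t in [set: 'F_p]].
  apply/setP => -[y z]; rewrite inE /=; apply/eqP/imsetP => [E|[t _ [-> ->]]]; last by ring.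
  case/orP: lm => nz.
    exists (- (z / l)) ; first (by rewrite in_setT); congr (_, _); last by field.
    by apply: (mulfI nz); rewrite (_ : l * y = - (m * z)); [field | apply/eqP; rewrite -addr_eq0 E].
  exists (y / m) ; first (by rewrite in_setT); congr (_, _); first by field.
  by apply: (mulfI nz); rewrite (_ : m * z = - (l * y)); [field | apply/eqP; rewrite -addr_eq0 addrC E].
rewrite card_imset // => t t' E; have /= E1 := congr1 fst E; have /= E2 := congr1 snd E.
case/orP: lm => nz; [apply: (mulfI nz); exact: (oppr_inj E2)|exact: (mulfI nz E1)].
Qed.

Section ModelIso.
Variables (p : nat) (p_pr : prime p).
Variables (A A' : zmodType) (fr : frame p A) (fr' : frame p A') (P P' : pars 'F_p).

(** Here s is the scalar by which f acts on the line [j1], the m's form its matrix on (Y, Z), and r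
    records the [j1] part that f adds to the values of [j2]. *)
Lemma model_iso (f : A -> A') (s r m11 m12 m21 m22 : 'F_p) :
  bijective f -> {morph f : a b / a + b} ->
  (forall u, f (fj1 fr u) = fj1 fr' (s * u)) ->
  (forall a, fY fr' (f a) = m11 * fY fr a + m12 * fZ fr a) ->
  (forall a, fZ fr' (f a) = m21 * fY fr a + m22 * fZ fr a) ->
  (forall t, f (fj2 fr (pb P * t)) = fj2 fr' (m11 * pb P * t) + fj1 fr' (r * t)) ->
  (forall y1 z1 y2 z2, m11 * pb P * (z1 * z2) = pb P' * (m21 * y1 + m22 * z1) * (m21 * y2 + m22 * z2)) ->
  (forall y1 z1 y2 z2, s * qf P y1 z1 y2 z2 + r * (z1 * z2) =
     qf P' (m11 * y1 + m12 * z1) (m21 * y1 + m22 * z1) (m11 * y2 + m12 * z2) (m21 * y2 + m22 * z2)) ->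
  brace_isog (model fr P) (model fr' P').
Proof.
move=> bf fD fj fY' fZ' fj2' E1 E2; exists f => //; split => // a b.
rewrite /model !fD fj !fY' !fZ' -E2 -E1 -(mulrA (pb P)) fj2' (fj1D fr').
by zmod.
Qed.
End ModelIso.

(** * Braces with an adapted frame are models *)

Section FrameClassification.
Variables (p : nat) (p_pr : prime p) (p_neq2 : p != 2%N).
Variables (A : finZmodType) (fr : frame p A) (op : A -> A -> A).
Local Notation Y := (fY fr).
Local Notation Z := (fZ fr).
Local Notation j1 := (fj1 fr).
Local Notation j2 := (fj2 fr).
Local Notation e3 := (fe3 fr).
Hypothesis brA : left_brace op.
Local Notation "a ** b" := (ast op a b) (at level 40).
Hypothesis j1l : forall u b, j1 u ** b = 0.
Hypothesis j1r : forall u b, b ** j1 u = 0.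
Hypothesis j2l : forall u b, exists c, j2 u ** b = j1 c.
Hypothesis j2r : forall u b, exists c, b ** j2 u = j1 c.
Hypothesis Zast : forall a b, Z (a ** b) = 0.

Lemma frame_linear (h : A -> 'F_p) : {morph h : a b / a + b} ->
  (forall u, h (j1 u) = 0) -> forall a, h a = Y a * h (j2 1) + Z a * h e3.
Proof.
move=> hD hj a; have [u E] := frameE fr a.
rewrite [in LHS]E !hD hj add0r (morphMn hD) -mulr_natl natr_Zp; congr (_ + _).
by apply: (Fp_linear p_pr (f := h \o j2)) => x y /=; rewrite (fj2D fr) hD.
Qed.

Definition fX (a : A) : 'F_p := odflt 0 [pick u | a == j1 u].

Lemma fXj1 u : fX (j1 u) = u.
Proof.
rewrite /fX; case: pickP => [v /eqP/fj1I -> //|/(_ u)].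
by rewrite eqxx.
Qed.

(** The action of a on j2 1 and e3 determines everything; al, be and ga are its components.
    Multiplicativity of lambda makes al and be homomorphisms on (A, .), and comparing [op] with +
    turns this into linearity in the coordinates, except for a quadratic term in ga. *)
Lemma model_of_brace :
  exists2 P, pa1 P * pb P = 0 & forall a b, op a b = model fr P a b.
Proof.
pose al a := fX (a ** j2 1); pose be a := Y (a ** e3).
pose ga a := fX (a ** e3 - j2 (be a)).
have alE a : a ** j2 1 = j1 (al a).
  by rewrite /al; have [c ->] := j2r 1 a; rewrite fXj1.
have gaE a : a ** e3 = j2 (be a) + j1 (ga a).
  rewrite /ga; have [u E] := frameE fr (a ** e3).
  move: E; rewrite Zast mulr0n addr0 -/(be a) => E.
  by rewrite {1}E addrC (_ : a ** e3 - _ = j1 u) ?fXj1 // E; zmod.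
have al2 a u : a ** j2 u = j1 (u * al a).
  rewrite -[u in LHS](natr_Zp u) (fj2Mn fr) (astMnr brA) alE -(fj1Mn fr).
  by rewrite -mulr_natl natr_Zp.
have astE' a b : a ** b = j1 (Y b * al a + Z b * ga a) + j2 (Z b * be a).
  have [u E] := frameE fr b; rewrite {1}E !(astDr brA) j1r al2 (astMnr brA) gaE.
  rewrite mulrnDl -(fj1Mn fr) -(fj2Mn fr) -(mulr_natl (be a)) -(mulr_natl (ga a)).
  by rewrite !natr_Zp (fj1D fr); zmod.
have opE' a b : op a b = a + b + j2 (Z b * be a) + j1 (Y b * al a + Z b * ga a).
  by rewrite (opE op) astE'; zmod.
have j1eq u v : j1 u = j1 v -> u = v by apply: fj1I.
have alM a b : al (op a b) = al a + al b.
  by apply: j1eq; rewrite -alE (astM brA) !alE j1r addr0 (fj1D fr).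
have beM a b : be (op a b) = be a + be b.
  by rewrite /be (astM brA) !(fYD fr) (gaE b) (astDr brA) al2 j1r addr0 (fYj1 fr) addr0.
have gaM a b : ga (op a b) = ga a + ga b + be b * al a.
  apply: j1eq; apply: (@addrI _ (j2 (be (op a b)))); rewrite -gaE (astM brA).
  by rewrite !gaE (astDr brA) al2 j1r beM !(fj1D fr) (fj2D fr); zmod.
have al1 u : al (j1 u) = 0 by apply: j1eq; rewrite -alE j1l (fj10 fr).
have be1 u : be (j1 u) = 0 by rewrite /be j1l fY0.
have ga1 u : ga (j1 u) = 0.
  by rewrite /ga j1l be1 (fj20 fr) subr0 -(fj10 fr) fXj1.
have be2 u : be (j2 u) = 0 by rewrite /be; have [c ->] := j2l u e3; rewrite fYj1.
have op1 a u : a + j1 u = op a (j1 u) by rewrite (opE op) j1r addr0.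
have alD1 a u : al (a + j1 u) = al a by rewrite op1 alM al1 addr0.
have beD1 a u : be (a + j1 u) = be a by rewrite op1 beM be1 addr0.
have gaD1 a u : ga (a + j1 u) = ga a by rewrite op1 gaM ga1 be1 mul0r !addr0.
have op2 a u : exists c, op a (j2 u) = a + j2 u + j1 c.
  by exists (u * al a); rewrite (opE op) al2.
have alD2 a u : al (a + j2 u) = al a + al (j2 u).
  by have [c E] := op2 a u; rewrite -(alD1 _ c) -E alM.
have beD2 a u : be (a + j2 u) = be a.
  by have [c E] := op2 a u; rewrite -(beD1 _ c) -E beM be2 addr0.
have gaD2 a u : ga (a + j2 u) = ga a + ga (j2 u).
  by have [c E] := op2 a u; rewrite -(gaD1 _ c) -E gaM be2 mul0r addr0.
have beD : {morph be : a b / a + b}.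
  by move=> a b; rewrite -beM opE' beD1 beD2.
have beZ a : be a = Z a * be e3 by rewrite (frame_linear beD be1) be2 mulr0 add0r.
set b0 := be e3 in beZ.
have lin2 (h : A -> 'F_p) : (forall a u, h (a + j2 u) = h a + h (j2 u)) -> forall u, h (j2 u) = u * h (j2 1).
  by move=> hD; apply: (Fp_linear p_pr (f := h \o j2)) => x y /=; rewrite (fj2D fr) hD.
pose a1 := al (j2 1); pose g := ga (j2 1); pose a2 := al e3.
have alD' a b : al (a + b) + b0 * Z a * Z b * a1 = al a + al b.
  by rewrite -alM opE' alD1 alD2 (lin2 al alD2) beZ -/a1; congr (_ + _); ring.
have gaD' a b : ga (a + b) + b0 * Z a * Z b * g = ga a + ga b + b0 * Z b * al a.
  rewrite -[b0 * Z b](mulrC (Z b)) -beZ -gaM opE' gaD1 gaD2 (lin2 ga gaD2) beZ -/g.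
  by congr (_ + _); ring.
(* The two expressions for ga (a + b) = ga (b + a) are compared; at j2 1 and e3 this is a1 b = 0. *)
have sym a b : b0 * Z b * al a = b0 * Z a * al b.
  apply: (@addrI _ (ga a + ga b)); rewrite -gaD' (addrC (ga a)) -gaD' (addrC a b).
  by congr (_ + _); ring.
have ab0 : a1 * b0 = 0.
  by have := sym (j2 1) e3; rewrite !frE mulr1 mulr0 mul0r mulrC.
have alD : {morph al : a b / a + b}.
  move=> a b; rewrite -alD' (_ : _ * a1 = Z a * Z b * (a1 * b0)); last by ring.
  by rewrite ab0 mulr0 addr0.
have alE2 a : al a = Y a * a1 + Z a * a2 by apply: frame_linear.
have nz2 := Fp_nz2 p_pr p_neq2.
(* The cross term of ga at a sum is (a2 - g) b z z', the polarization of the function subtracted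
   here. *)
pose de a := ga a - (a2 - g) * b0 * Z a ^+ 2 / 2%:R.
have deD : {morph de : a b / a + b}.
  move=> a b; rewrite /de (fZD fr).
  have -> : ga (a + b) = ga a + ga b + b0 * Z b * al a - b0 * Z a * Z b * g.
    by rewrite -gaD' addrK.
  rewrite alE2.
  rewrite (_ : b0 * Z b * _ = Y a * Z b * (a1 * b0) + b0 * Z a * Z b * a2); last by ring.
  by rewrite ab0 mulr0 add0r; field.
have de1 u : de (j1 u) = 0 by rewrite /de ga1 (fZj1 fr) expr0n /= mulr0 mul0r subr0.
have deE := frame_linear deD de1.
have de2 : de (j2 1) = g by rewrite /de (fZj2 fr) expr0n /= mulr0 mul0r subr0.
have gaE2 a : ga a = g * Y a + (a2 - g) * b0 * Z a ^+ 2 / 2%:R + de e3 * Z a.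
  have := deE a; rewrite {1}/de de2 => /eqP; rewrite subr_eq => /eqP ->; ring.
exists (Pars b0 a1 a2 g (de e3)) => // a b.
rewrite opE' modelE qfE /= beZ alE2 gaE2.
rewrite (_ : Z b * (Z a * b0) = b0 * Z a * Z b); last by ring.
rewrite addrAC; congr (_ + j1 _ + _); ring.
Qed.

End FrameClassification.

Lemma brace_isog_sym (A B : zmodType) (opA : A -> A -> A) (opB : B -> B -> B) :
  brace_isog opA opB -> brace_isog opB opA.
Proof.
case=> f [g fK gK] [fD fM]; exists g; first by exists f.
by split=> a b; apply: (can_inj fK); rewrite ?fD ?fM !gK.
Qed.

Lemma brace_isog_trans (A B C : zmodType) (opA : A -> A -> A) (opB : B -> B -> B)
    (opC : C -> C -> C) :
  brace_isog opA opB -> brace_isog opB opC -> brace_isog opA opC.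
Proof.
case=> f bf [fD fM] [g bg [gD gM]]; exists (g \o f); first exact: bij_comp.
by split=> a b /=; rewrite ?fD ?fM ?gD ?gM.
Qed.

Lemma brace_isog_eq (A : zmodType) (op op' : A -> A -> A) :
  (forall a b, op a b = op' a b) -> brace_isog op op'.
Proof. by move=> E; exists id; [exists id | split]. Qed.

Lemma left_brace_eq (A : zmodType) (op op' : A -> A -> A) :
  (forall a b, op a b = op' a b) -> left_brace op -> left_brace op'.
Proof.
move=> E [[opA [e [iv [e1 e2 iv1 iv2]]]] opD].
split; last by move=> a b c; rewrite -!E.
split; first by move=> a b c; rewrite -!E.
by exists e, iv; split=> a; rewrite -E.
Qed.

Lemma left_brace_transport (A B : zmodType) (opB : B -> B -> B) (f : A -> B) (g : B -> A) :
  cancel f g -> cancel g f -> {morph f : a b / a + b} -> left_brace opB ->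
  left_brace (fun a b => g (opB (f a) (f b))).
Proof.
move=> fK gK fD [[opA [e [iv [e1 e2 iv1 iv2]]]] opD].
have gD a b : g (a + b) = g a + g b by apply: (can_inj fK); rewrite fD !gK.
split.
  split; first by move=> a b c; rewrite !gK opA.
  exists (g e), (fun a => g (iv (f a))); split=> a; rewrite gK ?e1 ?e2 ?iv1 ?iv2 //.
by move=> a b c; rewrite -[in X in _ + X = _](fK a) -gD fD opD gD.
Qed.

Lemma transport_model (p : nat) (p_pr : prime p) (p_neq2 : p != 2%N)
    (A : finZmodType) (B : zmodType) (fr : frame p A) (op : B -> B -> B) (f : A -> B) :
  left_brace op -> bijective f -> {morph f : a b / a + b} ->
  (forall u b, ast op (f (fj1 fr u)) b = 0) ->
  (forall u b, ast op b (f (fj1 fr u)) = 0) ->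
  (forall u b, exists c, ast op (f (fj2 fr u)) b = f (fj1 fr c)) ->
  (forall u b, exists c, ast op b (f (fj2 fr u)) = f (fj1 fr c)) ->
  (forall a b, exists c d, ast op a b = f (fj1 fr c + fj2 fr d)) ->
  exists2 P, pa1 P * pb P = 0 & brace_isog op (model fr P).
Proof.
move=> br [g fK gK] fD H1 H2 H3 H4 H5.
pose op' a b := g (op (f a) (f b)).
have br' : left_brace op' by exact: (left_brace_transport fK gK fD br).
have gD a b : g (a + b) = g a + g b by apply: (can_inj fK); rewrite fD !gK.
have gN a : g (- a) = - g a by apply: morphN.
have astE' a b : ast op' a b = g (ast op (f a) (f b)).
  by rewrite !astE !gD !gN !fK.
have g0 : g 0 = 0 by apply: morph0.
have [|||||P P0 E] := model_of_brace p_pr p_neq2 (fr := fr) br'.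
- by move=> u b; rewrite astE' H1.
- by move=> u b; rewrite astE' H2.
- by move=> u b; have [c E] := H3 u (f b); exists c; rewrite astE' E fK.
- by move=> u b; have [c E] := H4 u (f b); exists c; rewrite astE' E fK.
- by move=> a b; rewrite astE'; have [c [d ->]] := H5 (f a) (f b); rewrite fK !frE.
exists P => //; exists g; first by exists f.
by split=> // a b; rewrite -E /op' !gK.
Qed.

(** * Frames on the two non-cyclic additive groups *)

Section StandardFrames.
Variables (p : nat) (p_pr : prime p).

Lemma Fp_val_nat n : ((n%:R : 'F_p) : nat) = (n %% p)%N.
Proof. by rewrite val_Fp_nat. Qed.

Lemma prime_sq_gt1 : (1 < p ^ 2)%N.
Proof. by rewrite -(exp1n 2) ltn_exp2r // prime_gt1. Qed.

Lemma Zp2_val_nat n : ((n%:R : 'Z_(p ^ 2)) : nat) = (n %% p ^ 2)%N.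
Proof. by rewrite val_Zp_nat // prime_sq_gt1. Qed.

Lemma redp_nat n : redp (n%:R : 'Z_(p ^ 2)) = n%:R.
Proof.
apply/val_inj; rewrite /redp /= -[LHS]/((_%:R : 'F_p) : nat) -[RHS]/((_%:R : 'F_p) : nat).
by rewrite !Fp_val_nat Zp2_val_nat modn_dvdm // expnS dvdn_mulr.
Qed.

Lemma redpD : {morph @redp p : a b / a + b}.
Proof.
move=> a b; rewrite -[a]natr_Zp -[b]natr_Zp -natrD !redp_nat natrD //.
Qed.

Lemma ptimes_nat n : ptimes (n%:R : 'F_p) = (p * n)%N%:R.
Proof.
rewrite /ptimes Fp_val_nat {2}(divn_eq n p) mulnDr natrD mulnCA mulnn (natrM _ (n %/ p)).
by rewrite pchar_Zp ?prime_sq_gt1 // mulr0 add0r.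
Qed.

Lemma ptimesD : {morph @ptimes p : a b / a + b}.
Proof.
by move=> a b; rewrite -[a]natr_Zp -[b]natr_Zp -natrD !ptimes_nat mulnDr natrD.
Qed.

Lemma redp_ptimes u : redp (ptimes u : 'Z_(p ^ 2)) = 0.
Proof. by rewrite -[u]natr_Zp ptimes_nat redp_nat natrM pchar_Fp_0 // mul0r. Qed.

Lemma ptimes_inj : injective (@ptimes p).
Proof.
move=> u v; rewrite /ptimes => /(congr1 (@nat_of_ord _)); rewrite !Zp2_val_nat.
have lt (w : 'F_p) : (p * w < p ^ 2)%N.
  by rewrite expnS expn1 ltn_pmul2l ?prime_gt0 //; have := ltn_ord w; rewrite [X in (_ < X)%N]Fp_cast.
rewrite !modn_small // => /eqP; rewrite eqn_pmul2l ?prime_gt0 // => /eqP uv.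
exact/val_inj.
Qed.

Lemma redp_eq0 (y : 'Z_(p ^ 2)) : redp y = 0 -> exists u, y = ptimes u.
Proof.
rewrite /redp => /(congr1 (@nat_of_ord _)); rewrite Fp_val_nat /= => /eqP.
rewrite -/(dvdn _ _) => /dvdnP[k E]; exists k%:R.
by rewrite ptimes_nat mulnC -E natr_Zp.
Qed.

Lemma ptimes_redp (y : 'Z_(p ^ 2)) : ptimes (redp y) = y *+ p.
Proof.
by rewrite -[y in RHS]natr_Zp /redp ptimes_nat mulnC natrM mulr_natr.
Qed.

Local Notation F := 'F_p.

Definition elem_frame : frame p (F * F * F)%type.
Proof.
refine (@Frame p (F * F * F)%type (fun a => a.1.2) (fun a => a.2)
  (fun u => (u, 0, 0)) (fun u => (0, u, 0)) (0, 0, 1) _ _ _ _ _ _ _ _ _ _ _ _) => //.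
- by move=> a b; congr (_, _, _); rewrite addr0.
- by move=> a b; congr (_, _, _); rewrite addr0.
- by move=> u v /= [].
- by move=> [[a b] c] /= -> ->; exists a.
Defined.

Definition mix_frame : frame p (F * 'Z_(p ^ 2))%type.
Proof.
refine (@Frame p (F * 'Z_(p ^ 2))%type (fun a => a.1) (fun a => redp a.2)
  (fun u => (0, ptimes u)) (fun u => (u, 0)) (0, 1) _ _ _ _ _ _ _ _ _ _ _ _) => //.
- by move=> a b; apply: redpD.
- by move=> a b; congr (_, _); rewrite ?addr0 ?ptimesD.
- by move=> a b; congr (_, _); rewrite addr0.
- by move=> u; apply: redp_ptimes.
- by move=> u v /(congr1 snd); apply: ptimes_inj.
- by move=> [a b] /= -> /redp_eq0[u ->]; exists u.
Defined.

End StandardFrames.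

Lemma mulrn_modn (V : zmodType) (e : V) m n : e *+ m = 0 -> e *+ (n %% m) = e *+ n.
Proof.
by move=> em; rewrite [in RHS](divn_eq n m) mulrnDr mulnC mulrnA em mul0rn add0r.
Qed.

Lemma mulrn_FpD (p : nat) (p_pr : prime p) (V : zmodType) (e : V) (u v : 'F_p) :
  e *+ p = 0 -> e *+ (u + v : 'F_p)%R = e *+ u + e *+ v.
Proof.
move=> pe; rewrite -mulrnDr -[in RHS](mulrn_modn _ pe); congr (_ *+ _).
by rewrite -[LHS]/((u + v) %% (Zp_trunc (pdiv p)).+2)%N; congr (_ %% _)%N; apply: Fp_cast.
Qed.

Lemma mulrn_Zp2D (p : nat) (p_pr : prime p) (V : zmodType) (e : V) (u v : 'Z_(p ^ 2)) :
  e *+ (p ^ 2) = 0 -> e *+ (u + v : 'Z_(p ^ 2))%R = e *+ u + e *+ v.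
Proof.
move=> pe; rewrite -mulrnDr -[in RHS](mulrn_modn _ pe); congr (_ *+ _).
rewrite -[LHS]/((u + v) %% (Zp_trunc (p ^ 2)).+2)%N; congr (_ %% _)%N.
by apply: Zp_cast; apply: prime_sq_gt1.
Qed.

Lemma morph_inj (V W : zmodType) (f : V -> W) : {morph f : a b / a + b} ->
  (forall x, f x = 0 -> x = 0) -> injective f.
Proof.
move=> fD f0 x y E; apply/eqP; rewrite -subr_eq0; apply/eqP/f0.
by rewrite fD (morphN fD) E subrr.
Qed.

(** * Non-cyclic braces are models *)

Section NonCyclic.
Variables (p : nat) (B : finZmodType) (op : B -> B -> B).
Hypothesis brB : left_brace op.
Hypotheses (p_pr : prime p) (p_neq2 : p != 2%N) (oB : #|B| = (p ^ 3)%N).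
Hypothesis exp_p2 : forall x : B, x *+ (p ^ 2) = 0.
Local Notation "a ** b" := (ast op a b) (at level 40).

Lemma Fp_dvd0 (u : 'F_p) : (p %| u)%N -> u = 0.
Proof.
move=> /dvdnP[k E]; rewrite -[u]natr_Zp E natrM pchar_Fp_0 // mulr0 //.
Qed.

Lemma noncyclic_model :
  (exists2 P, pa1 P * pb P = 0 & brace_isog op (model (elem_frame p) P)) \/
  (exists2 P, pa1 P * pb P = 0 & brace_isog op (model (mix_frame p_pr) P)).
Proof.
have [e1 [e2 [e3 [[e10 pe1 e1b be1] [e2D pe2 e2b be2] e3D alt D2b]]]] :=
  adapted_basis brB p_pr p_neq2 oB exp_p2.
set D1 := <[e1]>%g in e2D e2b be2 e3D D2b; set D2 := (D1 <*> <[e2]>)%g in e3D D2b.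
pose D1g := <[e1]>%G : {group B}; pose D2g := (D1g <*> <[e2]>)%G : {group B}.
have D1P x : x \in D1 -> exists n : nat, x = e1 *+ n by move/mem_cycleP.
have D2P x : x \in D2 -> exists n m : nat, x = e1 *+ n + e2 *+ m.
  by move/mem_joinP => [d /mem_cycleP[n ->] [m ->]]; exists n, m.
have pe3 : e3 *+ p \in D2g.
  case: alt => [->|->]; first exact: subg0.
  by apply: mem_joinl; apply/mem_cycleP; exists 1%N.
have be1n b n : b ** (e1 *+ n) = 0 by rewrite (astMnr brB) be1 mul0rn.
have e1bn b n : (e1 *+ n) ** b = 0.
  elim: n => [|n IH]; first exact: ast0l.
  have -> : e1 *+ n.+1 = op e1 (e1 *+ n) by rewrite (opE op) e1b addr0 mulrS.
  by rewrite (astM brB) e1b IH e1b !addr0.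
have be2n b n : b ** (e2 *+ n) \in D1g by rewrite (astMnr brB) subgMn.
(* [ast] is not additive on the left, so the multiple of e2 is built up as a product with e2, the
   error being absorbed in the multiple of e1. *)
have D2l n : forall k b, (e1 *+ k + e2 *+ n) ** b \in D1g.
  elim: n => [|n IH] k b; first by rewrite addr0 e1bn subg0.
  have [m Em] : exists m, e1 *+ k - e2 ** (e2 *+ n) = e1 *+ m.
    by apply: D1P; apply: (@subgB _ D1g) => //; apply/mem_cycleP; exists k.
  have -> : e1 *+ k + e2 *+ n.+1 = op e2 (e1 *+ m + e2 *+ n).
    by rewrite (opE op) (astDr brB) be1n -Em (mulrS e2); zmod.
  by rewrite (astM brB) !subgD // ?IH ?e2b.
have val_k n : e1 *+ n = e1 *+ ((n%:R : 'F_p) : nat).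
  by rewrite Fp_val_nat // mulrn_modn.
have val_k2 n : e2 *+ n = e2 *+ ((n%:R : 'F_p) : nat).
  by rewrite Fp_val_nat // mulrn_modn.
have D1z n m k : e1 *+ n + e2 *+ m + e3 *+ k = 0 -> (p %| k)%N.
  move=> E; apply: (mulrn_notin (D := D2g) p_pr e3D pe3).
  rewrite (_ : e3 *+ k = - (e1 *+ n + e2 *+ m)); last by apply/eqP; rewrite -addr_eq0 addrC E.
  by rewrite subgN; apply/mem_joinP; exists (e1 *+ n); [apply/mem_cycleP; exists n|exists m].
have D2z n m : e1 *+ n + e2 *+ m = 0 -> (p %| m)%N.
  move=> E; apply: (mulrn_notin (D := D1g) p_pr e2D); first by rewrite pe2 subg0.
  rewrite (_ : e2 *+ m = - (e1 *+ n)); last by apply/eqP; rewrite -addr_eq0 addrC E.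
  by rewrite subgN; apply/mem_cycleP; exists n.
case: alt => alt; [left|right].
  pose f (a : 'F_p * 'F_p * 'F_p) : B := e1 *+ a.1.1 + e2 *+ a.1.2 + e3 *+ a.2.
  have fD : {morph f : a b / a + b}.
    by move=> a b; rewrite /f !(mulrn_FpD p_pr) ?alt //; zmod.
  have bf : bijective f.
    apply: inj_card_bij; last by rewrite oB !card_prod !card_Fp // -mulnA.
    apply: morph_inj => // -[[x y] z] E.
    have z0 : z = 0 by apply: Fp_dvd0; apply: D1z E.
    move: E; rewrite /f z0 /= addr0 => E.
    have y0 : y = 0 by apply: Fp_dvd0; apply: D2z E.
    move: E; rewrite y0 /= addr0 => /eqP; rewrite (mulrn_ord p_pr _ e10 pe1).
    by move/Fp_dvd0 => ->.
  have fj1E u : f (fj1 (elem_frame p) u) = e1 *+ u by rewrite /f /= !addr0.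
  have fj2E u : f (fj2 (elem_frame p) u) = e2 *+ u by rewrite /f /= add0r !addr0.
  apply: (transport_model p_pr p_neq2 brB bf fD).
  - by move=> u b; rewrite fj1E e1bn.
  - by move=> u b; rewrite fj1E be1n.
  - move=> u b; rewrite fj2E; have := D2l u 0%N b; rewrite add0r => /D1P[n ->].
    by exists n%:R; rewrite fj1E -val_k.
  - move=> u b; rewrite fj2E; have := be2n b u => /D1P[n ->].
    by exists n%:R; rewrite fj1E -val_k.
  move=> a b; have /D2P[n [m ->]] := D2b a b.
  by exists n%:R, m%:R; rewrite fD fj1E fj2E -val_k -val_k2.
(* The multiples of e1 = p e3 are reached through second coordinates divisible by p. *)
pose f (a : 'F_p * 'Z_(p ^ 2)) : B := e2 *+ a.1 + e3 *+ a.2.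
have fD : {morph f : a b / a + b}.
  by move=> a b; rewrite /f (mulrn_FpD p_pr) // (mulrn_Zp2D p_pr) //; zmod.
have ek n : e3 *+ (p * n) = e1 *+ n by rewrite mulrnA alt.
have bf : bijective f.
  apply: inj_card_bij; last first.
    by rewrite oB card_prod card_Fp // card_ord Zp_cast ?prime_sq_gt1 // -expnS.
  apply: morph_inj => // -[x y] /= E.
  have /dvdnP[k Ek] : (p %| y)%N by apply: (@D1z 0%N x); rewrite mulr0n add0r.
  move: E; rewrite /f /= Ek mulnC ek addrC => E.
  have x0 : x = 0 by apply: Fp_dvd0; apply: D2z E.
  move: E; rewrite x0 /= addr0 => /eqP; rewrite (mulrn_ord p_pr _ e10 pe1).
  case/dvdnP => l kl; congr (_, _).
  by rewrite -[y]natr_Zp Ek kl -mulnA mulnn natrM pchar_Zp ?mulr0 // prime_sq_gt1.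
have fj1E u : f (fj1 (mix_frame p_pr) u) = e1 *+ u.
  rewrite /f /= /ptimes mulr0n add0r Zp2_val_nat // mulrn_modn ?ek //.
have fj2E u : f (fj2 (mix_frame p_pr) u) = e2 *+ u by rewrite /f /= !addr0.
apply: (transport_model p_pr p_neq2 brB bf fD).
- by move=> u b; rewrite fj1E e1bn.
- by move=> u b; rewrite fj1E be1n.
- move=> u b; rewrite fj2E; have := D2l u 0%N b; rewrite add0r => /D1P[n ->].
  by exists n%:R; rewrite fj1E -val_k.
- move=> u b; rewrite fj2E; have := be2n b u => /D1P[n ->].
  by exists n%:R; rewrite fj1E -val_k.
move=> a b; have /D2P[n [m ->]] := D2b a b.
by exists n%:R, m%:R; rewrite fD fj1E fj2E -val_k -val_k2.
Qed.
End NonCyclic.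

(** * Cyclic additive group *)

Section Cyclic.
Variables (p : nat).
Hypotheses (p_pr : prime p) (p_neq2 : p != 2%N).
Local Notation R := 'Z_(p ^ 3).

Definition cyc_op (s x y : R) : R := x + y + s * x * y.

Lemma p3_gt1 : (1 < p ^ 3)%N.
Proof. by rewrite -(exp1n 3) ltn_exp2r // prime_gt1. Qed.

Lemma Zp3_p3 : (p ^ 3)%N%:R = 0 :> R.
Proof. exact/pchar_Zp/p3_gt1. Qed.

Lemma Zp3_nat_eq0 n : (n%:R == 0 :> R) = (p ^ 3 %| n)%N.
Proof.
rewrite -(inj_eq val_inj) /= -[X in X == _]/((n%:R : R) : nat).
by rewrite val_Zp_nat // p3_gt1.
Qed.

Lemma card_Zp3 : #|(R : finType)| = (p ^ 3)%N.
Proof. by rewrite card_ord Zp_cast // p3_gt1. Qed.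

Lemma cyc_brace s : s ^+ 3 = 0 -> left_brace (cyc_op s).
Proof.
move=> s3; split; last by move=> a b c; rewrite /cyc_op; ring.
split; first by move=> a b c; rewrite /cyc_op; ring.
(* The inverse is -x / (1 + s x), with the geometric series cut off by s^3 = 0. *)
exists 0, (fun x => - x * (1 - s * x + s ^+ 2 * x ^+ 2)).
split=> x; rewrite /cyc_op; try ring.
  by transitivity (- s ^+ 3 * x ^+ 4); [ring|rewrite s3; ring].
by transitivity (- s ^+ 3 * x ^+ 4); [ring|rewrite s3; ring].
Qed.

(** As x |-> 1 + s x turns [cyc_op] into multiplication, the n-th power of 1 is ((1 + s)^n - 1) / s,
    whose expansion stops at s^2 when s^3 = 0. *)
Definition cyc_pow (s : R) n : R := n%:R + s * 'C(n, 2)%:R + s ^+ 2 * 'C(n, 3)%:R.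

Lemma cyc_powS s n : s ^+ 3 = 0 -> cyc_pow s n.+1 = 1 + cyc_pow s n + s * cyc_pow s n.
Proof.
move=> s3; rewrite /cyc_pow !binS !bin1 !natrD -natr1.
transitivity (1 + (n%:R + s * 'C(n, 2)%:R + s ^+ 2 * 'C(n, 3)%:R) + s * (n%:R + s * 'C(n, 2)%:R + s ^+ 2 * 'C(n, 3)%:R) - s ^+ 3 * 'C(n, 3)%:R); first by ring.
by rewrite s3; ring.
Qed.

(** Both correction terms are multiples of p^3: p^2 divides C(p^2, 2) since p is odd, and p divides
    C(p^2, 3). So the p^2-th power of 1 is not trivial, and 1 generates (R, .). *)
Lemma cyc_pow_p2 t : cyc_pow (p%:R * t) (p ^ 2) = (p ^ 2)%N%:R.
Proof.
have od : odd (p ^ 2) by rewrite oddX /=; case: (even_prime p_pr) => // E; move: p_neq2; rewrite E.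
rewrite /cyc_pow; have -> : 'C(p ^ 2, 2) = (p ^ 2 * (p ^ 2).-1./2)%N by apply: bin2odd.
(* From 3 C(p^2, 3) = p^2 C(p^2 - 1, 2); one factor p is left even when p = 3. *)
have /dvdnP[k ->] : (p %| 'C(p ^ 2, 3))%N.
  have d3 : (p ^ 2 %| 3 * 'C(p ^ 2, 3))%N by rewrite -mul_bin_diag dvdn_mulr.
  case: (eqVneq p 3) d3 => [-> d3|p3 d3].
    by rewrite -(@dvdn_pmul2l 3) // (dvdn_trans _ d3).
  rewrite -(@Gauss_dvdr _ 3); first by apply: dvdn_trans d3; rewrite dvdn_mulr.
  by rewrite prime_coprime // dvdn_prime2.
rewrite !natrM.
have E : p%:R ^+ 3 = 0 :> R by rewrite -natrX Zp3_p3.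
transitivity ((p ^ 2)%N%:R + p%:R ^+ 3 * (t * (p ^ 2).-1./2%:R + t ^+ 2 * k%:R) : R).
  by rewrite !natrX; ring.
by rewrite E mul0r addr0 -natrM.
Qed.

Lemma Zp3_p2_neq0 : (p ^ 2)%N%:R != 0 :> R.
Proof. by rewrite Zp3_nat_eq0 dvdn_Pexp2l ?prime_gt1. Qed.

Section CycGroup.
Variable t : R.
Local Notation s := (p%:R * t).

Lemma cyc_s3 : s ^+ 3 = 0.
Proof. by rewrite exprMn -natrX Zp3_p3 mul0r. Qed.

Variables (gT : finGroupType) (f : R -> gT).
Hypothesis fM : {morph f : a b / cyc_op s a b >-> (a * b)%g}.

Lemma cyc_f0 : f 0 = 1%g.
Proof.
apply: (@mulgI _ (f 0)); rewrite -fM mulg1; congr f.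
by rewrite /cyc_op; ring.
Qed.

Lemma cyc_expg n : (f 1%R ^+ n)%g = f (cyc_pow s n).
Proof.
elim: n => [|n IH]; first by rewrite /cyc_pow !mulr0 !addr0 cyc_f0.
by rewrite expgS IH -fM cyc_powS ?cyc_s3 // /cyc_op mulr1.
Qed.

Hypothesis bf : bijective f.

Lemma cyc_gen_exp : (f 1%R ^+ (p ^ 2)%N != 1)%g.
Proof.
by rewrite cyc_expg cyc_pow_p2 -cyc_f0 (bij_eq bf) Zp3_p2_neq0.
Qed.

Lemma cyc_group_order : #|[set: gT]| = (p ^ 3)%N.
Proof. by rewrite cardsT -card_Zp3; apply/esym; apply: bij_eq_card bf. Qed.

(** The element 1 has order p^3 in (R, .), so a formula need only be checked on its powers. *)
Lemma cyc_generated a : exists n, a = cyc_pow s n.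
Proof.
have ox : #[f 1%R]%g = (p ^ 3)%N.
  have : (#[f 1%R]%g %| #|[set: gT]|)%N by rewrite order_dvdG ?inE.
  rewrite cyc_group_order.
  case/(dvdn_pfactor _ _ p_pr) => m lem ox; rewrite ox; congr (_ ^ _)%N.
  apply/eqP; rewrite eqn_leq lem ltnNge; apply: contra cyc_gen_exp => lem2.
  by rewrite -order_dvdn ox dvdn_exp2l.
have : f a \in <[f 1%R]>%g.
  suff -> : <[f 1%R]>%g = [set: gT] by rewrite inE.
  by apply/eqP; rewrite eqEcard subsetT /= cyc_group_order -orderE ox.
by case/cycleP => n; rewrite cyc_expg => /(bij_inj bf) ->; exists n.
Qed.
End CycGroup.

Lemma cyc_mul_group t : mul_group_type (cyc_op (p%:R * t)) (is_Zp3 p).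
Proof.
have br := cyc_brace (cyc_s3 t).
have [gT [f [g [fK gK fM]]]] := group_of_op (brace_mul_group br).
have bf : bijective f by exists g.
exists gT, f; split => //.
apply: (p3group_is_Zp3 p_pr _ (cyc_gen_exp fM bf)).
exact: cyc_group_order bf.
Qed.

Lemma card_pk_torsion k : (k <= 3)%N ->
  #|[set x : R | (p ^ k)%N%:R * x == 0]| = (p ^ k)%N.
Proof.
move=> k3; have pk : (0 < p ^ (3 - k))%N by rewrite expn_gt0 prime_gt0.
have Ek : (p ^ k * p ^ (3 - k) = p ^ 3)%N by rewrite -expnD subnKC.
pose h (i : 'I_(p ^ k)) : R := (p ^ (3 - k) * i)%N%:R.
have -> : [set x : R | (p ^ k)%N%:R * x == 0] = h @: setT.
  apply/setP => x; rewrite inE; apply/idP/imsetP => [|[i _ ->]]; last first.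
    by rewrite /h -natrM mulnA Ek natrM Zp3_p3 mul0r.
  rewrite -{1}[x]natr_Zp -natrM Zp3_nat_eq0 => H.
  have : (p ^ k * p ^ (3 - k) %| p ^ k * x)%N by rewrite Ek.
  rewrite dvdn_pmul2l ?expn_gt0 ?prime_gt0 // => /dvdnP[m Em] {H}.
  have mk : (m < p ^ k)%N.
    have := ltn_ord x; rewrite [X in (_ < X)%N]Zp_cast ?p3_gt1 // Em -Ek.
    by rewrite ltn_pmul2r.
  by exists (Ordinal mk); rewrite ?inE // /h /= mulnC -Em natr_Zp.
rewrite card_imset ?cardsT ?card_ord // => i j /(congr1 val) /=.
rewrite -[LHS]/((_%:R : R) : nat) -[RHS]/((_%:R : R) : nat).
have lt (l : 'I_(p ^ k)) : (p ^ (3 - k) * l < p ^ 3)%N.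
  by rewrite -Ek mulnC ltn_pmul2r.
rewrite !val_Zp_nat ?p3_gt1 // !modn_small //.
by move/eqP; rewrite eqn_pmul2l // => /eqP/val_inj.
Qed.

Lemma cyc_socle s : socle (cyc_op s) = [set x | s * x == 0].
Proof.
apply/setP => x; rewrite !inE; apply/forallP/eqP => [/(_ 1)|E y].
  rewrite /brace_lambda /cyc_op -subr_eq0 => /eqP E.
  by rewrite -[RHS]E; ring.
by rewrite /brace_lambda /cyc_op E; apply/eqP; ring.
Qed.

Lemma cyc_scale s v : v \is a GRing.unit -> brace_isog (cyc_op s) (cyc_op (s / v)).
Proof.
move=> vU; exists (fun x => v * x).
  by exists (fun x => v^-1 * x) => x; rewrite mulrA ?mulVr ?mulrV ?mul1r.
split=> x y; first by rewrite mulrDr.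
rewrite /cyc_op.
transitivity (v * x + v * y + s * (v^-1 * v) * v * x * y); last by ring.
by rewrite mulVr //; ring.
Qed.

(** Writing p t = p^k m with m prime to p, the unit m is scaled away, and p^k vanishes from k = 3
    on. *)
Lemma cyc_normal t : exists2 k, (1 <= k <= 3)%N &
  brace_isog (cyc_op (p%:R * t)) (cyc_op (p ^ k)%N%:R).
Proof.
case: (posnP (p * t)) => [t0|pt0].
  exists 3 => //; apply: brace_isog_eq => a b.
  by rewrite /cyc_op Zp3_p3 -[t]natr_Zp -natrM t0.
have [m cm Em] := pfactor_coprime p_pr pt0.
set k := logn p _ in Em.
have k0 : (0 < k)%N by rewrite logn_gt0 mem_primes p_pr pt0 dvdn_mulr.
have E : p%:R * t = (p ^ k)%N%:R * m%:R by rewrite -{1}[t]natr_Zp -!natrM Em mulnC.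
have mU : (m%:R : R) \is a GRing.unit.
  by rewrite unitZpE ?p3_gt1 // coprimeXl.
case: (leqP k 3) => k3.
  exists k; rewrite ?k0 //.
  by have := cyc_scale (p%:R * t) mU; rewrite {2}E mulrK.
exists 3 => //; apply: brace_isog_eq => a b.
by rewrite /cyc_op E -(subnKC (ltnW k3)) expnD natrM Zp3_p3 !mul0r.
Qed.

(** The product is determined by h a = a * 1. Stability of the flag shows that h takes multiples of
    p as values, and h is then computed on the powers of 1, which exhaust the ring. *)
Lemma cyc_classification (B : finZmodType) (op : B -> B -> B) (y : B) :
  left_brace op -> #|B| = (p ^ 3)%N -> y *+ (p ^ 2) != 0 ->
  exists2 k, (1 <= k <= 3)%N & brace_isog op (cyc_op (p ^ k)%N%:R).
Proof.
move=> brB oB yp2.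
have yp3 : y *+ (p ^ 3) = 0 by apply: mulrn_card.
have oy : #[y]%g = (p ^ 3)%N.
  have : (#[y]%g %| p ^ 3)%N by rewrite -oB -cardsT order_dvdG ?inE.
  case/(dvdn_pfactor _ _ p_pr) => m lem ox; rewrite ox; congr (_ ^ _)%N.
  apply/eqP; rewrite eqn_leq lem ltnNge; apply: contra yp2 => lem2.
  by rewrite -FinRing.zmodXgE -[_ == 0]/(_ == 1%g) -order_dvdn ox dvdn_exp2l.
pose f (x : R) : B := y *+ x.
have fD : {morph f : a b / a + b}.
  move=> a b; rewrite /f -mulrnDr -[in RHS](mulrn_modn _ yp3); congr (_ *+ _).
  rewrite -[LHS]/((a + b) %% (Zp_trunc (p ^ 3)).+2)%N; congr (_ %% _)%N.
  by apply: Zp_cast; apply: p3_gt1.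
have bf : bijective f.
  apply: inj_card_bij; last by rewrite oB card_Zp3.
  apply: morph_inj => // x /eqP.
  rewrite /f -FinRing.zmodXgE -[_ == 0]/(_ == 1%g) -order_dvdn oy -Zp3_nat_eq0.
  by rewrite natr_Zp => /eqP.
have [g fK gK] := bf.
pose op' a b := g (op (f a) (f b)).
have br' : left_brace op' by exact: (left_brace_transport fK gK fD brB).
have iso : brace_isog op op'.
  by exists g; [exists f | split=> a b; rewrite ?/op' ?gK //; apply: (can_inj fK); rewrite fD !gK].
pose h a := ast op' a 1.
have hE a b : ast op' a b = b * h a.
  by rewrite -{1}[b]natr_Zp (astMnr br') -mulr_natl natr_Zp.
pose D : {group R} := <[p%:R : R]>%G.
have oD : #|D| = (p ^ 2)%N.
  rewrite -orderE; have : (#[p%:R : R]%g %| p ^ 2)%N.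
    rewrite order_dvdn FinRing.zmodXgE -[_ == _]/(p%:R *+ (p ^ 2) == 0 :> R).
    by rewrite -mulr_natr -natrM -expnS Zp3_p3.
  case/(dvdn_pfactor _ _ p_pr) => m lem ox; rewrite ox; congr (_ ^ _)%N.
  apply/eqP; rewrite eqn_leq lem ltnNge; apply: contra Zp3_p2_neq0 => lem1.
  have -> : (p ^ 2)%N%:R = p%:R *+ p :> R by rewrite -[RHS]mulr_natr -natrM.
  rewrite -FinRing.zmodXgE -[_ == 0]/(_ == 1%g) -order_dvdn ox.
  by rewrite -[X in (_ %| X)%N]expn1 dvdn_exp2l.
have DP x : x \in D -> exists u, x = p%:R * u.
  by case/mem_cycleP => n ->; exists n%:R; rewrite mulr_natr.
have PD u : p%:R * u \in D.
  by apply/mem_cycleP; exists u; rewrite -[u in LHS]natr_Zp mulr_natr.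
have hD a d : d \in D -> ast op' a d \in D.
  by case/DP => u ->; rewrite hE -mulrA PD.
(* Outside D = pR the element s is a unit, so a * s in D gives h a in pR for every a. *)
have [s [sD _ hs _]] := flag_step br' p_pr card_Zp3 (ltnSn 2) oD hD.
have sU : s \is a GRing.unit.
  rewrite -[s]natr_Zp unitZpE ?p3_gt1 // coprimeXl // prime_coprime //.
  apply: contra sD => /dvdnP[k Ek]; rewrite -[s]natr_Zp Ek mulnC natrM; exact: PD.
have ph a : exists u, h a = p%:R * u.
  have /DP[u] := hs a; rewrite hE => E; exists (s^-1 * u).
  by rewrite mulrCA -E mulrA mulVr // mul1r.
have [t Et] := ph 1.
have hM a b : h (op' a b) = h a + h b + h b * h a by rewrite {1}/h (astM br') -!/(h _) [ast op' a (h b)]hE.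
have op'E a b : op' a b = a + b + b * h a by rewrite (opE op') hE.
have s3 := cyc_s3 t.
(* Products with left factor 1 already agree with [cyc_op], which is enough to identify the powers
   of 1 in both. *)
have hpow n : h (cyc_pow (p%:R * t) n) = p%:R * t * cyc_pow (p%:R * t) n.
  elim: n => [|n IH].
    by rewrite /cyc_pow !mulr0 !addr0 mulr0; apply: ast0l.
  have E : cyc_pow (p%:R * t) n.+1 = op' 1 (cyc_pow (p%:R * t) n).
    by rewrite op'E cyc_powS // Et; ring.
  by rewrite {1}E hM IH Et cyc_powS //; ring.
have [gT [F [G [FK GK FM]]]] := group_of_op (brace_mul_group (cyc_brace s3)).
have hall a : h a = p%:R * t * a.
  by have [n ->] := cyc_generated FM (Bijective FK GK) a.
have iso2 : brace_isog op' (cyc_op (p%:R * t)).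
  by apply: brace_isog_eq => a b; rewrite op'E hall /cyc_op; ring.
have [k k13 iso3] := cyc_normal t.
exists k => //; apply: brace_isog_trans iso _.
exact: brace_isog_trans iso2 iso3.
Qed.

End Cyclic.

(** * Square classes and representatives in F_p *)

Section SquareClasses.
Variables (p : nat) (p_pr : prime p) (p_neq2 : p != 2%N) (eps : 'F_p).
Hypothesis eps_ns : forall u : 'F_p, u * u <> eps.

Lemma eps_neq0 : eps != 0.
Proof. by apply/eqP => e0; apply: (eps_ns (u := 0)); rewrite mul0r e0. Qed.

(** In terms of a generator of the cyclic unit group, the non-square eps is an odd power, so u or
    eps u is an even one. *)
Lemma square_class (u : 'F_p) : u != 0 ->
  exists2 r, r != 0 & u = r ^+ 2 \/ u = eps * r ^+ 2.
Proof.
move=> u0; have /cyclicP[x ex] := field_unit_group_cyclic [set: {unit 'F_p}]%G.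
have gen (v : 'F_p) : v != 0 -> exists n, v = FinRing.uval x ^+ n.
  move=> v0; have vU : v \is a GRing.unit by rewrite unitfE.
  have : FinRing.unit 'F_p vU \in <[x]>%g by rewrite -ex inE.
  case/cycleP => n En; exists n; rewrite -FinRing.val_unitX -En //.
have x0 : FinRing.uval x != 0 by rewrite -unitfE; apply: valP.
set g := FinRing.uval x in gen x0.
have [n En] := gen u u0; have [m Em] := gen eps eps_neq0.
have om : odd m.
  apply: contraT => em; case: (@eps_ns (g ^+ m./2)).
  by rewrite -exprD addnn even_halfK.
have [on|en] := boolP (odd n); last first.
  exists (g ^+ n./2); first by rewrite expf_neq0.
  by left; rewrite -exprM muln2 even_halfK.
have nm : ~~ odd (n + m) by rewrite oddD on om.
(* A square root of u eps = g^(n + m), divided by eps. *)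
exists (g ^+ (n + m)./2 / eps).
  by rewrite mulf_neq0 ?invr_neq0 ?eps_neq0 ?expf_neq0.
right; rewrite exprMn -exprM muln2 even_halfK // exprD -En -Em.
by have := eps_neq0 => e0; field.
Qed.

Lemma square_neq (a : 'F_p) u : a != 0 -> a ^+ 2 * eps <> u ^+ 2.
Proof.
move=> a0 E; apply: (@eps_ns (u / a)).
by rewrite -expr2 expr_div_n -E; field.
Qed.

Lemma half_range (u : 'F_p) : exists2 l : nat, (l <= p.-1./2)%N & u = l%:R \/ u = - l%:R.
Proof.
have up : (u < p)%N by have := ltn_ord u; rewrite [X in (_ < X)%N]Fp_cast.
case: (leqP u p.-1./2) => up2; first by exists u => //; left; rewrite natr_Zp.
have od : odd p by case: (even_prime p_pr) => // p2; move: p_neq2; rewrite p2.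
exists (p - u)%N; first by lia.
by right; rewrite natrB ?(ltnW up) // pchar_Fp_0 // natr_Zp sub0r opprK.
Qed.

Lemma natFp_inj m n : (m < p)%N -> (n < p)%N -> m%:R = n%:R :> 'F_p -> m = n.
Proof.
by move=> mp np /(congr1 (@nat_of_ord _)); rewrite !Fp_val_nat // !modn_small.
Qed.

(** The alternative l = - l' makes p divide l + l', which is at most p - 1, so both are 0. *)
Lemma half_range_inj l l' : (l <= p.-1./2)%N -> (l' <= p.-1./2)%N ->
  l%:R ^+ 2 = l'%:R ^+ 2 :> 'F_p -> l = l'.
Proof.
move=> lp lp'; have p1 := prime_gt1 p_pr.
have hp : (p.-1./2 + p.-1./2 < p)%N by lia.
have lt k : (k <= p.-1./2)%N -> (k < p)%N.
  by move=> kp; apply: leq_ltn_trans kp (leq_ltn_trans (leq_addl _ _) hp).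
move/eqP; rewrite eqf_sqr => /orP[/eqP|]; first by apply: natFp_inj; apply: lt.
rewrite -addr_eq0 -natrD => /eqP/(congr1 (@nat_of_ord _)); rewrite Fp_val_nat //.
rewrite modn_small; last by apply: leq_ltn_trans hp; apply: leq_add.
by move/eqP; rewrite /= addn_eq0 => /andP[/eqP -> /eqP ->].
Qed.
End SquareClasses.

(** * Additive group Z/(p) x Z/(p^2) *)

(* The conditions under which [(x, y) |-> (a x + t y, d y + p c x)] maps the
   brace with parameters [P] to the one with parameters [P']. *)
Definition mix_equiv (F : fieldType) (P P' : pars F) (a t d c : F) : Prop :=
  [/\ a * pb P = pb P' * d ^+ 2,
      d * pa1 P = a ^+ 2 * pa1 P',
      d * pa2 P = a * (pa1 P' * t + d * pa2 P'),
      d * pg P = a * (pa1 P' * t + d * pg P') &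
      d * pe P + c * pb P = pa1 P' * t ^+ 2 + (pa2 P' + pg P') * t * d + pe P' * d ^+ 2].

Lemma qf_mix_equiv (F : fieldType) (P P' : pars F) a t d c :
  2%:R != 0 :> F -> d != 0 -> mix_equiv P P' a t d c ->
  forall y1 z1 y2 z2, d * qf P y1 z1 y2 z2 + c * pb P * (z1 * z2) =
    qf P' (a * y1 + t * z1) (d * z1) (a * y2 + t * z2) (d * z2).
Proof.
move=> nz2 d0 [E1 E2 E3 E4 E5] y1 z1 y2 z2; rewrite !qfE.
(* The coefficient of z1^2 z2 imposes nothing new: this follows from the equations for b, a2 and
   g. *)
have E6 : (pa2 P - pg P) * pb P = (pa2 P' - pg P') * pb P' * d ^+ 2.
  apply: (mulfI d0); rewrite mulrA mulrBr E3 E4.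
  transitivity (d * (pa2 P' - pg P') * (a * pb P)); first by ring.
  by rewrite E1; ring.
rewrite E6.
transitivity (d * pa1 P * y1 * y2 + d * pa2 P * z1 * y2 + d * pg P * y1 * z2
  + (d * pe P + c * pb P) * z1 * z2 + d ^+ 3 * (pa2 P' - pg P') * pb P' * z1 ^+ 2 * z2 / 2%:R).
  by field.
by rewrite E2 E3 E4 E5; field.
Qed.

Lemma pair_mulrn (V W : zmodType) (x : V) (y : W) n : (x, y) *+ n = (x *+ n, y *+ n).
Proof. by elim: n => // n IH; rewrite !mulrS IH. Qed.

Section Mix.
Variables (p : nat) (p_pr : prime p) (p_neq2 : p != 2%N).
Local Notation F := 'F_p.
Local Notation mixm := (model (mix_frame p_pr)).
Local Notation A := (F * 'Z_(p ^ 2))%type.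

Lemma lift_redp (d : F) : redp ((d : nat)%:R : 'Z_(p ^ 2)) = d.
Proof. by rewrite redp_nat // natr_Zp. Qed.

Lemma redp0 : redp (0 : 'Z_(p ^ 2)) = 0. Proof. exact: (redp_nat p_pr 0). Qed.
Lemma redp1 : redp (1 : 'Z_(p ^ 2)) = 1. Proof. exact: (redp_nat p_pr 1). Qed.

Lemma redpM (x y : 'Z_(p ^ 2)) : redp (x * y) = redp x * redp y.
Proof. by rewrite -[x]natr_Zp -[y]natr_Zp -natrM !redp_nat // natrM. Qed.

Lemma mul_ptimes (x : 'Z_(p ^ 2)) u : x * ptimes u = ptimes (redp x * u).
Proof.
rewrite -[x]natr_Zp redp_nat // -[u]natr_Zp -natrM !ptimes_nat // -natrM.
by congr _%:R; rewrite mulnCA.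
Qed.

Lemma mix_iso (P P' : pars F) a t d c : a != 0 -> d != 0 ->
  mix_equiv P P' a t d c -> brace_isog (mixm P) (mixm P').
Proof.
move=> a0 d0 E.
have nz2 := Fp_nz2 p_pr p_neq2.
pose dd : 'Z_(p ^ 2) := (d : nat)%:R.
pose f (x : A) : A := (a * x.1 + t * redp x.2, dd * x.2 + ptimes (c * x.1)).
have fD : {morph f : x y / x + y}.
  move=> x y; rewrite /f /= redpD // !mulrDr ptimesD //.
  by congr (_, _) => /=; zmod.
have bf : bijective f.
  apply: injF_bij; apply: morph_inj => // -[x y] E0.
  have /= E1 := congr1 fst E0; have /= E2 := congr1 snd E0.
  have ry : redp y = 0.
    have := congr1 (@redp p) E2; rewrite redpD // redpM redp_ptimes // addr0 lift_redp.
    rewrite redp0 => /eqP; rewrite mulf_eq0 (negPf d0) /= => /eqP //.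
  have x0 : x = 0.
    move/eqP: E1; rewrite ry mulr0 addr0 mulf_eq0 (negPf a0) /= => /eqP //.
  have [u Eu] := redp_eq0 p_pr ry.
  move: E2; rewrite x0 mulr0 (morph0 (ptimesD p_pr)) addr0 Eu mul_ptimes lift_redp.
  rewrite -(morph0 (ptimesD p_pr)) => /(ptimes_inj p_pr)/eqP.
  by rewrite mulf_eq0 (negPf d0) /= => /eqP ->; rewrite (morph0 (ptimesD p_pr)).
have [E1 _ _ _ _] := E.
apply: (@model_iso _ _ _ _ _ _ _ f d (c * pb P) a t 0 d) => //.
- move=> u /=; rewrite /f /= redp_ptimes // mul_ptimes lift_redp !mulr0 addr0.
  by rewrite (morph0 (ptimesD p_pr)) addr0.
- by move=> x /=; rewrite redpD // redpM lift_redp redp_ptimes // mul0r add0r addr0.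
- move=> u; rewrite /f /= redp0 !mulr0.
  by congr (_, _) => /=; rewrite ?addr0 ?add0r !mulrA.
- by move=> y1 z1 y2 z2; rewrite E1; ring.
- move=> y1 z1 y2 z2; rewrite (qf_mix_equiv nz2 d0 E) !mul0r !add0r //.
Qed.

(** Every additive bijection has the shape behind [mix_equiv]: (1, 0) has order p, so the second
    component of its image is a multiple of p, and the multiplier d of the second coordinate matters
    only modulo p. *)
Lemma mix_iso_inv (P P' : pars F) : brace_isog (mixm P) (mixm P') ->
  exists a t d c, [/\ a != 0, d != 0 & mix_equiv P P' a t d c].
Proof.
case=> f bf [fD fM]; have fI := bij_inj bf.
pose d := redp (f (0, 1)).2; pose t := (f (0, 1)).1; pose a := (f (1, 0)).1.
have fj1 u : f (0, ptimes u) = (0, ptimes (d * u)).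
  have -> : ((0, ptimes u) : A) = (0, 1) *+ (p * u)%N.
    by rewrite pair_mulrn mul0rn.
  rewrite (morphMn fD) [f _]surjective_pairing pair_mulrn -/t; congr (_, _) => /=.
    by rewrite mulrnA -(mulr_natl t) pchar_Fp_0 // mul0r mul0rn.
  by rewrite -mulr_natr -[_%:R]/(ptimes u) mul_ptimes.
have [c Ec] : exists c, f (1, 0) = (a, ptimes c).
  have : redp (f (1, 0)).2 = 0.
    apply: (ptimes_inj p_pr); rewrite ptimes_redp // (morph0 (ptimesD p_pr)).
    have E0 : ((1, 0) : A) *+ p = 0.
      by apply/eqP; rewrite pair_mulrn mul0rn pchar_Fp_0.
    by have := morphMn fD (1, 0) p; rewrite E0 (morph0 fD) [f (1, 0)]surjective_pairing pair_mulrn => /(congr1 snd) /= <-.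
  by case/(redp_eq0 p_pr) => c Ec; exists c; rewrite [LHS]surjective_pairing Ec.
have fj2 u : f (u, 0) = (a * u, ptimes (c * u)).
  have -> : ((u, 0) : A) = (1, 0) *+ u.
    by apply/eqP; rewrite pair_mulrn mul0rn natr_Zp.
  rewrite (morphMn fD) Ec pair_mulrn; congr (_, _) => /=.
    by rewrite -(mulr_natr a) natr_Zp.
  by rewrite -(morphMn (ptimesD p_pr)) -(mulr_natr c) natr_Zp.
have a0 : a != 0.
  apply/eqP => a0.
  (* With a = 0 the image of (1, 0) would lie in the image of the line of multiples of p. *)
  have E : f (1, 0) = f (0, ptimes (c / d)).
    rewrite Ec a0 fj1; congr (_, ptimes _).
    case: (eqVneq d 0) => [d0|d0]; last by field.
    have : f (0, ptimes 1) = f 0.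
      by rewrite fj1 d0 mul0r (morph0 fD) (morph0 (ptimesD p_pr)).
    move/fI/(congr1 snd) => /= E.
    have : ptimes (1 : F) = ptimes 0 by rewrite E (morph0 (ptimesD p_pr)).
    by move/(ptimes_inj p_pr)/eqP; rewrite oner_eq0.
  by have /(congr1 fst) /= /eqP := fI _ _ E; rewrite oner_eq0.
have d0 : d != 0.
  apply/eqP => d0.
  have : f (0, ptimes 1) = f 0.
    by rewrite fj1 d0 mul0r (morph0 fD) (morph0 (ptimesD p_pr)).
  move/fI/(congr1 snd) => /= E.
  have : ptimes (1 : F) = ptimes 0 by rewrite E (morph0 (ptimesD p_pr)).
  by move/(ptimes_inj p_pr)/eqP; rewrite oner_eq0.
have main (v w : A) :
  a * (pb P * redp v.2 * redp w.2) = pb P' * redp (f v).2 * redp (f w).2 /\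
  d * qf P v.1 (redp v.2) w.1 (redp w.2) + c * (pb P * redp v.2 * redp w.2)
    = qf P' (f v).1 (redp (f v).2) (f w).1 (redp (f w).2).
  have := fM v w; rewrite /model !fD -!addrA => /addrI/addrI.
  rewrite fj1 fj2 => E.
  have /= := congr1 fst E; have /= := congr1 snd E; rewrite !addr0 !add0r.
  by rewrite -(ptimesD p_pr) => /(ptimes_inj p_pr) -> ->.
have E1 : a * pb P = pb P' * d ^+ 2.
  by have [] := main (0, 1) (0, 1); rewrite /= redp1 !mulr1 -/d -mulrA -expr2.
have E2 : d * pa1 P = a ^+ 2 * pa1 P'.
  have [_] := main (1, 0) (1, 0).
  rewrite Ec !qfE /= !redp_ptimes // redp0 !(mulr0, addr0, mulr1, mul0r) => ->; ring.
have E3 : d * pa2 P = a * (pa1 P' * t + d * pa2 P').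
  have [_] := main (0, 1) (1, 0).
  rewrite Ec !qfE /= !redp_ptimes // redp0 redp1 -/d -/t !(mulr0, addr0, mulr1, mul0r, add0r) => ->; ring.
have E4 : d * pg P = a * (pa1 P' * t + d * pg P').
  have [_] := main (1, 0) (0, 1).
  rewrite Ec !qfE /= !redp_ptimes // redp0 redp1 -/d -/t !(mulr0, addr0, mulr1, mul0r, add0r, expr0n) /= ?(mulr0, mul0r, addr0) => ->; ring.
exists a, t, d, c; split => //; split => //.
have nz2 := Fp_nz2 p_pr p_neq2.
have E6 : (pa2 P - pg P) * pb P = (pa2 P' - pg P') * pb P' * d ^+ 2.
  apply: (mulfI d0); rewrite mulrA mulrBr E3 E4.
  transitivity (d * (pa2 P' - pg P') * (a * pb P)); first by ring.
  by rewrite E1; ring.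
have [_] := main (0, 1) (0, 1).
rewrite !qfE /= redp1 -/d -/t !(mulr0, add0r, mulr1, expr1n) E6 => E5.
transitivity (d * ((pa2 P' - pg P') * pb P' * d ^+ 2 / 2%:R + pe P) + c * pb P
  - d * ((pa2 P' - pg P') * pb P' * d ^+ 2 / 2%:R)); first by ring.
by rewrite E5; field.
Qed.

End Mix.

Section Counts.
Variables (p : nat) (p_pr : prime p) (p_neq2 : p != 2%N) (P : pars 'F_p).

Definition socle_lines : {set 'F_p * 'F_p} := [set yz : 'F_p * 'F_p |
  [&& pb P * yz.2 == 0, pa1 P * yz.1 + pa2 P * yz.2 == 0
    & pg P * yz.1 + pe P * yz.2 == 0]].

Lemma socle_linesP y z : reflect
  [/\ pb P * z = 0, pa1 P * y + pa2 P * z = 0 & pg P * y + pe P * z = 0]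
  ((y, z) \in socle_lines).
Proof.
rewrite in_set; apply: (iffP and3P) => -[E1 E2 E3]; split; try exact/eqP.
Qed.

Lemma socle_lines1 : (forall y z, (y, z) \in socle_lines -> y = 0 /\ z = 0) ->
  #|socle_lines| = 1%N.
Proof.
move=> H; rewrite (_ : socle_lines = [set (0, 0)]) ?cards1 //.
apply/setP => -[y z]; rewrite in_set1; apply/idP/eqP => [/H[-> ->] //|[-> ->]].
by apply/socle_linesP; rewrite !mulr0 addr0.
Qed.

Lemma socle_linesp l m : (l != 0) || (m != 0) ->
  (forall y z, (y, z) \in socle_lines <-> l * y + m * z = 0) ->
  #|socle_lines| = p.
Proof.
move=> lm H; rewrite -[RHS](card_line p_pr lm); apply: eq_card => -[y z].
apply/idP/idP; first by move/H => E; rewrite in_set E.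
by rewrite in_set => /eqP E; apply/H.
Qed.

Lemma socle_linesp2 : pb P = 0 -> pa1 P = 0 -> pa2 P = 0 -> pg P = 0 -> pe P = 0 ->
  #|socle_lines| = (p ^ 2)%N.
Proof.
move=> E1 E2 E3 E4 E5; rewrite (_ : socle_lines = setT).
  by rewrite cardsT card_prod card_Fp.
apply/setP => -[y z]; rewrite in_setT; apply/socle_linesP.
by rewrite E1 E2 E3 E4 E5 !mul0r addr0.
Qed.
End Counts.

Section FpFacts.
Variables (p : nat) (p_pr : prime p) (p_neq2 : p != 2%N).

Lemma bin3p : 'C(p, 3)%:R = (p == 3)%:R :> 'F_p.
Proof.
case: (eqVneq p 3) => [->|p3]; first by rewrite binn.
have /dvdnP[k ->] : (p %| 'C(p, 3))%N.
  apply: prime_dvd_bin => //=; have := prime_gt1 p_pr; lia.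
by rewrite natrM pchar_Fp_0 // mulr0.
Qed.

Lemma F3_cube (x : 'F_p) : p = 3%N -> x ^+ 3 = x.
Proof.
move=> p3; rewrite -[x]natr_Zp.
have : (x < 3)%N by have := ltn_ord x; rewrite [X in (_ < X)%N](etrans (Fp_cast p_pr) p3).
have E3 : 3%:R = 0 :> 'F_p by rewrite -(pchar_Fp_0 p_pr); congr _%:R.
case: (x : nat) => [|[|[|//]]] _; rewrite ?expr0n ?expr1n //.
transitivity (2%:R + 2%:R * 3%:R : 'F_p); first by ring.
by rewrite E3 mulr0 addr0.
Qed.

Lemma F3_neg1 (e : 'F_p) : p = 3%N -> (forall u : 'F_p, u * u <> e) -> e = -1.
Proof.
move=> p3 ns; have := F3_cube e p3 => E.
have : e * (e - 1) * (e + 1) = 0.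
  by transitivity (e ^+ 3 - e); [ring | rewrite E subrr].
move/eqP; rewrite !mulf_eq0 subr_eq0 addr_eq0 -orbA => /or3P[] /eqP // e0.
  by case: (ns 0); rewrite mul0r e0.
by case: (ns 1); rewrite mul1r e0.
Qed.

Lemma Fp_1N1 : (1 == -1 :> 'F_p) = false.
Proof. by rewrite -addr_eq0; apply/negbTE/Fp_nz2. Qed.

Lemma bin2pE n : bin2p p n = (n%:R ^+ 2 - n%:R) / 2%:R.
Proof.
have nz2 := Fp_nz2 p_pr p_neq2.
by rewrite /bin2p natr_sqr_bin2; field.
Qed.
End FpFacts.

Lemma mul_group_type_eq (B : Type) (op op' : B -> B -> B) K :
  (forall a b, op a b = op' a b) -> mul_group_type op' K -> mul_group_type op K.
Proof.
by move=> E [gT [f [bf fM KgT]]]; exists gT, f; split => // a b; rewrite E.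
Qed.

Lemma socle_eq (B : finZmodType) (op op' : B -> B -> B) :
  (forall a b, op a b = op' a b) -> socle op = socle op'.
Proof.
move=> E; apply/setP => a; rewrite !inE.
by apply: eq_forallb => b; rewrite /brace_lambda E.
Qed.

Definition mix_tab (F : fieldType) (p : nat) (eps : F) (i : brace_index p) :
    option (pars F) :=
  match i with
  | Mix_s1_a l => Some (Pars 0 eps l%:R 0 1)
  | Mix_s1_b l => Some (Pars 0 1 l%:R 0 1)
  | Mix_s1_c l => Some (Pars 0 0 l%:R 1 0)
  | Mix_s1_d => Some (Pars 0 0 (-1) 1 1)
  | Mix_s1_e a => Some (Pars 1 0 a%:R 1 (- (a%:R - 1) / 2%:R))
  | Mix_s1_f a => Some (Pars 1 0 a%:R eps (- (a%:R - eps) / 2%:R))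
  | Mix_s2_a => Some (Pars 0 0 0 1 0)
  | Mix_s2_b => Some (Pars 0 0 0 0 1)
  | Mix_s2_c => Some (Pars 0 0 1 0 0)
  | Mix_s2_d => Some (Pars 0 1 0 0 0)
  | Mix_s2_e => Some (Pars 0 1 1 0 0)
  | Mix_s2_f => Some (Pars 1 0 0 0 0)
  | Mix_s2_g => Some (Pars 1 0 1 0 (- 1 / 2%:R))
  | Mix_s2_h => Some (Pars 1 0 eps 0 (- eps / 2%:R))
  | Mix_s3 => Some (Pars 0 0 0 0 0)
  | _ => None
  end.

(** * The table for Z/(p) x Z/(p^2) *)

Section MixTable.
Variables (p : nat) (p_pr : prime p) (p_neq2 : p != 2%N).
Variables (eps : 'F_p) (eps_ns : forall u : 'F_p, u * u <> eps).
Local Notation F := 'F_p.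
Local Notation mixm := (model (mix_frame p_pr)).
Local Notation A := (F * 'Z_(p ^ 2))%type.

Lemma card_mix : #|(A : finType)| = (p ^ 3)%N.
Proof. by rewrite card_prod card_Fp // card_ord Zp_cast ?prime_sq_gt1 // -expnS. Qed.

Lemma mix_exp_p2 (x : A) : x *+ (p ^ 2) = 0.
Proof.
case: x => x y; rewrite pair_mulrn -(mulr_natl y) pchar_Zp ?prime_sq_gt1 // mul0r.
by rewrite mulrnA -(mulr_natl x) pchar_Fp_0 // mul0r mul0rn.
Qed.

(** The p-th power of an element is p (z + [p = 3] b a2 z^3), and z^3 = z for p = 3, so all p-th
    powers vanish exactly when p = 3 and b a2 = -1. *)
Definition mix_type (P : pars F) : nat -> finGroupType -> Prop :=
  let k := (p == 3) && (pb P * pa2 P == -1) in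
  if pa2 P == pg P then if k then is_Zp_cube else is_Zp_Zp2
  else if k then is_M else is_M3.

Lemma mix_mul_type (P : pars F) : pa1 P * pb P = 0 ->
  mul_group_type (mixm P) (mix_type P p).
Proof.
move=> ab0; rewrite /mix_type; set fr := mix_frame p_pr.
have powpE a : model_powp fr P a =
    fj1 fr (fZ fr a + (p == 3)%:R * (pb P * pa2 P * fZ fr a ^+ 3)).
  rewrite /model_powp bin3p // (fj1D fr); congr (_ + _).
  case: a => x y; rewrite pair_mulrn -(mulr_natl x) pchar_Fp_0 // mul0r.
  by rewrite -ptimes_redp.
have kill : (p == 3) && (pb P * pa2 P == -1) -> forall a, model_powp fr P a = 0.
  case/andP => p3 /eqP E a; rewrite powpE p3 E (F3_cube _ _ (eqP p3)) // mulN1r mul1r.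
  by rewrite subrr (fj10 fr).
have nkill : ~~ ((p == 3) && (pb P * pa2 P == -1)) -> model_powp fr P (0, 1) != 0.
  rewrite powpE -(fj10 fr) (inj_eq (@fj1I _ _ fr)) /= redp1 // expr1n mulr1.
  case: (p == 3) => //=.
  by rewrite ?mulr1n mul1r addrC addr_eq0.
case: (eqVneq (pa2 P) (pg P)) => E; case: ifPn => k.
- by apply: (model_Zp_cube p_pr p_neq2 ab0 card_mix mix_exp_p2 E); apply: kill.
- by apply: (model_Zp_Zp2 p_pr p_neq2 ab0 card_mix mix_exp_p2 E); apply: nkill.
- by apply: (model_M p_pr p_neq2 ab0 card_mix mix_exp_p2 E); apply: kill.
- by apply: (model_M3 p_pr p_neq2 ab0 card_mix mix_exp_p2 E); apply: nkill.
Qed.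

(* The binomial coefficient C(y, 2) is (y^2 - y)/2, so each line of the table
   with additive group Z/(p) x Z/(p^2) is a model. *)
Lemma mix_table_op (i : brace_index p) P : mix_tab eps i = Some P ->
  exists op s K, brace_table eps i = @BraceEntry A op s K /\
    (forall a b, op a b = mixm P a b).
Proof.
have nz2 := Fp_nz2 p_pr p_neq2.
have ptN u : - ptimes u = ptimes (- u) :> 'Z_(p ^ 2).
  by rewrite (morphN (ptimesD p_pr)).
have pt2 (y : 'Z_(p ^ 2)) u v : u = v -> y + ptimes u = y + ptimes v by move=> ->.
have pt0 (y : 'Z_(p ^ 2)) u : u = 0 -> y = y + ptimes u.
  by move=> ->; rewrite (morph0 (ptimesD p_pr)) addr0.
have C2 (y : 'Z_(p ^ 2)) : bin2p p y = (redp y ^+ 2 - redp y) / 2%:R.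
  exact: bin2pE.
have ptA (y : 'Z_(p ^ 2)) u v : y + ptimes u + ptimes v = y + ptimes (u + v).
  by rewrite (ptimesD p_pr) addrA.
have fin (x1 x2 : F) (y1 y2 : 'Z_(p ^ 2)) : x1 = x2 -> y1 = y2 -> (x1, y1) = (x2, y2).
  by move=> -> ->.
case: i => [|||l|l|l||l|l|||||||||||l|l|l||||] //= [<-].
all: eexists; eexists; eexists; split; [reflexivity|].
all: move=> [x1 y1] [x2 y2]; rewrite [RHS]surjective_pairing; apply: fin; simpl.
all: rewrite ?[RHS]addr0; try by rewrite addr0; ring.
all: rewrite ?ptN ?ptA ?C2 qfE /=.
all: first [apply: pt2 | apply: pt0].
all: by field.
Qed.

Lemma natFp_neq0 l : (0 < l < p)%N -> l%:R != 0 :> F.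
Proof.
case/andP=> l0 lp; apply/eqP => E; have := @natFp_inj _ p_pr l 0%N lp (prime_gt0 p_pr) E.
by move=> l00; rewrite l00 in l0.
Qed.

Lemma natFp_lt_half l : (l <= p.-1./2)%N -> (l < p)%N.
Proof. by have := prime_gt0 p_pr; lia. Qed.

Lemma mix_table_ab0 (i : brace_index p) P : mix_tab eps i = Some P -> pa1 P * pb P = 0.
Proof. by case: i => [|||l|l|l||l|l|||||||||||l|l|l||||] //= [<-] /=; rewrite ?mulr0 ?mul0r. Qed.

(** The socle is cut out by a linear system in (y, z), whose rank 2, 1 or 0 gives the order p, p^2
    or p^3. *)
Lemma mix_table_socle (i : brace_index p) P : allowed i -> mix_tab eps i = Some P ->
  (p * #|socle_lines P|)%N = entry_socle_order (brace_table eps i).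
Proof.
have e0 := eps_neq0 eps_ns.
have one (Q : pars F) : (forall y z, pb Q * z = 0 -> pa1 Q * y + pa2 Q * z = 0 ->
    pg Q * y + pe Q * z = 0 -> y = 0 /\ z = 0) -> (p * #|socle_lines Q|)%N = p.
  move=> H; rewrite socle_lines1 ?muln1 // => y z /socle_linesP[]; exact: H.
have line (Q : pars F) l m : (l != 0) || (m != 0) ->
    (forall y z, (y, z) \in socle_lines Q <-> l * y + m * z = 0) ->
    (p * #|socle_lines Q|)%N = (p ^ 2)%N.
  by move=> lm H; rewrite (socle_linesp p_pr lm H).
have smp := (mul0r, mulr0, mul1r, add0r, addr0).
have mI (k y : F) : k != 0 -> k * y = 0 -> y = 0.
  by move=> k0 /eqP; rewrite mulf_eq0 (negPf k0) /= => /eqP.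
have n1 : 1 != 0 :> F by apply: oner_neq0.
case: i => [|||l|l|l||l|l|||||||||||l|l|l||||] //= al [<-].
- apply: one => y z /= _ + E; move: E; rewrite !smp => ->; rewrite !smp => /(mI _ _ e0) -> //.
- by apply: one => y z /= _ + E; move: E; rewrite !smp => ->; rewrite !smp => ->.
- have l0 : l%:R != 0 :> F by apply: natFp_neq0; have := prime_gt0 p_pr; lia.
  by apply: one => y z /= _; rewrite !smp => /(mI _ _ l0) -> ->.
- apply: one => y z /= _; rewrite !smp mulN1r => /eqP; rewrite oppr_eq0 => /eqP ->.
  by rewrite addr0 => ->.
- apply: one => y z /=; rewrite mul1r => -> _; rewrite !smp => -> //.
- apply: one => y z /=; rewrite mul1r => -> _; rewrite !smp => /(mI _ _ e0) -> //.
- apply: (line _ 1 0); rewrite ?n1 // => y z; rewrite -(rwP (socle_linesP _ _ _)) /= !smp.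
  by split=> [[]|].
- apply: (line _ 0 1); rewrite ?n1 ?orbT // => y z; rewrite -(rwP (socle_linesP _ _ _)) /= !smp.
  by split=> [[]|].
- apply: (line _ 0 1); rewrite ?n1 ?orbT // => y z; rewrite -(rwP (socle_linesP _ _ _)) /= !smp.
  by split=> [[]|].
- apply: (line _ 1 0); rewrite ?n1 // => y z; rewrite -(rwP (socle_linesP _ _ _)) /= !smp.
  by split=> [[]|].
- apply: (line _ 1 1); rewrite ?n1 // => y z; rewrite -(rwP (socle_linesP _ _ _)) /= !smp.
  by split=> [[]|].
- apply: (line _ 0 1); rewrite ?n1 ?orbT // => y z; rewrite -(rwP (socle_linesP _ _ _)) /= !smp.
  by split=> [[]|].
- apply: (line _ 0 1); rewrite ?n1 ?orbT // => y z; rewrite -(rwP (socle_linesP _ _ _)) /= !smp.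
  by split=> [[]|->] //; rewrite !smp.
- apply: (line _ 0 1); rewrite ?n1 ?orbT // => y z; rewrite -(rwP (socle_linesP _ _ _)) /= !smp.
  by split=> [[]|->] //; rewrite !smp.
- by rewrite socle_linesp2 // -expnS.
Qed.

Lemma mix_table_type (i : brace_index p) P : allowed i -> mix_tab eps i = Some P ->
  entry_mul_type (brace_table eps i) = mix_type P p.
Proof.
have e0 := eps_neq0 eps_ns; have N0 := Fp_1N1 p_pr p_neq2.
have lz l : (l < p)%N -> (l%:R == 0 :> F) = (l == 0)%N.
  move=> lp; apply/eqP/eqP => [|-> //].
  exact: (@natFp_inj _ p_pr l 0%N lp (prime_gt0 p_pr)).
have l1 l : (l < p)%N -> (l%:R == 1 :> F) = (l == 1)%N.
  move=> lp; apply/eqP/eqP => [|-> //].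
  exact: (@natFp_inj _ p_pr l 1%N lp (prime_gt1 p_pr)).
have N00 : (0 == -1 :> F) = false by rewrite eq_sym oppr_eq0 oner_eq0.
case: i => [|||l|l|l||l|l|||||||||||l|l|l||||] //= al [<-];
  rewrite /mix_type /= ?mul0r ?mul1r ?mulr0 ?N00 ?N0 ?andbF ?eqxx //.
- by rewrite lz ?natFp_lt_half //; case: (l == 0)%N.
- by rewrite lz ?natFp_lt_half //; case: (l == 0)%N.
- by rewrite l1; [case: (l == 1)%N | have := prime_gt0 p_pr; lia].
- by rewrite eq_sym N0.
- case: (eqVneq p 3) => p3 /=; last by case: eqP.
  by case: (eqVneq l%:R (1 : F)) => [->|] //; rewrite N0.
- case: (eqVneq p 3) => p3 /=; last by case: eqP.
  (* For p = 3 the non-square is -1, so the group is commutative for the very a that makes its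
     exponent 3. *)
  have -> := F3_neg1 p_pr p3 eps_ns; case: (eqVneq l%:R (1 : F)) => [->|_]; first by rewrite N0.
  by case: eqP.
- rewrite (negPf e0); case: (eqVneq p 3) => p3 //=.
  by rewrite (F3_neg1 p_pr p3 eps_ns) eqxx.
Qed.

Lemma mix_table_correct (i : brace_index p) P : allowed i -> mix_tab eps i = Some P ->
  let E := brace_table eps i in
  [/\ left_brace (@entry_mul E), #|entry_carrier E| = (p ^ 3)%N,
      #|socle (@entry_mul E)| = entry_socle_order E
    & mul_group_type (@entry_mul E) (entry_mul_type E)].
Proof.
move=> al tab /=; have ab0 := mix_table_ab0 tab.
rewrite (mix_table_type al tab) -(mix_table_socle al tab).
have [op [s [K [-> /= E]]]] := mix_table_op tab.
split; rewrite ?card_mix //.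
- by apply: left_brace_eq (model_brace p_pr p_neq2 _ ab0) => a b.
- by rewrite (socle_eq E) (model_socle_card p_pr).
- by apply: mul_group_type_eq E (mix_mul_type ab0).
Qed.

End MixTable.

(** * Normal forms of the parameters for Z/(p) x Z/(p^2) *)

Section MixNormalForm.
Variables (F : fieldType) (p : nat) (eps : F).
Hypotheses (nz2 : 2%:R != 0 :> F) (e0 : eps != 0).
Hypothesis squares : forall u : F, u != 0 ->
  exists2 r, r != 0 & u = r ^+ 2 \/ u = eps * r ^+ 2.
Hypothesis half : forall u : F,
  exists2 l : nat, (l <= p.-1./2)%N & u = l%:R \/ u = - l%:R.
Hypothesis any_rep : forall u : F, exists2 l, (l <= p.-1)%N & u = l%:R.
Hypothesis nonzero_rep : forall u : F, u != 0 ->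
  exists2 l, (1 <= l <= p.-1)%N & u = l%:R.

(** When b != 0, normalizing it to 1 imposes a b = d^2, which ties the scale to squares, and c sets
    e to the tabulated value. When b = 0 and a1 != 0, t clears g and a determinant is left to
    normalize. When both vanish, t can clear e unless a2 + g = 0. *)
Lemma mix_normal_form (P : pars F) : pa1 P * pb P = 0 ->
  exists (i : brace_index p) P', [/\ allowed i, mix_tab eps i = Some P' &
    exists a t d c : F, [/\ a != 0, d != 0 & mix_equiv P P' a t d c]].
Proof.
have iso Q Q' (a t d c : F) : a != 0 -> d != 0 -> mix_equiv Q Q' a t d c ->
    exists a t d c : F, [/\ a != 0, d != 0 & mix_equiv Q Q' a t d c].
  by exists a, t, d, c.
case: P => b a1 a2 g e /= ab0.
case: (eqVneq b 0) => [b0|b0]; last first.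
  have {}ab0 : a1 = 0 by move/eqP: ab0; rewrite mulf_eq0 (negPf b0) orbF => /eqP.
  subst a1.
  case: (eqVneq g 0) => [->|g0].
    case: (eqVneq a2 0) => [->|a20].
      exists (Mix_s2_f p); eexists; split; [by []|reflexivity|].
      apply: (iso _ _ b^-1 0 1 (- e / b)); rewrite ?invr_neq0 ?oner_neq0 //.
      by split; rewrite /=; field.
    have [r r0 E] := squares (mulf_neq0 a20 b0).
    case: E => E.
      exists (Mix_s2_g p); eexists; split; [by []|reflexivity|].
      apply: (iso _ _ (r ^+ 2 / b) 0 r ((- 1 / 2%:R * r ^+ 2 - r * e) / b)) => //.
        by rewrite mulf_neq0 ?invr_neq0 ?expf_neq0.
      have -> : a2 = r ^+ 2 / b by rewrite -E; field.
      by split; rewrite /=; field; rewrite ?nz2 ?b0.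
    exists (Mix_s2_h p); eexists; split; [by []|reflexivity|].
    apply: (iso _ _ (r ^+ 2 / b) 0 r ((- eps / 2%:R * r ^+ 2 - r * e) / b)) => //.
      by rewrite mulf_neq0 ?invr_neq0 ?expf_neq0.
    have -> : a2 = eps * r ^+ 2 / b by rewrite -E; field.
    by split; rewrite /=; field; rewrite ?nz2 ?b0.
  (* The equations give g b = g' d^2, so the square class of g b decides between 1 and eps; c is
     read off the last equation of [mix_equiv]. *)
  have [r r0 E] := squares (mulf_neq0 g0 b0).
  pose a := r ^+ 2 / b.
  have a0 : a != 0 by rewrite mulf_neq0 ?invr_neq0 ?expf_neq0.
  have [l lp El] := any_rep (a2 / a).
  case: E => E.
    exists (Mix_s1_e p l); eexists; split; [by []|reflexivity|].
    apply: (iso _ _ a 0 r ((- (l%:R - 1) / 2%:R * r ^+ 2 - r * e) / b)) => //.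
    have Eg : g = a by rewrite /a -E; field.
    by split; rewrite /= -?El ?Eg /a; field; rewrite ?nz2 ?r0 ?b0.
  exists (Mix_s1_f p l); eexists; split; [by []|reflexivity|].
  apply: (iso _ _ a 0 r ((- (l%:R - eps) / 2%:R * r ^+ 2 - r * e) / b)) => //.
  have Eg : g = a * eps by rewrite /a [r ^+ 2 / b * eps]mulrAC [r ^+ 2 * _]mulrC -E; field.
  by split; rewrite /= -?El ?Eg /a; field; rewrite ?nz2 ?r0 ?b0.
subst b => {ab0}.
case: (eqVneq a1 0) => [->|a10]; last first.
  (* The determinant a1 e - a2 g divided by a1: the value of e once t has cleared g. *)
  pose e' := e - a2 * g / a1.
  case: (eqVneq e' 0) => E'.
    have Ee : e = a2 * g / a1 by apply/eqP; rewrite -subr_eq0 -/e' E'.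
    case: (eqVneq a2 g) => [a2g|a2g].
      exists (Mix_s2_d p); eexists; split; [by []|reflexivity|].
      apply: (iso _ _ 1 (g / a1) a1^-1 0); rewrite ?oner_neq0 ?invr_neq0 //.
      by rewrite Ee a2g; split; rewrite /=; field.
    have a20 : a2 - g != 0 by rewrite subr_eq0.
    exists (Mix_s2_e p); eexists; split; [by []|reflexivity|].
    apply: (iso _ _ (a2 - g) ((a2 - g) * g / a1) ((a2 - g) ^+ 2 / a1) 0) => //.
      by rewrite mulf_neq0 ?invr_neq0 ?expf_neq0.
    by rewrite Ee; split; rewrite /=; field.
  have [r r0 E] := squares (mulf_neq0 a10 E').
  have Ee : e = e' + a2 * g / a1 by rewrite /e' subrK.
  have [l lp El] := half ((a2 - g) / r).
  (* Only s^2 is prescribed, so its sign can bring the label into 0, ..., (p - 1)/2. *)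
  have [s [s0 Es E2]] : exists s, [/\ s != 0, s ^+ 2 = r ^+ 2 & a2 = g + s * l%:R].
    case: El => El.
      exists r; split => //; rewrite -El; field; exact: r0.
    by exists (- r); split; rewrite ?oppr_eq0 ?sqrrN // -(opprK l%:R) -El; field.
  clearbody e'.
  case: E => E.
    exists (Mix_s1_b p l); eexists; split; [by []|reflexivity|].
    have Ea : a1 = s ^+ 2 / e' by rewrite Es -E; field.
    apply: (iso _ _ s (s * g / a1) e' 0) => //.
    by rewrite Ee E2 Ea; split; rewrite /=; field; rewrite ?s0 ?E'.
  exists (Mix_s1_a p l); eexists; split; [by []|reflexivity|].
  have Ea : a1 = eps * s ^+ 2 / e' by rewrite Es -E; field.
  apply: (iso _ _ s (s * g / a1) e' 0) => //.
  by rewrite Ee E2 Ea; split; rewrite /=; field; rewrite ?s0 ?E' ?e0.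
case: (eqVneq g 0) => [->|g0].
  case: (eqVneq a2 0) => [->|a20].
    case: (eqVneq e 0) => [->|e00].
      exists (Mix_s3 p); eexists; split; [by []|reflexivity|].
      by apply: (iso _ _ 1 0 1 0); rewrite ?oner_neq0 //; split; rewrite /=; ring.
    exists (Mix_s2_b p); eexists; split; [by []|reflexivity|].
    by apply: (iso _ _ 1 0 e 0); rewrite ?oner_neq0 //; split; rewrite /=; ring.
  exists (Mix_s2_c p); eexists; split; [by []|reflexivity|].
  by apply: (iso _ _ a2 e 1 0); rewrite ?oner_neq0 //; split; rewrite /=; ring.
case: (eqVneq a2 0) => [->|a20].
  exists (Mix_s2_a p); eexists; split; [by []|reflexivity|].
  by apply: (iso _ _ g e 1 0); rewrite ?oner_neq0 //; split; rewrite /=; ring.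
have [l lp El] := nonzero_rep (mulf_neq0 a20 (invr_neq0 g0)).
(* The last equation now reads e = (a2' + g') t + e' d, so t clears e when a2 + g != 0. *)
case: (eqVneq (a2 + g) 0) => ag.
  have a2N : a2 = - g by apply/eqP; rewrite -addr_eq0 ag.
  case: (eqVneq e 0) => [->|e00].
    exists (Mix_s1_c p l); eexists; split; [by []|reflexivity|].
    apply: (iso _ _ g 0 1 0); rewrite ?oner_neq0 //; rewrite -El.
    by split; rewrite /=; field.
  exists (Mix_s1_d p); eexists; split; [by []|reflexivity|].
  by apply: (iso _ _ g 0 e 0) => //; rewrite a2N; split; rewrite /=; ring.
exists (Mix_s1_c p l); eexists; split; [by []|reflexivity|].
apply: (iso _ _ g (e * g / (a2 + g)) 1 0); rewrite ?oner_neq0 //; rewrite -El.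
by split; rewrite /=; field; rewrite ?g0 ?ag.
Qed.

End MixNormalForm.

(** * Classification over Z/(p) x Z/(p^2) *)

Section MixClassification.
Variables (p : nat) (p_pr : prime p) (p_neq2 : p != 2%N).
Variables (eps : 'F_p) (eps_ns : forall u : 'F_p, u * u <> eps).
Local Notation F := 'F_p.
Local Notation mixm := (model (mix_frame p_pr)).

Lemma nonzero_rep (u : F) : u != 0 -> exists2 l, (1 <= l <= p.-1)%N & u = l%:R.
Proof.
move=> u0; exists u; last by rewrite natr_Zp.
have up : (u < p)%N by have := ltn_ord u; rewrite [X in (_ < X)%N]Fp_cast.
have : (u != 0 :> nat)%N by apply: contra u0 => /eqP uu; rewrite -[u]natr_Zp uu.
by move: (u : nat) up => n; lia.
Qed.

Lemma any_rep (u : F) : exists2 l, (l <= p.-1)%N & u = l%:R.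
Proof.
exists u; last by rewrite natr_Zp.
have up : (u < p)%N by have := ltn_ord u; rewrite [X in (_ < X)%N]Fp_cast.
by move: (u : nat) up => n; lia.
Qed.

Lemma mix_exists (P : pars F) : pa1 P * pb P = 0 ->
  exists (i : brace_index p) P', [/\ allowed i, mix_tab eps i = Some P' & brace_isog (mixm P) (mixm P')].
Proof.
move/(mix_normal_form (Fp_nz2 p_pr p_neq2) (eps_neq0 eps_ns) (square_class eps_ns)
  (half_range p_pr p_neq2) any_rep nonzero_rep).
case=> i [P' [al tab [a [t [d [c [a0 d0 E]]]]]]]; exists i, P'; split => //.
by apply: (@mix_iso p p_pr p_neq2 _ _ a t d c).
Qed.

(** Numbers the families up to label and square class by the vanishing of coefficients. It is meant
    for parameters with g = 0 whenever a1 != 0, as in the table. *)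
Definition mix_code (P : pars F) : nat :=
  if pb P == 0 then
    if pa1 P == 0 then
      if pg P == 0 then
        if pa2 P == 0 then if pe P == 0 then 0 else 1
        else 2
      else if pa2 P == 0 then 3
      else if (pa2 P + pg P == 0) && (pe P != 0) then 4 else 5
    else if pe P == 0 then if pa2 P == 0 then 6 else 7
    else 8
  else if pg P != 0 then 9
  else if pa2 P == 0 then 10 else 11.

Definition mix_index_code (i : brace_index p) : nat :=
  match i with
  | Mix_s1_a _ | Mix_s1_b _ => 8
  | Mix_s1_c _ => 5
  | Mix_s1_d => 4
  | Mix_s1_e _ | Mix_s1_f _ => 9
  | Mix_s2_a => 3
  | Mix_s2_b => 1
  | Mix_s2_c => 2
  | Mix_s2_d => 6
  | Mix_s2_e => 7
  | Mix_s2_f => 10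
  | Mix_s2_g | Mix_s2_h => 11
  | _ => 0
  end.

Lemma mix_table_code (i : brace_index p) P : allowed i -> mix_tab eps i = Some P ->
  mix_code P = mix_index_code i.
Proof.
have e0 := negPf (eps_neq0 eps_ns); have n1 := negPf (oner_neq0 'F_p).
case: i => [|||l|l|l||l|l|||||||||||l|l|l||||] //= al [<-];
  rewrite /mix_code /= ?eqxx ?e0 ?n1 //=.
- rewrite (negPf (natFp_neq0 p_pr _)) ?andbF //.
  by move: al; have := prime_gt0 p_pr; lia.
- by rewrite oppr_eq0 n1 addNr eqxx.
Qed.

Lemma mix_equiv_code (P P' : pars F) a t d c : a != 0 -> d != 0 ->
  pa1 P * pb P = 0 -> pa1 P' * pb P' = 0 ->
  (pa1 P != 0 -> pg P = 0) -> (pa1 P' != 0 -> pg P' = 0) ->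
  mix_equiv P P' a t d c -> mix_code P = mix_code P'.
Proof.
move=> a0 d0 ab0 ab0' ag ag' [E1 E2 E3 E4 E5].
have mz (k x l y : F) : k != 0 -> l != 0 -> k * x = l * y -> (x == 0) = (y == 0).
  by move=> k0 l0 E; rewrite -(mulrI_eq0 _ (mulfI k0)) E (mulrI_eq0 _ (mulfI l0)).
have d20 : d ^+ 2 != 0 by rewrite expf_neq0.
have a20 : a ^+ 2 != 0 by rewrite expf_neq0.
have Zb : (pb P == 0) = (pb P' == 0).
  by apply: (mz a _ (d ^+ 2)) => //; rewrite E1 mulrC.
have Z1 : (pa1 P == 0) = (pa1 P' == 0) by apply: (mz d _ (a ^+ 2)).
(* If a1' != 0 then g vanishes on both sides and the equation for g leaves a1' t = 0; the equations
   for the first four parameters are then mere scalings. *)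
have at0 : pa1 P' * t = 0.
  case: (eqVneq (pa1 P') 0) => [->|a1']; first by rewrite mul0r.
  move: E4; rewrite (ag' a1') ag ?Z1 // !mulr0 addr0 => /eqP.
  by rewrite eq_sym mulf_eq0 (negPf a0) /= => /eqP.
have ad0 : a * d != 0 by rewrite mulf_neq0.
have Z2 : (pa2 P == 0) = (pa2 P' == 0).
  by apply: (mz d _ (a * d)) => //; rewrite E3 at0 add0r mulrA.
have Zg : (pg P == 0) = (pg P' == 0).
  by apply: (mz d _ (a * d)) => //; rewrite E4 at0 add0r mulrA.
rewrite /mix_code Zb Z1 Z2 Zg.
case: (eqVneq (pb P') 0) => // b0'; have b0 : pb P = 0 by apply/eqP; rewrite Zb b0' eqxx.
have E5' : d * pe P = (pa2 P' + pg P') * t * d + pe P' * d ^+ 2.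
  by move: E5; rewrite b0 mulr0 addr0 expr2 mulrA at0 mul0r add0r.
case: (eqVneq (pa1 P') 0) => a1'.
  case: (eqVneq (pg P') 0) => g0'.
    case: (eqVneq (pa2 P') 0) => a2' //.
    suff -> : (pe P == 0) = (pe P' == 0) by [].
    by apply: (mz d _ (d ^+ 2)) => //; rewrite E5' a2' g0' addr0 !mul0r add0r mulrC.
  case: (eqVneq (pa2 P') 0) => a2' //.
  have -> : (pa2 P + pg P == 0) = (pa2 P' + pg P' == 0).
    by apply: (mz d _ (a * d)) => //; rewrite mulrDr E3 E4 at0; ring.
  case: (eqVneq (pa2 P' + pg P') 0) => //= ag0.
  suff -> : (pe P == 0) = (pe P' == 0) by [].
  by apply: (mz d _ (d ^+ 2)) => //; rewrite E5' ag0 !mul0r add0r mulrC.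
have t0 : t = 0 by move/eqP: at0; rewrite mulf_eq0 (negPf a1') /= => /eqP.
suff -> : (pe P == 0) = (pe P' == 0) by [].
by apply: (mz d _ (d ^+ 2)) => //; rewrite E5' t0 mulr0 !mul0r add0r mulrC.
Qed.

Lemma mix_table_norm (i : brace_index p) P : mix_tab eps i = Some P ->
  pa1 P != 0 -> pg P = 0.
Proof.
by case: i => [|||l|l|l||l|l|||||||||||l|l|l||||] //= [<-] //=; rewrite eqxx.
Qed.

(** Equal codes leave only pairs of the same shape. There the scalars are pinned: d = 1 for the
    forms with a1 and e nonzero, and a = d^2 when b = 1. Hence 1 and eps are never identified, and a
    label keeps its value up to sign. *)
Lemma mix_unique (i i' : brace_index p) P P' : allowed i -> allowed i' ->
  mix_tab eps i = Some P -> mix_tab eps i' = Some P' ->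
  brace_isog (mixm P) (mixm P') -> i = i'.
Proof.
move=> al al' tab tab' /(mix_iso_inv p_neq2) [a [t [d [c [a0 d0 E]]]]].
have := mix_equiv_code a0 d0 (mix_table_ab0 tab) (mix_table_ab0 tab')
  (mix_table_norm tab) (mix_table_norm tab') E.
rewrite (mix_table_code al tab) (mix_table_code al' tab').
have e0 := eps_neq0 eps_ns; have p0 := prime_gt0 p_pr.
have lp l : (l <= p.-1)%N -> (l < p)%N by lia.
have scale (x y : F) : d * x = a * (0 * t + d * y) -> x = a * y.
  by move=> E'; apply: (mulfI d0); rewrite E'; ring.
have scale1 (k k' : F) : k' != 0 -> d * 0 = a * (k' * t + d * 0) -> t = 0.
  move=> k0 /eqP; rewrite !mulr0 addr0 eq_sym !mulf_eq0 (negPf a0) (negPf k0) /=.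
  by move/eqP.
have quad (k k' l l' : F) : k' != 0 -> mix_equiv (Pars 0 k l 0 1) (Pars 0 k' l' 0 1) a t d c ->
    k = a ^+ 2 * k' /\ l = a * l'.
  move=> k0 [/= _ E2 E3 E4 E5]; have t0 := scale1 k k' k0 E4; subst t.
  have d1 : d = 1.
    apply: (mulfI d0); transitivity (1 * d ^+ 2 : F); first by ring.
    transitivity (d * 1 + c * 0); last by ring.
    by rewrite E5; ring.
  by move: E2 E3; rewrite d1 !mul1r mulr0 add0r.
have cub (l l' g g' e e' : F) : mix_equiv (Pars 1 0 l g e) (Pars 1 0 l' g' e') a t d c ->
    [/\ a = d ^+ 2, l = a * l' & g = a * g'].
  by move=> [/= E1 _ E3 E4 _]; split; [move: E1; rewrite mulr1 mul1r | apply: scale | apply: scale].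
have a1 (k : F) : k != 0 -> k = a * k -> a = 1.
  by move=> k0 Ek; apply: (mulIf k0); rewrite mul1r -Ek.
have sqr1 (k l l' : F) : k != 0 -> k = a ^+ 2 * k -> l = a * l' -> l ^+ 2 = l' ^+ 2.
  move=> k0 Ek ->; rewrite exprMn (_ : a ^+ 2 = 1) ?mul1r //.
  by apply: (mulIf k0); rewrite mul1r -Ek.
case: i al tab E => [|||l|l|l||l|l|||||||||||l|l|l||||] //= al [<-];
case: i' al' tab' => [|||l'|l'|l'||l'|l'|||||||||||l'|l'|l'||||] //= al' [<-] //= E _.
- have [E1 E2] := quad _ _ _ _ e0 E; congr Mix_s1_a.
  by apply: (half_range_inj p_pr p_neq2) => //; apply: sqr1 E1 E2.
- have [E1 _] := quad _ _ _ _ (oner_neq0 _) E.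
  by case: (eps_ns (u := a)); rewrite E1 mulr1 expr2.
- have [E1 _] := quad _ _ _ _ e0 E.
  by case: (square_neq eps_ns (u := 1) a0); rewrite -E1 expr1n.
- have [E1 E2] := quad _ _ _ _ (oner_neq0 _) E; congr Mix_s1_b.
  by apply: (half_range_inj p_pr p_neq2) => //; apply: sqr1 (oner_neq0 _) E1 E2.
- have [/= _ _ E3 E4 _] := E; have aa := a1 1 (oner_neq0 _) (scale _ _ E4).
  congr Mix_s1_c; have := scale _ _ E3; rewrite aa mul1r.
  by apply: natFp_inj => //; apply: lp; lia.
- have [_ E2 E3] := cub _ _ _ _ _ _ E; congr Mix_s1_e.
  move: E2; rewrite (a1 1 (oner_neq0 _) E3) mul1r.
  by apply: natFp_inj => //; apply: lp.
- have [E1 _ E3] := cub _ _ _ _ _ _ E.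
  by case: (square_neq eps_ns (u := 1) d0); rewrite -E1 -E3 expr1n.
- have [E1 _ E3] := cub _ _ _ _ _ _ E.
  by case: (eps_ns (u := d)); rewrite E3 mulr1 E1 expr2.
- have [_ E2 E3] := cub _ _ _ _ _ _ E; congr Mix_s1_f.
  move: E2; rewrite (a1 eps e0 E3) mul1r.
  by apply: natFp_inj => //; apply: lp.
- have [E1 E2 _] := cub _ _ _ _ _ _ E.
  by case: (square_neq eps_ns (u := 1) d0); rewrite -E1 -E2 expr1n.
- have [E1 E2 _] := cub _ _ _ _ _ _ E.
  by case: (eps_ns (u := d)); rewrite E2 mulr1 E1 expr2.
Qed.

End MixClassification.

(** * Additive group (Z/(p))^3 *)

Section ElemTable.
Variables (p : nat) (p_pr : prime p) (p_neq2 : p != 2%N).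
Variables (eps : 'F_p) (eps_ns : forall u : 'F_p, u * u <> eps).
Local Notation F := 'F_p.
Local Notation elemm := (model (elem_frame p)).
Local Notation A := (F * F * F)%type.

Lemma card_elem : #|(A : finType)| = (p ^ 3)%N.
Proof. by rewrite !card_prod !card_Fp // -mulnA. Qed.

Lemma Fp_mulrn_p (x : F) : x *+ p = 0.
Proof. by rewrite -mulr_natl pchar_Fp_0 // mul0r. Qed.

Lemma elem_mulrn_p (x : A) : x *+ p = 0.
Proof. by case: x => [[x y] z]; rewrite !pair_mulrn !Fp_mulrn_p. Qed.

Lemma elem_exp_p2 (x : A) : x *+ (p ^ 2) = 0.
Proof. by rewrite mulrnA elem_mulrn_p. Qed.

(** Here p v = 0, so the p-th power reduces to the term C(p, 3) b a2 z^3, which is nonzero for some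
    z exactly when p = 3 and b a2 != 0. *)
Definition elem_type (P : pars F) : nat -> finGroupType -> Prop :=
  let k := (p == 3) && (pb P * pa2 P != 0) in
  if pa2 P == pg P then if k then is_Zp_Zp2 else is_Zp_cube
  else if k then is_M3 else is_M.

Lemma elem_mul_type (P : pars F) : pa1 P * pb P = 0 ->
  mul_group_type (elemm P) (elem_type P p).
Proof.
move=> ab0; rewrite /elem_type; set fr := elem_frame p.
have powpE a : model_powp fr P a =
    fj1 fr ((p == 3)%:R * (pb P * pa2 P * fZ fr a ^+ 3)).
  by rewrite /model_powp bin3p // elem_mulrn_p add0r.
have nkill : (p == 3) && (pb P * pa2 P != 0) -> model_powp fr P (0, 0, 1) != 0.
  case/andP => p3 E; rewrite powpE -(fj10 fr) (inj_eq (@fj1I _ _ fr)) /= expr1n.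
  by rewrite p3 mulr1 mul1r.
have kill : ~~ ((p == 3) && (pb P * pa2 P != 0)) -> forall a, model_powp fr P a = 0.
  move=> + a; rewrite powpE; case: (p == 3) => /=; last by rewrite mul0r ?(fj10 fr).
  by rewrite negbK => /eqP ->; rewrite mul0r mulr0 ?(fj10 fr).
case: (eqVneq (pa2 P) (pg P)) => E; case: ifPn => k.
- by apply: (model_Zp_Zp2 p_pr p_neq2 ab0 card_elem elem_exp_p2 E); apply: nkill.
- by apply: (model_Zp_cube p_pr p_neq2 ab0 card_elem elem_exp_p2 E); apply: kill.
- by apply: (model_M3 p_pr p_neq2 ab0 card_elem elem_exp_p2 E); apply: nkill.
- by apply: (model_M p_pr p_neq2 ab0 card_elem elem_exp_p2 E); apply: kill.
Qed.

Definition elem_tab (i : brace_index p) : option (pars F) :=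
  match i with
  | Elem_s1_a => Some (Pars 0 0 (-1) 1 0)
  | Elem_s1_b l => Some (Pars 0 1 l%:R 0 1)
  | Elem_s1_c l => Some (Pars 0 eps l%:R 0 1)
  | Elem_s1_d c => Some (Pars 1 0 c 1 (- (c - 1) / 2%:R))
  | Elem_s2_a => Some (Pars 0 1 0 0 0)
  | Elem_s2_b => Some (Pars 0 0 1 0 0)
  | Elem_s2_c => Some (Pars 1 0 1 0 (- 1 / 2%:R))
  | Elem_s3 => Some (Pars 0 0 0 0 0)
  | _ => None
  end.

Lemma elem_table_op (i : brace_index p) P : elem_tab i = Some P ->
  exists op s K, brace_table eps i = @BraceEntry A op s K /\
    (forall a b, op a b = elemm P a b).
Proof.
have nz2 := Fp_nz2 p_pr p_neq2.
have C2 (z : F) : bin2p p z = (z ^+ 2 - z) / 2%:R by rewrite bin2pE // natr_Zp.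
have fin (x1 x2 y1 y2 z1 z2 : F) : x1 = x2 -> y1 = y2 -> z1 = z2 ->
    (x1, y1, z1) = (x2, y2, z2) by move=> -> -> ->.
case: i => [|||l|l|l||l|l|||||||||||l|l|l||||] //= [<-].
all: eexists; eexists; eexists; split; [reflexivity|].
all: move=> [[x1 y1] z1] [[x2 y2] z2]; rewrite [RHS]surjective_pairing [X in _ = (X, _)]surjective_pairing; apply: fin; simpl.
all: rewrite ?C2 ?qfE /=; by field.
Qed.

Lemma elem_table_ab0 (i : brace_index p) P : elem_tab i = Some P -> pa1 P * pb P = 0.
Proof. by case: i => [|||l|l|l||l|l|||||||||||l|l|l||||] //= [<-] /=; rewrite ?mulr0 ?mul0r. Qed.

Lemma elem_table_socle (i : brace_index p) P : elem_tab i = Some P ->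
  (p * #|socle_lines P|)%N = entry_socle_order (brace_table eps i).
Proof.
have e0 := eps_neq0 eps_ns.
have one (Q : pars F) : (forall y z, pb Q * z = 0 -> pa1 Q * y + pa2 Q * z = 0 ->
    pg Q * y + pe Q * z = 0 -> y = 0 /\ z = 0) -> (p * #|socle_lines Q|)%N = p.
  move=> H; rewrite socle_lines1 ?muln1 // => y z /socle_linesP[]; exact: H.
have line (Q : pars F) l m : (l != 0) || (m != 0) ->
    (forall y z, (y, z) \in socle_lines Q <-> l * y + m * z = 0) ->
    (p * #|socle_lines Q|)%N = (p ^ 2)%N.
  by move=> lm H; rewrite (socle_linesp p_pr lm H).
have smp := (mul0r, mulr0, mul1r, add0r, addr0).
have mI (k y : F) : k != 0 -> k * y = 0 -> y = 0.
  by move=> k0 /eqP; rewrite mulf_eq0 (negPf k0) /= => /eqP.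
have n1 : 1 != 0 :> F by apply: oner_neq0.
case: i => [|||l|l|l||l|l|||||||||||l|l|l||||] //= [<-].
- apply: one => y z /= _; rewrite !smp mulN1r => /eqP; rewrite oppr_eq0 => /eqP -> ->.
  by [].
- by apply: one => y z /= _ + E; move: E; rewrite !smp => ->; rewrite !smp => ->.
- apply: one => y z /= _ + E; move: E; rewrite !smp => ->; rewrite !smp => /(mI _ _ e0) -> //.
- apply: one => y z /=; rewrite mul1r => -> _; rewrite !smp => -> //.
- apply: (line _ 1 0); rewrite ?n1 // => y z; rewrite -(rwP (socle_linesP _ _ _)) /= !smp.
  by split=> [[]|].
- apply: (line _ 0 1); rewrite ?n1 ?orbT // => y z; rewrite -(rwP (socle_linesP _ _ _)) /= !smp.
  by split=> [[]|].
- apply: (line _ 0 1); rewrite ?n1 ?orbT // => y z; rewrite -(rwP (socle_linesP _ _ _)) /= !smp.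
  by split=> [[]|->] //; rewrite !smp.
- by rewrite socle_linesp2 // -expnS.
Qed.

Lemma elem_table_type (i : brace_index p) P : allowed i -> elem_tab i = Some P ->
  entry_mul_type (brace_table eps i) = elem_type P p.
Proof.
have N0 := Fp_1N1 p_pr p_neq2.
have lz l : (l < p)%N -> (l%:R == 0 :> F) = (l == 0)%N.
  move=> lp; apply/eqP/eqP => [|-> //].
  exact: (@natFp_inj _ p_pr l 0%N lp (prime_gt0 p_pr)).
case: i => [|||l|l|l||l|l|||||||||||l|l|l||||] //= al [<-];
  rewrite /elem_type /= ?mul0r ?mul1r ?mulr0 ?eqxx ?oner_eq0 ?andbF ?andbT //.
- by rewrite eq_sym N0.
- by rewrite lz ?natFp_lt_half //; case: (l == 0)%N.
- by rewrite lz ?natFp_lt_half //; case: (l == 0)%N.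
- case: (eqVneq p 3) => p3 /=; last by case: eqP.
  case: (eqVneq l 0) => [->|_] /=; by [|case: eqP].
Qed.

Lemma elem_table_correct (i : brace_index p) P : allowed i -> elem_tab i = Some P ->
  let E := brace_table eps i in
  [/\ left_brace (@entry_mul E), #|entry_carrier E| = (p ^ 3)%N,
      #|socle (@entry_mul E)| = entry_socle_order E
    & mul_group_type (@entry_mul E) (entry_mul_type E)].
Proof.
move=> al tab /=; have ab0 := elem_table_ab0 tab.
rewrite (elem_table_type al tab) -(elem_table_socle tab).
have [op [s [K [-> /= E]]]] := elem_table_op tab.
split; rewrite ?card_elem //.
- by apply: left_brace_eq (model_brace p_pr p_neq2 _ ab0) => a b.
- by rewrite (socle_eq E) (model_socle_card p_pr).
- by apply: mul_group_type_eq E (elem_mul_type ab0).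
Qed.

End ElemTable.

(** * Field identities behind changes of coordinates *)

Section FieldIdentities.
Variable F : fieldType.
Local Notation A := (F * F * F)%type.

(** The substitution y |-> y / b normalizes b to 1, s rescales the line, and the shift by (e' - s e)
    / b moves e to any prescribed e'. *)
Lemma qf_rescale (b a2 g e e' s y1 z1 y2 z2 : F) : 2%:R != 0 :> F -> b != 0 ->
  s * qf (Pars b 0 a2 g e) y1 z1 y2 z2 + (e' - s * e) / b * b * (z1 * z2) =
  qf (Pars 1 0 (s * b * a2) (s * b * g) e') (b^-1 * y1 + 0 * z1) (0 * y1 + 1 * z1)
    (b^-1 * y2 + 0 * z2) (0 * y2 + 1 * z2).
Proof. by move=> nz2 b0; rewrite !qfE /=; field; rewrite ?nz2. Qed.

Lemma half_coordinate (a g e r l : F) : e != 0 -> r != 0 ->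
  (a - g) / e / r = l -> a = g + e * r * l.
Proof. by move=> e0 r0 <-; field; rewrite ?r0. Qed.

(** When b != 0 and a1 = a2 = g = 0, every u * v is the multiple z1 z2 of the single vector (e, b,
    0). This map takes that vector to (1, 0, 0) and moves z to the middle coordinate, which gives
    the form y1 y2. *)
Definition elem_swap (b e : F) (a : A) : A :=
  (a.1.2 / b, a.2, a.1.1 - e / b * a.1.2).

Lemma elem_swap_bij b e : b != 0 -> bijective (elem_swap b e).
Proof.
move=> b0; exists (fun a => (a.2 + e * a.1.1, b * a.1.1, a.1.2)) => -[[x y] z];
  by rewrite /elem_swap /=; congr (_, _, _); field.
Qed.

Lemma elem_swapD b e : {morph elem_swap b e : u v / u + v}.
Proof.
by case=> [[x y] z] [[x' y'] z']; rewrite /elem_swap /=; congr (_, _, _) => /=; ring.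
Qed.

Lemma elem_swap_op b e (u v : A) : b != 0 ->
  elem_swap b e (u + v + (qf (Pars b 0 0 0 e) u.1.2 u.2 v.1.2 v.2, 0, 0)
    + (0, b * u.2 * v.2, 0)) =
  elem_swap b e u + elem_swap b e v +
    (qf (Pars 0 1 0 0 0) u.2 (u.1.1 - e / b * u.1.2) v.2 (v.1.1 - e / b * v.1.2), 0, 0)
    + (0, 0 * (u.1.1 - e / b * u.1.2) * (v.1.1 - e / b * v.1.2), 0).
Proof.
case: u v => [[x y] z] [[x' y'] z'] b0; rewrite !qfE /elem_swap /= !subrr !(mul0r, addr0, add0r).
by congr (_, _, _) => /=; field.
Qed.

End FieldIdentities.

(** * Normal forms and invariants over (Z/(p))^3 *)

Section ElemClassification.
Variables (p : nat) (p_pr : prime p) (p_neq2 : p != 2%N).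
Variables (eps : 'F_p) (eps_ns : forall u : 'F_p, u * u <> eps).
Local Notation F := 'F_p.
Local Notation elemm := (model (elem_frame p)).
Local Notation A := (F * F * F)%type.

Definition elem_map (s r m11 m12 m21 m22 : F) (a : A) : A :=
  (s * a.1.1 + r * a.1.2, m11 * a.1.2 + m12 * a.2, m21 * a.1.2 + m22 * a.2).

Lemma elem_mapD s r m11 m12 m21 m22 :
  {morph elem_map s r m11 m12 m21 m22 : a b / a + b}.
Proof.
by move=> a b; rewrite /elem_map /= !mulrDr; congr (_, _, _) => /=; zmod.
Qed.

Lemma elem_map_bij s r m11 m12 m21 m22 : s != 0 -> m11 * m22 - m12 * m21 != 0 ->
  bijective (elem_map s r m11 m12 m21 m22).
Proof.
move=> s0 det; apply: injF_bij; apply: morph_inj; first exact: elem_mapD.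
move=> [[x y] z] E0.
have /= E1 := congr1 (fun a : A => a.1.1) E0.
have /= E2 := congr1 (fun a : A => a.1.2) E0.
have /= E3 := congr1 (fun a : A => a.2) E0.
have y0 : y = 0.
  apply: (mulfI det); rewrite mulr0.
  transitivity (m22 * (m11 * y + m12 * z) - m12 * (m21 * y + m22 * z)); first by ring.
  by rewrite E2 E3; ring.
have z0 : z = 0.
  apply: (mulfI det); rewrite mulr0.
  transitivity (m11 * (m21 * y + m22 * z) - m21 * (m11 * y + m12 * z)); first by ring.
  by rewrite E2 E3; ring.
move: E1; rewrite y0 z0 mulr0 addr0 => /eqP; rewrite mulf_eq0 (negPf s0) /= => /eqP -> //.
Qed.

(** The function [qf] at b = 0, where the quadratic term is absent. *)
Definition bil (a1 a2 g e y1 z1 y2 z2 : F) : F :=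
  (a1 * y1 + a2 * z1) * y2 + (g * y1 + e * z1) * z2.

Lemma elem_iso0 a1 a2 g e a1' a2' g' e' s m11 m12 m21 m22 :
  s != 0 -> m11 * m22 - m12 * m21 != 0 ->
  (forall y1 z1 y2 z2, s * bil a1 a2 g e y1 z1 y2 z2 =
    bil a1' a2' g' e' (m11 * y1 + m12 * z1) (m21 * y1 + m22 * z1)
      (m11 * y2 + m12 * z2) (m21 * y2 + m22 * z2)) ->
  brace_isog (elemm (Pars 0 a1 a2 g e)) (elemm (Pars 0 a1' a2' g' e')).
Proof.
move=> s0 det E.
apply: (@model_iso _ _ _ _ _ _ _ (elem_map s 0 m11 m12 m21 m22) s 0 m11 m12 m21 m22) => //.
- exact: elem_map_bij.
- exact: elem_mapD.
- by move=> u; rewrite /elem_map /= !mulr0 !addr0.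
- by move=> t; rewrite /elem_map /= !(mul0r, mulr0, addr0).
- by move=> * /=; ring.
move=> y1 z1 y2 z2; have := E y1 z1 y2 z2; rewrite !qfE /bil /= => E'.
transitivity (s * ((a1 * y1 + a2 * z1) * y2 + (g * y1 + e * z1) * z2)); first by ring.
by rewrite E'; ring.
Qed.

(** Adding a multiple of y to x changes e freely, so what remains is the pair b a2, b g up to a
    common scalar. *)
Lemma elem_iso1 b a2 g e a2' g' e' s : b != 0 -> s != 0 ->
  s * b * a2 = a2' -> s * b * g = g' ->
  brace_isog (elemm (Pars b 0 a2 g e)) (elemm (Pars 1 0 a2' g' e')).
Proof.
move=> b0 s0 Ea Eg; have nz2 := Fp_nz2 p_pr p_neq2.
pose r := (e' - s * e) / b.
apply: (@model_iso _ _ _ _ _ _ _ (elem_map s r b^-1 0 0 1) s (r * b) b^-1 0 0 1) => //.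
- by apply: elem_map_bij; rewrite // mulr1 mul0r subr0 invr_neq0.
- exact: elem_mapD.
- by move=> u; rewrite /elem_map /= !mulr0 !addr0.
- move=> t; rewrite /elem_map /=; congr (_, _, _) => /=; ring.
- by move=> *; rewrite /=; field.
by move=> y1 z1 y2 z2; rewrite -Ea -Eg; apply: qf_rescale.
Qed.

Lemma elem_exists_e a1 a2 g e : e != 0 ->
  exists i P', [/\ allowed i, elem_tab eps i = Some P' &
    brace_isog (elemm (Pars 0 a1 a2 g e)) (elemm P')].
Proof.
move=> e0.
(* The coordinate k y + z completes the square, and de is the determinant a1 e - a2 g divided by
   e^2. *)
pose k := g / e; pose de := a1 / e - g * a2 / e ^+ 2.
case: (eqVneq de 0) => de0.
  have Ea1 : a1 = g * a2 / e.
    by apply: (mulIf (invr_neq0 e0)); apply/eqP; rewrite -subr_eq0 -de0 /de; apply/eqP; field.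
  case: (eqVneq a2 g) => [a2g|a2g].
    exists (Elem_s2_a p); eexists; split; [by []|reflexivity|].
    apply: (@elem_iso0 _ _ _ _ _ _ _ _ e^-1 k 1 1 0); rewrite ?invr_neq0 //.
      by rewrite mulr0 mulr1 sub0r oppr_eq0 oner_neq0.
    by move=> *; rewrite /bil Ea1 a2g /k; field.
  have d0 : a2 - g != 0 by rewrite subr_eq0.
  exists (Elem_s2_b p); eexists; split; [by []|reflexivity|].
  apply: (@elem_iso0 _ _ _ _ _ _ _ _ e^-1 (a2 / e) 1 k 1); rewrite ?invr_neq0 //.
    by rewrite mulr1 mul1r /k -mulrBl mulf_neq0 ?invr_neq0.
  by move=> *; rewrite /bil Ea1 /k; field.
have Ea1 : a1 = e * (de + g * a2 / e ^+ 2) by rewrite /de; field.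
have [r r0 E] := square_class eps_ns de0.
have [l lp El] := half_range p_pr p_neq2 ((a2 - g) / e / r).
have [m [m0 Em E2]] : exists m, [/\ m != 0, m ^+ 2 = r ^+ 2 & a2 = g + e * m * l%:R].
  case: El => /(half_coordinate e0 _) El.
    by exists r; split; [exact: r0 | reflexivity | exact: El].
  exists (- r); split; [by rewrite oppr_eq0 | by rewrite sqrrN |].
  by rewrite mulrN mulNr -mulrN; exact: El.
clearbody de.
have det : m * 1 - 0 * k != 0 by rewrite mulr1 mul0r subr0.
case: E => E.
  exists (Elem_s1_b p l); eexists; split; [by []|reflexivity|].
  apply: (@elem_iso0 _ _ _ _ _ _ _ _ e^-1 m 0 k 1); rewrite ?invr_neq0 //.
  by move=> *; rewrite /bil Ea1 E -Em E2 /k; field.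
exists (Elem_s1_c p l); eexists; split; [by []|reflexivity|].
apply: (@elem_iso0 _ _ _ _ _ _ _ _ e^-1 m 0 k 1); rewrite ?invr_neq0 //.
by move=> *; rewrite /bil Ea1 E -Em E2 /k; field.
Qed.

Lemma elem_exists (P : pars F) : pa1 P * pb P = 0 ->
  exists i P', [/\ allowed i, elem_tab eps i = Some P' & brace_isog (elemm P) (elemm P')].
Proof.
case: P => b a1 a2 g e /= ab0.
case: (eqVneq b 0) => [b0|b0]; last first.
  have {}ab0 : a1 = 0 by move/eqP: ab0; rewrite mulf_eq0 (negPf b0) orbF => /eqP.
  subst a1.
  case: (eqVneq g 0) => [->|g0].
    case: (eqVneq a2 0) => [->|a20].
      exists (Elem_s2_a p); eexists; split; [by []|reflexivity|].
      exists (elem_swap b e); first exact: elem_swap_bij.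
      split; first exact: elem_swapD.
      by move=> u v; rewrite /model /=; apply: elem_swap_op.
    exists (Elem_s2_c p); eexists; split; [by []|reflexivity|].
    apply: (@elem_iso1 _ _ _ _ _ _ _ (b * a2)^-1) => //.
    - by rewrite invr_neq0 ?mulf_neq0.
    - by field; rewrite ?b0 ?a20.
    - by rewrite mulr0.
  exists (Elem_s1_d (a2 / g)); eexists; split; [by []|reflexivity|].
  apply: (@elem_iso1 _ _ _ _ _ _ _ (b * g)^-1) => //.
  - by rewrite invr_neq0 ?mulf_neq0.
  - by field; rewrite ?b0 ?g0.
  - by field; rewrite ?b0 ?g0.
subst b => {ab0}.
have step a1' a2' g' e' : e' != 0 ->
    brace_isog (elemm (Pars 0 a1 a2 g e)) (elemm (Pars 0 a1' a2' g' e')) ->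
    exists i P', [/\ allowed i, elem_tab eps i = Some P' &
      brace_isog (elemm (Pars 0 a1 a2 g e)) (elemm P')].
  move=> e0 iso; have [i [P' [al tab iso']]] := elem_exists_e a1' a2' g' e0.
  by exists i, P'; split; [exact: al | exact: tab | exact: brace_isog_trans iso iso'].
case: (eqVneq e 0) => [e0|e0]; last exact: elem_exists_e.
(* A form that is not alternating can be brought to e != 0: by exchanging y and z if a1 != 0, by a
   shear if a2 + g != 0. *)
case: (eqVneq a1 0) => [a10|a10]; last first.
  apply: (step e g a2 a1 a10).
  apply: (@elem_iso0 _ _ _ _ _ _ _ _ 1 0 1 1 0); rewrite ?oner_neq0 //.
    by rewrite mulr0 mulr1 sub0r oppr_eq0 oner_neq0.
  by move=> *; rewrite /bil; ring.
case: (eqVneq (a2 + g) 0) => [ag|ag]; last first.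
  apply: (step 0 a2 g (a2 + g) ag).
  apply: (@elem_iso0 _ _ _ _ _ _ _ _ 1 1 (- 1) 0 1); rewrite ?oner_neq0 //.
    by rewrite mulr0 mulr1 subr0 oner_neq0.
  by move=> *; rewrite /bil e0 a10; ring.
have a2N : a2 = - g by apply/eqP; rewrite -addr_eq0 ag.
case: (eqVneq g 0) => g0.
  exists (Elem_s3 p); eexists; split; [by []|reflexivity|].
  by apply: brace_isog_eq; rewrite e0 a10 a2N g0 oppr0.
exists (Elem_s1_a p); eexists; split; [by []|reflexivity|].
apply: (@elem_iso0 _ _ _ _ _ _ _ _ g^-1 1 0 0 1); rewrite ?invr_neq0 //.
  by rewrite mulr0 mulr1 subr0 oner_neq0.
by move=> *; rewrite /bil e0 a10 a2N; field.
Qed.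

(** A nonzero value of the form spans the line of the first coordinate and is carried to another
    value, so f preserves this line and acts on it by a scalar s. *)
Lemma elem_iso_inv0 a1 a2 g e a1' a2' g' e' :
  ~~ [&& a1 == 0, a2 == 0, g == 0 & e == 0] ->
  brace_isog (elemm (Pars 0 a1 a2 g e)) (elemm (Pars 0 a1' a2' g' e')) ->
  exists s m11 m12 m21 m22,
  [/\ s != 0, s * a1 = bil a1' a2' g' e' m11 m21 m11 m21,
    s * a2 = bil a1' a2' g' e' m12 m22 m11 m21,
    s * g = bil a1' a2' g' e' m11 m21 m12 m22 &
    s * e = bil a1' a2' g' e' m12 m22 m12 m22].
Proof.
move=> nz [f bf [fD fM]]; have fI := bij_inj bf.
pose q (v w : A) := bil a1 a2 g e v.1.2 v.2 w.1.2 w.2.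
pose q' (v w : A) := bil a1' a2' g' e' v.1.2 v.2 w.1.2 w.2.
have main v w : f (q v w, 0, 0) = (q' (f v) (f w), 0, 0).
  have := fM v w; rewrite /model /= !fD -!addrA => /addrI/addrI.
  rewrite !mul0r (_ : (0, 0, 0) = 0 :> A) // (morph0 fD) !addr0.
  by rewrite !qfE /= !(mulr0, mul0r, addr0) => <-.
have [v [w qvw]] : exists v w, q v w != 0.
  move: nz; rewrite !negb_and => /or4P[] n.
  - by exists (0, 1, 0), (0, 1, 0); rewrite /q /bil /= !(mulr0, mulr1, mul0r, addr0, add0r).
  - by exists (0, 0, 1), (0, 1, 0); rewrite /q /bil /= !(mulr0, mulr1, mul0r, addr0, add0r).
  - by exists (0, 1, 0), (0, 0, 1); rewrite /q /bil /= !(mulr0, mulr1, mul0r, addr0, add0r).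
  by exists (0, 0, 1), (0, 0, 1); rewrite /q /bil /= !(mulr0, mulr1, mul0r, addr0, add0r).
pose s := q' (f v) (f w) / q v w.
have fj1 u : f (u, 0, 0) = (s * u, 0, 0).
  have -> : ((u, 0, 0) : A) = (q v w, 0, 0) *+ (u / q v w : F).
    by rewrite !pair_mulrn !mul0rn -(mulr_natr (q v w)) natr_Zp mulrC divfK.
  rewrite (morphMn fD) main !pair_mulrn !mul0rn -(mulr_natr (q' _ _)) natr_Zp.
  by congr (_, _, _); rewrite /s; field.
have s0 : s != 0.
  apply/eqP => s0; have : f (1, 0, 0) = f 0 by rewrite fj1 s0 mul0r (morph0 fD).
  by move/fI/(congr1 (fun a : A => a.1.1)) => /= /eqP; rewrite oner_eq0.
have main2 v' w' : s * q v' w' = q' (f v') (f w').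
  by have /(congr1 (fun a : A => a.1.1)) /= := main v' w'; rewrite fj1.
pose u2 : A := (0, 1, 0); pose u3 : A := (0, 0, 1).
exists s, (f u2).1.2, (f u3).1.2, (f u2).2, (f u3).2; split => //.
- by have := main2 u2 u2; rewrite {1}/q {1}/bil /= !(mulr0, mulr1, mul0r, addr0, add0r).
- by have := main2 u3 u2; rewrite {1}/q {1}/bil /= !(mulr0, mulr1, mul0r, addr0, add0r).
- by have := main2 u2 u3; rewrite {1}/q {1}/bil /= !(mulr0, mulr1, mul0r, addr0, add0r).
- by have := main2 u3 u3; rewrite {1}/q {1}/bil /= !(mulr0, mulr1, mul0r, addr0, add0r).
Qed.

(* The determinant of the form and its skew part scale like [t ^ 2] and [t]. *)
Lemma elem_invariants a1 a2 g e a1' a2' g' e' :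
  ~~ [&& a1 == 0, a2 == 0, g == 0 & e == 0] ->
  brace_isog (elemm (Pars 0 a1 a2 g e)) (elemm (Pars 0 a1' a2' g' e')) ->
  exists s t, [/\ s != 0, s * (a2 - g) = t * (a2' - g'),
    s ^+ 2 * (a1 * e - a2 * g) = t ^+ 2 * (a1' * e' - a2' * g') &
    a1' = 0 -> e' = 0 -> a2' + g' = 0 -> e = 0].
Proof.
move=> nz /(elem_iso_inv0 nz) [s [m11 [m12 [m21 [m22 [s0 E1 E2 E3 E4]]]]]].
exists s, (m11 * m22 - m12 * m21); split => //.
- by rewrite mulrBr E2 E3 /bil; ring.
- transitivity (s * a1 * (s * e) - s * a2 * (s * g)); first by ring.
  by rewrite E1 E2 E3 E4 /bil; ring.
move=> z1 z2 z3; apply: (mulfI s0); rewrite E4 mulr0 /bil z1 z2.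
transitivity ((a2' + g') * m12 * m22); first by ring.
by rewrite z3 !mul0r.
Qed.

Lemma elem_ast_r (P : pars F) u v w : pa1 P * pb P = 0 ->
  ast (elemm P) u (ast (elemm P) v w) = (pa2 P * pb P * (u.2 * v.2 * w.2), 0, 0).
Proof.
move=> ab0; rewrite !astE /model /= !qfE; case: u v w => [[u1 u2] u3] [[v1 v2] v3] [[w1 w2] w3] /=.
congr (_, _, _) => /=; try ring.
transitivity (pa1 P * pb P * (u2 * v3 * w3) + pa2 P * pb P * (u3 * v3 * w3)); first by ring.
by rewrite ab0 mul0r add0r.
Qed.

Lemma elem_ast_l (P : pars F) u v w : pa1 P * pb P = 0 ->
  ast (elemm P) (ast (elemm P) u v) w = (pg P * pb P * (u.2 * v.2 * w.2), 0, 0).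
Proof.
move=> ab0; rewrite !astE /model /= !qfE; case: u v w => [[u1 u2] u3] [[v1 v2] v3] [[w1 w2] w3] /=.
congr (_, _, _) => /=; try ring.
transitivity (pa1 P * pb P * (u3 * v3 * w2) + pg P * pb P * (u3 * v3 * w3)); first by ring.
by rewrite ab0 mul0r add0r.
Qed.

Lemma ast_morph (B C : zmodType) (opB : B -> B -> B) (opC : C -> C -> C) f a b :
  brace_morphism opB opC f -> f (ast opB a b) = ast opC (f a) (f b).
Proof. by case=> fD fM; rewrite !astE !fD !(morphN fD) fM. Qed.

(** The triple products are evaluated at the preimage of (0, 0, 1). When g b = 1 on both sides, a2 b
    is the ratio of the right triple product to the left one, an additive relation that f
    respects. *)
Lemma elem_triple (P P' : pars F) : pa1 P * pb P = 0 -> pa1 P' * pb P' = 0 ->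
  brace_isog (elemm P) (elemm P') ->
  [/\ pa2 P * pb P = 0 -> pa2 P' * pb P' = 0,
      pg P * pb P = 0 -> pg P' * pb P' = 0 &
      pg P * pb P = 1 -> pg P' * pb P' = 1 -> pa2 P * pb P = pa2 P' * pb P'].
Proof.
move=> ab0 ab0' [f [h fK hK] fM]; pose u : A := (0, 0, 1).
have [fD _] := fM; have f0 : f 0 = 0 by apply: morph0.
have R a b c : f (ast (elemm P) a (ast (elemm P) b c)) = ast (elemm P') (f a) (ast (elemm P') (f b) (f c)).
  by rewrite !(ast_morph _ _ fM).
have L a b c : f (ast (elemm P) (ast (elemm P) a b) c) = ast (elemm P') (ast (elemm P') (f a) (f b)) (f c).
  by rewrite !(ast_morph _ _ fM).
split=> [z|z|z z'].
- have := R (h u) (h u) (h u); rewrite !elem_ast_r // !hK z mul0r (_ : (0, 0, 0) = 0 :> A) // f0.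
  by move/(congr1 (fun a : A => a.1.1)) => /= /esym; rewrite !mulr1.
- have := L (h u) (h u) (h u); rewrite !elem_ast_l // !hK z mul0r (_ : (0, 0, 0) = 0 :> A) // f0.
  by move/(congr1 (fun a : A => a.1.1)) => /= /esym; rewrite !mulr1.
have := L (h u) (h u) (h u); have := R (h u) (h u) (h u).
rewrite !elem_ast_r // !elem_ast_l // !hK z z' !mulr1 !mul1r; set x := (h u).2 * _ * _ => E1 E2.
have E3 : ((pa2 P * pb P * x, 0, 0) : A) = (x, 0, 0) *+ (pa2 P * pb P : F)%R.
  by rewrite !pair_mulrn !mul0rn -mulr_natl natr_Zp.
move: E1; rewrite E3 (morphMn fD) E2 => /(congr1 (fun a : A => a.1.1)).
by rewrite !pair_mulrn => E4; rewrite -[LHS]natr_Zp; exact: E4.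
Qed.

End ElemClassification.

(** * Uniqueness over (Z/(p))^3 *)

Section ElemUnique.
Variables (p : nat) (p_pr : prime p) (p_neq2 : p != 2%N).
Variables (eps : 'F_p) (eps_ns : forall u : 'F_p, u * u <> eps).
Local Notation F := 'F_p.
Local Notation elemm := (model (elem_frame p)).

(** Depends only on which triple products vanish. Kind 0 also contains b != 0 with a2 = g = 0, which
    [elem_swap] carries into b = 0. *)
Definition elem_kind (P : pars F) : nat :=
  if pg P * pb P != 0 then 1 else if pa2 P * pb P != 0 then 2 else 0.

(** A case analysis on this view yields index, parameters and kind together, so that pairs of
    different kinds are discarded by [discriminate]. *)
Inductive elem_spec : brace_index p -> pars F -> nat -> Prop :=
  | ElemSpec_s1_a : elem_spec (Elem_s1_a p) (Pars 0 0 (-1) 1 0) 0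
  | ElemSpec_s1_b l : (l <= p.-1./2)%N ->
      elem_spec (Elem_s1_b p l) (Pars 0 1 l%:R 0 1) 0
  | ElemSpec_s1_c l : (l <= p.-1./2)%N ->
      elem_spec (Elem_s1_c p l) (Pars 0 eps l%:R 0 1) 0
  | ElemSpec_s1_d c :
      elem_spec (Elem_s1_d c) (Pars 1 0 c 1 (- (c - 1) / 2%:R)) 1
  | ElemSpec_s2_a : elem_spec (Elem_s2_a p) (Pars 0 1 0 0 0) 0
  | ElemSpec_s2_b : elem_spec (Elem_s2_b p) (Pars 0 0 1 0 0) 0
  | ElemSpec_s2_c : elem_spec (Elem_s2_c p) (Pars 1 0 1 0 (- 1 / 2%:R)) 2
  | ElemSpec_s3 : elem_spec (Elem_s3 p) (Pars 0 0 0 0 0) 0.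

Lemma elem_tableP (i : brace_index p) P : allowed i -> elem_tab eps i = Some P ->
  elem_spec i P (elem_kind P).
Proof.
move=> al tab; suff [k sp <-] : exists2 k, elem_spec i P k & k = elem_kind P by [].
case: i al tab => [|||l|l|l||l|l|||||||||||l|l|l||||] //= al [<-];
  (eexists; first by [constructor]); rewrite /elem_kind /=;
  by rewrite ?mulr0 ?mulr1 ?eqxx ?oner_eq0.
Qed.

(** The lines of kind 0 have b = 0 and are mostly separated by whether the determinant, the skew
    part and the diagonal of the form vanish; where these agree, the square class of the determinant
    distinguishes 1 from eps. *)
Lemma elem_unique (i i' : brace_index p) P P' : allowed i -> allowed i' ->
  elem_tab eps i = Some P -> elem_tab eps i' = Some P' ->
  brace_isog (elemm P) (elemm P') -> i = i'.
Proof.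
move=> al al' tab tab' iso; have iso' := brace_isog_sym iso.
have [T1 T2 T3] := elem_triple (elem_table_ab0 tab) (elem_table_ab0 tab') iso.
have K : elem_kind P = elem_kind P'.
  have [T1' T2' _] := elem_triple (elem_table_ab0 tab') (elem_table_ab0 tab) iso'.
  rewrite /elem_kind (_ : (pg P * pb P == 0) = (pg P' * pb P' == 0)).
    by rewrite (_ : (pa2 P * pb P == 0) = (pa2 P' * pb P' == 0)) //; apply/eqP/eqP.
  by apply/eqP/eqP.
have T4 c c' : P = Pars 1 0 c 1 (- (c - 1) / 2%:R) ->
    P' = Pars 1 0 c' 1 (- (c' - 1) / 2%:R) -> c = c'.
  by move=> E E'; move: T3; rewrite E E' !mulr1; apply.
move=> {T1 T2 T3}.
have e0 := eps_neq0 eps_ns; have n1 := oner_neq0 F.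
have V1 a1 a2 g e a1' a2' g' e' := @elem_invariants p a1 a2 g e a1' a2' g' e'.
have sq (x : F) : x != 0 -> x ^+ 2 != 0 by move=> x0; rewrite expf_neq0.
have ns s t : s != 0 -> s ^+ 2 * eps = t ^+ 2 -> False.
  by move=> s0; apply: (square_neq eps_ns s0).
have det0 (a1 a2 g e a1' a2' g' e' : F) : ~~ [&& a1 == 0, a2 == 0, g == 0 & e == 0] ->
    a1 * e - a2 * g != 0 -> a1' * e' - a2' * g' = 0 ->
    brace_isog (elemm (Pars 0 a1 a2 g e)) (elemm (Pars 0 a1' a2' g' e')) -> False.
  move=> nz d0 d0' /(V1 _ _ _ _ _ _ _ _ nz) [s [t [s0 _ E _]]].
  move/eqP: E; rewrite d0' mulr0 mulf_eq0 (negPf d0) orbF expf_eq0 /=.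
  by rewrite (negPf s0).
have skew0 (a1 a2 g e a1' a2' g' e' : F) : ~~ [&& a1 == 0, a2 == 0, g == 0 & e == 0] ->
    a2 != g -> a2' = g' ->
    brace_isog (elemm (Pars 0 a1 a2 g e)) (elemm (Pars 0 a1' a2' g' e')) -> False.
  move=> nz d0 d0' /(V1 _ _ _ _ _ _ _ _ nz) [s [t [s0 E _ _]]].
  by move/eqP: E; rewrite d0' subrr mulr0 mulf_eq0 (negPf s0) subr_eq0 (negPf d0).
have alt0 (a1 a2 g e a2' g' : F) : e != 0 -> a2' + g' = 0 ->
    brace_isog (elemm (Pars 0 a1 a2 g e)) (elemm (Pars 0 0 a2' g' 0)) -> False.
  move=> ee z /(V1 _ _ _ _ _ _ _ _ _) [|s [t [s0 _ _ E]]].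
    by rewrite (negPf ee) !andbF.
  by move/eqP: ee; apply; apply: E.
have zero0 : brace_isog (elemm (Pars 0 1 0 0 0)) (elemm (Pars 0 0 0 0 0)) -> False.
  case/elem_iso_inv0 => [|s [? [? [? [? [s0 E _ _ _]]]]]]; first by rewrite (negPf n1).
  by move/eqP: E; rewrite /bil mulr1 !(mul0r, addr0) (negPf s0).
have same (a a' : F) l l' : a != 0 ->
    brace_isog (elemm (Pars 0 a l 0 1)) (elemm (Pars 0 a' l' 0 1)) ->
    exists s t, [/\ s != 0, s * l = t * l' & s ^+ 2 * a = t ^+ 2 * a'].
  move=> a0 /(V1 _ _ _ _ _ _ _ _ _) [|s [t [s0 E1 E2 _]]]; first by rewrite (negPf a0).
  exists s, t; split; first exact: s0.
    by move: E1; rewrite !subr0.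
  by move: E2; rewrite !mulr0 !subr0 !mulr1.
(* The skew part scales by a factor and the determinant by its square, so equal determinants leave
   the square of the label unchanged. *)
have samel (a : F) (l0 l0' : nat) : a != 0 -> (l0 <= p.-1./2)%N -> (l0' <= p.-1./2)%N ->
    brace_isog (elemm (Pars 0 a l0%:R 0 1)) (elemm (Pars 0 a l0'%:R 0 1)) -> l0 = l0'.
  move=> a0 lp lp' /(same _ _ _ _ a0) [s [t [s0 E1 E2]]].
  apply: (half_range_inj p_pr p_neq2 lp lp'); apply: (mulfI (sq _ s0)).
  by rewrite -exprMn E1 exprMn; congr (_ * _); apply: (mulIf a0).
have detq (a l a1' a2' : F) : a != 0 ->
    brace_isog (elemm (Pars 0 a l 0 1)) (elemm (Pars 0 a1' a2' 0 0)) -> False.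
  move=> a0; apply: det0; first by rewrite (negPf a0).
    by rewrite mulr1 mulr0 subr0.
  by rewrite !mulr0 subr0.
have deta (a1' a2' : F) :
    brace_isog (elemm (Pars 0 0 (-1) 1 0)) (elemm (Pars 0 a1' a2' 0 0)) -> False.
  apply: det0; first by rewrite (negPf n1) !andbF.
    by rewrite mulr0 sub0r mulr1 opprK.
  by rewrite !mulr0 subr0.
have skewb (a : F) :
    brace_isog (elemm (Pars 0 0 1 0 0)) (elemm (Pars 0 a 0 0 0)) -> False.
  by apply: skew0; rewrite ?(negPf n1) ?andbF.
case: (elem_tableP al tab) iso iso' K T4 => [|l lp|l lp|c||||];
case: (elem_tableP al' tab') => [|l' lp'|l' lp'|c'||||] iso iso' K T4.
all: try discriminate K; try reflexivity.
- by exfalso; apply: alt0 iso'; rewrite ?addNr.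
- by exfalso; apply: alt0 iso'; rewrite ?addNr.
- by case: (deta _ _ iso).
- by case: (deta _ _ iso).
- by case: (deta _ _ iso).
- by exfalso; apply: alt0 iso; rewrite ?addNr.
- by congr Elem_s1_b; apply: samel iso.
- by exfalso; have [s [t [s0 _ E]]] := same _ _ _ _ e0 iso'; apply: (ns s t s0); rewrite E mulr1.
- by case: (detq _ _ _ _ n1 iso).
- by case: (detq _ _ _ _ n1 iso).
- by case: (detq _ _ _ _ n1 iso).
- by exfalso; apply: alt0 iso; rewrite ?addNr.
- by exfalso; have [s [t [s0 _ E]]] := same _ _ _ _ e0 iso; apply: (ns s t s0); rewrite E mulr1.
- by congr Elem_s1_c; apply: samel iso.
- by case: (detq _ _ _ _ e0 iso).
- by case: (detq _ _ _ _ e0 iso).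
- by case: (detq _ _ _ _ e0 iso).
- by rewrite (T4 _ _ erefl erefl).
- by case: (deta _ _ iso').
- by case: (detq _ _ _ _ n1 iso').
- by case: (detq _ _ _ _ e0 iso').
- by case: (skewb _ iso').
- by case: (zero0 iso).
- by case: (deta _ _ iso').
- by case: (detq _ _ _ _ n1 iso').
- by case: (detq _ _ _ _ e0 iso').
- by case: (skewb _ iso).
- by case: (skewb _ iso).
- by case: (deta _ _ iso').
- by case: (detq _ _ _ _ n1 iso').
- by case: (detq _ _ _ _ e0 iso').
- by case: (zero0 iso').
- by case: (skewb _ iso').
Qed.

End ElemUnique.

(** * The classification *)

Lemma socle_isog (A B : finZmodType) (opA : A -> A -> A) (opB : B -> B -> B) :
  brace_isog opA opB -> #|socle opA| = #|socle opB|.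
Proof.
case=> f [g fK gK] [fD fM].
have lam a b : f (brace_lambda opA a b) = brace_lambda opB (f a) (f b).
  by rewrite /brace_lambda fD (morphN fD) fM.
rewrite -(card_imset _ (can_inj fK)); apply: eq_card => y.
apply/imsetP/idP => [[a]|].
  rewrite !inE => /forallP H ->; apply/forallP => b.
  by rewrite -(gK b) -lam (eqP (H _)).
rewrite inE => /forallP H; exists (g y); last by rewrite gK.
by rewrite inE; apply/forallP => b; rewrite -(can_eq fK) lam gK.
Qed.

Lemma mulrn_isog (A B : zmodType) (opA : A -> A -> A) (opB : B -> B -> B) n :
  brace_isog opA opB -> (forall x : A, x *+ n = 0) -> forall y : B, y *+ n = 0.
Proof.
case=> f [g fK gK] [fD _] An y.
by rewrite -(gK y) -(morphMn fD) An (morph0 fD).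
Qed.

Section Table.
Variables (p : nat) (p_pr : prime p) (p_neq2 : p != 2%N).
Variables (eps : 'F_p) (eps_ns : forall u : 'F_p, u * u <> eps).

Definition cyc_tab (i : brace_index p) : option nat :=
  match i with
  | Cyc_s1 => Some 1 | Cyc_s2 => Some 2 | Cyc_s3 => Some 3 | _ => None
  end.

Lemma index_cases (i : brace_index p) : [\/ exists k, cyc_tab i = Some k,
  exists P, mix_tab eps i = Some P | exists P, elem_tab eps i = Some P].
Proof.
by case: i => [|||l|l|l||l|l|||||||||||l|l|l||||] /=;
  first [by apply: Or31; eexists | by apply: Or32; eexists | by apply: Or33; eexists].
Qed.

Lemma cyc_table_op (i : brace_index p) k : cyc_tab i = Some k ->
  (1 <= k <= 3)%N /\
  exists op, brace_table eps i = @BraceEntry 'Z_(p ^ 3) op (p ^ k) (is_Zp3 p) /\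
    (forall a b, op a b = cyc_op (p ^ k)%N%:R a b).
Proof.
case: i => [|||l|l|l||l|l|||||||||||l|l|l||||] //= [<-]; split => //;
  eexists; split; try reflexivity; move=> a b; rewrite /cyc_op //.
by rewrite Zp3_p3 // !mul0r addr0.
Qed.

Lemma cyc_table_correct (i : brace_index p) k : cyc_tab i = Some k ->
  let E := brace_table eps i in
  [/\ left_brace (@entry_mul E), #|entry_carrier E| = (p ^ 3)%N,
      #|socle (@entry_mul E)| = entry_socle_order E
    & mul_group_type (@entry_mul E) (entry_mul_type E)].
Proof.
move=> tab /=; have [/andP[k1 k3] [op [-> /= E]]] := cyc_table_op tab.
have Ek : (p ^ k)%N%:R = p%:R * (p ^ k.-1)%N%:R :> 'Z_(p ^ 3).
  by rewrite -natrM -expnS prednK.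
split.
- by apply: left_brace_eq (cyc_brace (cyc_s3 p_pr (p ^ k.-1)%N%:R)) => a b; rewrite E Ek.
- exact: card_Zp3.
- by rewrite (socle_eq E) cyc_socle card_pk_torsion.
- by apply: mul_group_type_eq E _; rewrite Ek; apply: cyc_mul_group.
Qed.

Lemma cyc_isog (i : brace_index p) k : cyc_tab i = Some k ->
  brace_isog (@cyc_op p (p ^ k)%N%:R) (@entry_mul (brace_table eps i)).
Proof.
by move/cyc_table_op => [_ [op [-> /= E]]]; apply: brace_isog_eq => a b; rewrite E.
Qed.

Lemma mix_isog (i : brace_index p) P : mix_tab eps i = Some P ->
  brace_isog (model (mix_frame p_pr) P) (@entry_mul (brace_table eps i)).
Proof.
move/(mix_table_op p_pr p_neq2) => [op [s [K [-> /= E]]]].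
by apply: brace_isog_eq => a b; rewrite E.
Qed.

Lemma elem_isog (i : brace_index p) P : elem_tab eps i = Some P ->
  brace_isog (model (elem_frame p) P) (@entry_mul (brace_table eps i)).
Proof.
move/(elem_table_op p_pr p_neq2) => [op [s [K [-> /= E]]]].
by apply: brace_isog_eq => a b; rewrite E.
Qed.

Lemma table_exists (B : finZmodType) (op : B -> B -> B) :
  left_brace op -> #|B| = (p ^ 3)%N ->
  exists i : brace_index p, allowed i /\ brace_isog op (@entry_mul (brace_table eps i)).
Proof.
move=> brB oB; case: (pickP (fun y : B => y *+ (p ^ 2) != 0)) => [y yp2|noy].
  have [k k13 iso] := cyc_classification p_pr p_neq2 brB oB yp2.
  have [i [al tab]] : exists i, allowed i /\ cyc_tab i = Some k.
    case: k k13 {iso} => [|[|[|[|]]]] //= _.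
    - by exists (Cyc_s1 p).
    - by exists (Cyc_s2 p).
    - by exists (Cyc_s3 p).
  by exists i; split => //; apply: brace_isog_trans iso (cyc_isog tab).
have exp_p2 (x : B) : x *+ (p ^ 2) = 0 by have /negbFE/eqP := noy x.
case: (noncyclic_model brB p_pr p_neq2 oB exp_p2) => -[P ab0 iso].
  have [i [P' [al tab iso']]] := elem_exists p_pr p_neq2 eps_ns ab0.
  exists i; split => //; apply: brace_isog_trans iso _.
  exact: brace_isog_trans iso' (elem_isog tab).
have [i [P' [al tab iso']]] := mix_exists p_pr p_neq2 eps_ns ab0.
exists i; split => //; apply: brace_isog_trans iso _.
exact: brace_isog_trans iso' (mix_isog tab).
Qed.

(** The exponents p^3, p^2 and p of the additive group tell the three families apart, and the order
    of the socle tells the cyclic braces apart. *)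
Lemma table_unique (i i' : brace_index p) : allowed i -> allowed i' ->
  brace_isog (@entry_mul (brace_table eps i)) (@entry_mul (brace_table eps i')) ->
  i = i'.
Proof.
have cycP : ~ forall x : 'Z_(p ^ 3), x *+ (p ^ 2) = 0.
  by move/(_ 1)/eqP; rewrite (negPf (Zp3_p2_neq0 p_pr)).
have mixP : ~ forall x : 'F_p * 'Z_(p ^ 2), x *+ p = 0.
  move/(_ (0, 1)); rewrite pair_mulrn => /(congr1 snd) /= /(congr1 (@nat_of_ord _)).
  rewrite Zp2_val_nat // modn_small; last by rewrite expnS expn1 ltn_Pmull ?prime_gt1 ?prime_gt0.
  by move=> p0; have := prime_gt0 p_pr; rewrite p0.
have mixE := mix_exp_p2 p_pr; have elemE := elem_mulrn_p p_pr; have elemE2 := elem_exp_p2 p_pr.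
move=> al al' iso.
case: (index_cases i) => -[u tab]; case: (index_cases i') => -[u' tab'].
- have := brace_isog_trans (cyc_isog tab) (brace_isog_trans iso (brace_isog_sym (cyc_isog tab'))).
  have [k1 _] := cyc_table_op tab; have [k1' _] := cyc_table_op tab'.
  move/socle_isog; rewrite !cyc_socle !card_pk_torsion //; [|by case/andP: k1'|by case/andP: k1].
  move/eqP; rewrite eqn_exp2l ?prime_gt1 // => /eqP uu'.
  move: tab tab'; rewrite uu'; case: (i) => [|||l|l|l||l|l|||||||||||l|l|l||||] //= [<-];
   by case: (i') => [|||l'|l'|l'||l'|l'|||||||||||l'|l'|l'||||] //=.
- have := brace_isog_trans (cyc_isog tab) (brace_isog_trans iso (brace_isog_sym (mix_isog tab'))).
  by move/brace_isog_sym/mulrn_isog/(_ mixE)/cycP.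
- have := brace_isog_trans (cyc_isog tab) (brace_isog_trans iso (brace_isog_sym (elem_isog tab'))).
  by move/brace_isog_sym/mulrn_isog/(_ elemE2)/cycP.
- have := brace_isog_trans (mix_isog tab) (brace_isog_trans iso (brace_isog_sym (cyc_isog tab'))).
  by move/mulrn_isog/(_ mixE)/cycP.
- have := brace_isog_trans (mix_isog tab) (brace_isog_trans iso (brace_isog_sym (mix_isog tab'))).
  exact: (mix_unique p_neq2 eps_ns al al' tab tab').
- have := brace_isog_trans (mix_isog tab) (brace_isog_trans iso (brace_isog_sym (elem_isog tab'))).
  by move/brace_isog_sym/mulrn_isog/(_ elemE)/mixP.
- have := brace_isog_trans (elem_isog tab) (brace_isog_trans iso (brace_isog_sym (cyc_isog tab'))).
  by move/mulrn_isog/(_ elemE2)/cycP.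
- have := brace_isog_trans (elem_isog tab) (brace_isog_trans iso (brace_isog_sym (mix_isog tab'))).
  by move/mulrn_isog/(_ elemE)/mixP.
- have := brace_isog_trans (elem_isog tab) (brace_isog_trans iso (brace_isog_sym (elem_isog tab'))).
  exact: (elem_unique p_pr p_neq2 eps_ns al al' tab tab').
Qed.

End Table.

Theorem theorem3p2 (p : nat) (eps : 'F_p) (p_prime : prime p)
    (p_neq2 : p != 2%N) (eps_nonsquare : forall u : 'F_p, u * u <> eps) :
  (forall i : brace_index p, allowed i ->
     let E := brace_table eps i in
     [/\ left_brace (@entry_mul E),
         #|entry_carrier E| = (p ^ 3)%N,
         #|socle (@entry_mul E)| = entry_socle_order E
       & mul_group_type (@entry_mul E) (entry_mul_type E)])
  /\
  (forall (B : finZmodType) (op : B -> B -> B),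
     left_brace op -> #|B| = (p ^ 3)%N ->
     exists! i : brace_index p,
       allowed i /\ brace_isog op (@entry_mul (brace_table eps i))).
Proof.
split=> [i al|B op brB oB].
  case: (index_cases eps i) => -[u tab].
  - exact: (cyc_table_correct p_prime p_neq2 eps tab).
  - exact: (mix_table_correct p_prime p_neq2 eps_nonsquare al tab).
  - exact: (elem_table_correct p_prime p_neq2 eps_nonsquare al tab).
have [i [al iso]] := table_exists p_prime p_neq2 eps_nonsquare brB oB.
exists i; split => // i' [al' iso'].
apply: (table_unique p_prime p_neq2 eps_nonsquare al al').
exact: brace_isog_trans (brace_isog_sym iso) iso'.
Qed.
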